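(* Let $\Gamma$ be an infinite set, let $E$ be either $c_0(\Gamma)$ or $\ell_p(\Gamma)$ for some $1\le p<\infty$ (over $\mathbb{C}$), and put $\kappa=|\Gamma|$. Then $$\mathcal{M}_E=\mathcal{K}_\kappa(E),$$ where $\mathcal{K}_\kappa(E)$ denotes the ideal of $\kappa$-compact operators on $E$. Moreover, for every $a\in\mathcal{B}(E)/\mathcal{K}_\kappa(E)$ with $\|a\|=1$, $$C_{\mathrm{pi}}^{\mathcal{B}(E)/\mathcal{K}_\kappa(E)}(a)=1.$$ Consequently, for every countably incomplete ultrafilter $\mathcal{U}$, the ultrapower $\bigl(\mathcal{B}(E)/\mathcal{M}_E\bigr)^{\mathcal{U}}$ is purely infinite.
   Context: For a Banach space $E$, $\mathcal{B}(E)$ denotes the Banach algebra of bounded linear operators on $E$ and $\mathrm{Id}_E$ the identity operator. $\mathrm{Id}_E$ factors through $T\in\mathcal{B}(E)$ if there are $U,V\in\mathcal{B}(E)$ with $UTV=\mathrm{Id}_E$, and $\mathcal{M}_E=\{T\in\mathcal{B}(E): \mathrm{Id}_E \text{ does not factor through } T\}$. For $E=c_0(\Gamma)$ or $\ell_p(\Gamma)$ and an infinite cardinal $\kappa$, the $\kappa$-compact operators are understood in the ''fewer than $\kappa$ coordinates'' sense: $T\in\mathcal{K}_\kappa(E)$ if and only if for every $\varepsilon>0$ there is $A\subseteq\Gamma$ with $|A|<\kappa$ and $\|T-P_AT\|\le\varepsilon$, where $P_A$ is the canonical coordinate projection onto the vectors supported in $A$. (For $\kappa=\aleph_0$ these are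 the compact operators.) The quotient $\mathcal{B}(E)/\mathcal{K}_\kappa(E)$ carries the quotient norm. For a unital Banach algebra $A$ and $a\in A\setminus\{0\}$, $C_{\mathrm{pi}}^A(a)=\inf\{\|b\|\,\|c\|: b,c\in A,\ bac=1_A\}$, with value $\infty$ if no such $b,c$ exist. A unital complex Banach algebra $A$ is purely infinite if $A\not\simeq\mathbb{C}$ and for every non-zero $a\in A$ there exist $b,c\in A$ with $bac=1_A$. For an ultrafilter $\mathcal{U}$ on a set $I$, the ultrapower $(A)^{\mathcal{U}}$ is the quotient Banach algebra of $\ell_\infty(I,A)$ by the closed ideal $\{(a_i): \lim_{i\to\mathcal{U}}\|a_i\|=0\}$. $\mathcal{U}$ is countably incomplete if some sequence of members of $\mathcal{U}$ has empty intersection. *)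

(* Defs.v *)
From HB Require Import structures.
From mathcomp Require Import all_boot all_order all_algebra.
From mathcomp Require Import generic_quotient ring_quotient.
From mathcomp Require Import all_classical all_reals all_analysis.
From mathcomp Require Import complex ring lra.

Set Implicit Arguments.
Unset Strict Implicit.
Unset Printing Implicit Defensive.

Import Order.TTheory GRing.Theory Num.Theory.
Import numFieldNormedType.Exports.
Local Open Scope classical_set_scope.
Local Open Scope card_scope.
Local Open Scope complex_scope.
Local Open Scope quotient_scope.
Local Open Scope ring_scope.

Section RealNorm.
Variable R : realType.
Implicit Types V : normedZmodType R[i].

(* The library's norm of a complex normed space takes its values in [R[i]];
   [nrm x] is the same number, seen in [R]. *)
Definition nrm V (x : V) : R := complex.Re `|x|.

Lemma nrmE V (x : V) : `|x| = (nrm x)%:C.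
Proof. by rewrite /nrm RRe_real// normr_real. Qed.

Lemma nrm_ge0 V (x : V) : 0 <= nrm x.
Proof. by rewrite -lecR -nrmE normr_ge0. Qed.

Lemma nrm0 V : nrm (0 : V) = 0.
Proof. by rewrite /nrm normr0. Qed.

Lemma nrm_eq0 V (x : V) : nrm x = 0 -> x = 0.
Proof. by move=> x0; apply/normr0_eq0; rewrite nrmE x0. Qed.

Lemma nrmD V (x y : V) : nrm (x + y) <= nrm x + nrm y.
Proof. by rewrite -lecR rmorphD/= -!nrmE ler_normD. Qed.

Lemma nrmN V (x : V) : nrm (- x) = nrm x.
Proof. by rewrite /nrm normrN. Qed.

Lemma nrmB V (x y : V) : nrm (x - y) = nrm (y - x).
Proof. by rewrite /nrm distrC. Qed.

Lemma nrm_split V (z x y : V) : nrm (x - y) <= nrm (x - z) + nrm (z - y).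
Proof. by rewrite (le_trans _ (nrmD _ _))// addrA subrK. Qed.

Lemma nrmZ (V : normedModType R[i]) (l : R[i]) (x : V) :
  nrm (l *: x) = nrm l * nrm x.
Proof. by apply: complexI; rewrite rmorphM/= -!nrmE normrZ. Qed.

Lemma nrmC_ge (z : R[i]) : `|complex.Re z| <= nrm z /\ `|complex.Im z| <= nrm z.
Proof.
case: z => a b; rewrite /nrm normc_def/=; split.
  by rewrite -sqrtr_sqr ler_sqrt ?addr_ge0 ?sqr_ge0// lerDl sqr_ge0.
by rewrite -sqrtr_sqr ler_sqrt ?addr_ge0 ?sqr_ge0// lerDr sqr_ge0.
Qed.

Lemma nrmC_le (z : R[i]) : nrm z <= `|complex.Re z| + `|complex.Im z|.
Proof.
case: z => a b; rewrite /nrm normc_def/=.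
rewrite -[leRHS]ger0_norm ?addr_ge0// -sqrtr_sqr ler_sqrt ?sqr_ge0//.
by rewrite sqrrD !real_normK ?num_real// addrAC lerDl mulrn_wge0// mulr_ge0.
Qed.

Lemma nrm_real (r : R) : nrm r%:C = `|r|.
Proof. by rewrite /nrm normc_def/= expr0n/= addr0 sqrtr_sqr. Qed.

Lemma nrmM1 (l m : R[i]) : nrm (l * m) = nrm l * nrm m.
Proof. by apply: complexI; rewrite rmorphM/= -!nrmE normrM. Qed.

End RealNorm.

Section Complete.
Variable R : realType.

Definition dyad (n : nat) : R := 2^-1 ^+ n.

Lemma dyad_gt0 n : 0 < dyad n. Proof. by rewrite exprn_gt0. Qed.

Lemma dyad_le m n : (m <= n)%N -> dyad n <= dyad m.
Proof.
move=> mn; rewrite /dyad ler_wiXn2l// ?invr_ge0// invf_le1// ler1n//.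
Qed.

Lemma dyad_small (e : R) : 0 < e -> exists N, forall n, (N <= n)%N -> dyad n <= e.
Proof.
move=> e0.
have : (fun n => dyad n) @ \oo --> (0 : R).
  by apply: cvg_expr; rewrite ger0_norm ?invr_ge0// invf_lt1// ltr1n.
move=> /cvgrPdist_le /(_ e e0) [N _ H]; exists N => n Nn.
by have := H n Nn; rewrite sub0r normrN ger0_norm// ltW// dyad_gt0.
Qed.

Definition fast (V : zmodType) (N : V -> R) (u : nat -> V) :=
  forall m n, (m <= n)%N -> N (u n - u m) <= dyad m.

Definition seq_lim (V : zmodType) (N : V -> R) (u : nat -> V) (l : V) :=
  forall e : R, 0 < e -> exists n0, forall n, (n0 <= n)%N -> N (l - u n) <= e.

Lemma fast_limit (V : zmodType) (N : V -> R) (u : nat -> V) l :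
  (forall x y, N (x + y) <= N x + N y) -> fast N u -> seq_lim N u l ->
  forall m, N (l - u m) <= dyad m.
Proof.
move=> ND fu H m; apply/ler_addgt0Pl => e e0.
have [n0 /(_ (maxn n0 m) (leq_maxl _ _)) Hn] := H _ e0.
have -> : l - u m = (l - u (maxn n0 m)) + (u (maxn n0 m) - u m).
  by rewrite addrA subrK.
by rewrite (le_trans (ND _ _))// lerD// fu// leq_maxr.
Qed.

Lemma dyad_lim (V : zmodType) (N : V -> R) (u : nat -> V) l :
  (forall m, N (l - u m) <= dyad m) -> seq_lim N u l.
Proof.
move=> H e /dyad_small[n0 Hn0]; exists n0 => n /Hn0; exact: le_trans.
Qed.

Lemma real_fast (x : nat -> R) :
  (forall m n, (m <= n)%N -> `|x n - x m| <= dyad m) ->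
  exists l, forall m, `|l - x m| <= dyad m.
Proof.
move=> fx.
have xy m n : x m - dyad m <= x n + dyad n.
  have [mn|/ltnW nm] := leqP m n.
    have := fx _ _ mn; rewrite ler_norml => /andP[+ _].
    by rewrite lerBrDl => /le_trans -> //; rewrite lerDl ltW ?dyad_gt0.
  have := fx _ _ nm; rewrite ler_norml => /andP[_].
  by rewrite lerBlDl => h; rewrite (le_trans _ h)// gerBl ltW ?dyad_gt0.
pose S := range (fun n => x n - dyad n).
have S0 : S !=set0 by exists (x 0%N - dyad 0), 0%N.
exists (sup S) => m; rewrite ler_distl; apply/andP; split.
  apply: ub_le_sup; last by exists m.
  by exists (x 0%N + dyad 0) => _ [n _ <-].
by apply: ge_sup => // _ [n _ <-].
Qed.

Lemma complex_fast (z : nat -> R[i]) : fast (@nrm R _) z ->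
  exists l, forall m, nrm (l - z m) <= dyad m.
Proof.
move=> fz.
have [|a Ha] := @real_fast (fun n => complex.Re (z n)).
  move=> m n mn; rewrite (le_trans _ (fz _ _ mn))//.
  by rewrite (le_trans _ (proj1 (nrmC_ge _)))// raddfB.
have [|b Hb] := @real_fast (fun n => complex.Im (z n)).
  move=> m n mn; rewrite (le_trans _ (fz _ _ mn))//.
  by rewrite (le_trans _ (proj2 (nrmC_ge _)))// raddfB.
exists (a +i* b); apply: (@fast_limit _ (@nrm R _)) => //; [exact: nrmD|move=> e e0].
have [|N HN] := @dyad_small (e / 2); first by rewrite divr_gt0.
exists N => n Nn; rewrite (le_trans (nrmC_le _))// [leRHS]splitr.
rewrite lerD// ?raddfB/=.
  by rewrite (le_trans (Ha _))// HN.
by rewrite (le_trans (Hb _))// HN.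
Qed.

Definition cauchy_for (V : zmodType) (N : V -> R) (u : nat -> V) :=
  forall e : R, 0 < e -> exists n0, forall m n,
    (n0 <= m)%N -> (n0 <= n)%N -> N (u m - u n) <= e.

Lemma fast_cauchy (V : zmodType) (N : V -> R) (u : nat -> V) :
  (forall x, N (- x) = N x) -> fast N u -> cauchy_for N u.
Proof.
move=> NN fu e /dyad_small[n0 H]; exists n0 => m n hm hn.
have [mn|/ltnW nm] := leqP m n.
  by rewrite -opprB NN (le_trans (fu _ _ mn))// H.
by rewrite (le_trans (fu _ _ nm))// H.
Qed.

Lemma fast_complete_for (V : zmodType) (N : V -> R) :
  (forall x y, N (x + y) <= N x + N y) ->
  (forall u, fast N u -> exists l, seq_lim N u l) ->
  forall u, cauchy_for N u -> exists l, seq_lim N u l.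
Proof.
move=> ND H u cu.
have hk k : exists n0, forall m n, (n0 <= m)%N -> (n0 <= n)%N ->
    N (u m - u n) <= dyad k by apply/cu/dyad_gt0.
have [f Hf] := choice hk.
pose M k := (\max_(j < k.+1) f j)%N.
have Mf k : (f k <= M k)%N by exact: (@leq_bigmax _ (fun j : 'I_k.+1 => f j) ord_max).
have Mle m n : (m <= n)%N -> (M m <= M n)%N.
  move=> mn; apply/bigmax_leqP => j _.
  have jn : (j < n.+1)%N by rewrite (leq_trans (ltn_ord j)).
  exact: (@leq_bigmax _ (fun j : 'I_n.+1 => f j) (Ordinal jn)).
have fv : fast N (u \o M).
  move=> m n mn; apply: Hf => //=; exact: leq_trans (Mf m) (Mle _ _ mn).
have [l Hl] := H _ fv; exists l => e e0.
have e20 : 0 < e / 2 by rewrite divr_gt0.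
have [a Ha] := Hl _ e20; have [b Hb] := dyad_small e20.
pose k := maxn a b; exists (M k) => n nk.
have -> : l - u n = (l - u (M k)) + (u (M k) - u n) by rewrite addrA subrK.
rewrite (le_trans (ND _ _))// [leRHS]splitr lerD//.
  by apply: Ha; rewrite leq_maxl.
rewrite (le_trans (Hf k _ _ _ _))//; first exact: leq_trans nk.
by rewrite Hb// leq_maxr.
Qed.

Lemma fast_complete (V : normedModType R[i]) :
  (forall u : nat -> V, fast (@nrm R V) u -> exists l, seq_lim (@nrm R V) u l) ->
  forall F : set_system V, ProperFilter F -> cauchy F -> cvg F.
Proof.
move=> H F FF cF; apply/cvg_ex.
have hx n : exists x, F (ball x (dyad n / 2)%:C).
  have /cauchyP := cF; apply.
  by rewrite ltcR divr_gt0// dyad_gt0.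
have [u Hu] := choice hx.
have fu : fast (@nrm R V) u.
  move=> m n mn.
  have [y [ym yn]] := filter_ex (filterI (Hu m) (Hu n)).
  rewrite (le_trans (nrm_split y _ _))// [leRHS]splitr addrC lerD//.
    move: ym; rewrite -ball_normE/= nrmE ltcR => /ltW.
    by rewrite nrmB.
  move: yn; rewrite -ball_normE/= nrmE ltcR => /ltW /le_trans; apply.
  by rewrite ler_pM2r ?invr_gt0// dyad_le.
have [l Hl] := H u fu; exists l.
apply/cvgrPdist_le => e e0.
have eE : e = (complex.Re e)%:C by rewrite RRe_real// gtr0_real.
have e0' : 0 < complex.Re e / 2 by rewrite divr_gt0// -ltcR -eE.
have [N HN] := Hl _ e0'; have [M HM] := dyad_small e0'.
pose n := maxn N M.
apply: filterS (Hu n) => y.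
rewrite -ball_normE/= nrmE ltcR => yn.
rewrite eE nrmE lecR (le_trans (nrm_split (u n) _ _))// [leRHS]splitr.
rewrite lerD ?HN ?leq_maxl// (le_trans (ltW yn))//.
apply: le_trans (HM n (leq_maxr _ _)).
by rewrite ler_pdivrMr// ler_peMr// ?ler1n// ltW// dyad_gt0.
Qed.

Lemma complete_seq (V : completeNormedModType R[i]) (u : nat -> V) :
  cauchy_for (@nrm R V) u -> exists l, seq_lim (@nrm R V) u l.
Proof.
move=> cu; pose G : set_system V := u @ \oo.
have : cauchy G.
  apply/cauchyP => e e0.
  have eE : e = (complex.Re e)%:C by rewrite RRe_real// gtr0_real.
  have e0' : 0 < complex.Re e / 2 by rewrite divr_gt0// -ltcR -eE.
  have [n0 H] := cu _ e0'.
  exists (u n0); exists n0 => //= n /= Nn.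
  rewrite -ball_normE/= nrmE eE ltcR.
  rewrite (le_lt_trans (H _ _ _ Nn))//.
  by rewrite ltr_pdivrMr// ltr_pMr ?ltr1n// -ltcR -eE.
move=> /cauchy_cvg/cvg_ex[/= l Hl]; exists l => e e0.
have e0' : 0 < e%:C by rewrite ltcR.
have /cvgrPdist_le/(_ _ e0')[n0 _ Hn0] := Hl.
by exists n0 => n /Hn0/=; rewrite nrmE lecR.
Qed.

End Complete.

(* A real-valued norm [N] gives the library's [R[i]]-valued one. *)
Section NormFactory.
Variables (R : realType) (V : lmodType R[i]) (N : V -> R).
Hypothesis ND : forall x y, N (x + y) <= N x + N y.
Hypothesis NZ : forall (l : R[i]) x, N (l *: x) = nrm l * N x.
Hypothesis N0 : forall x, N x = 0 -> x = 0.

Definition cnorm (x : V) : R[i] := (N x)%:C.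

Lemma cnormD x y : cnorm (x + y) <= cnorm x + cnorm y.
Proof. by rewrite -rmorphD/= lecR. Qed.

Lemma cnormZ (l : R[i]) x : cnorm (l *: x) = `|l| * cnorm x.
Proof. by rewrite /cnorm NZ rmorphM/= nrmE. Qed.

Lemma cnorm0 x : cnorm x = 0 -> x = 0.
Proof. by move=> /complexI/N0. Qed.

End NormFactory.

(* Nonzero complex Banach spaces; [V] being nonzero makes the ring of operators
   of [V] nontrivial, as MathComp's [algType] requires. *)
HB.mixin Record isNontrivial V & GRing.Zmodule V := {
  nontrivial_subproof : exists x : V, x != 0
}.

#[short(type="banachType")]
HB.structure Definition Banach (R : realType) :=
  {V of CompleteNormedModule R[i] V & isNontrivial V}.

(* Unital complex Banach algebras.  The norm is a field of the structure, with
   values in [R], because Hierarchy Builder cannot join the library's normed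
   modules with its rings (numDomainType already inherits from both). *)
HB.mixin Record isBanachAlgebra (R : realType) A & GRing.Algebra R[i] A := {
  bnorm : A -> R;
  bnormD : forall x y, bnorm (x + y) <= bnorm x + bnorm y;
  bnormZ : forall (l : R[i]) x, bnorm (l *: x) = nrm l * bnorm x;
  bnorm_eq0 : forall x, bnorm x = 0 -> x = 0;
  bnormM : forall x y, bnorm (x * y) <= bnorm x * bnorm y;
  bnorm1 : bnorm 1 = 1;
  bnorm_complete : forall u : nat -> A,
    cauchy_for bnorm u -> exists l, seq_lim bnorm u l
}.

#[short(type="banachAlgType")]
HB.structure Definition BanachAlgebra (R : realType) :=
  {A of GRing.Algebra R[i] A & isBanachAlgebra R A}.

Section BanachAlgebraTheory.
Variables (R : realType) (A : banachAlgType R).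
Implicit Types x y : A.

Lemma bnorm0 : bnorm (0 : A) = 0 :> R.
Proof. by rewrite -(scale0r (0 : A)) bnormZ nrm0 mul0r. Qed.

Lemma bnormN x : bnorm (- x) = bnorm x :> R.
Proof. by rewrite -scaleN1r bnormZ nrmN /nrm normr1 mul1r. Qed.

Lemma bnorm_ge0 x : 0 <= bnorm x :> R.
Proof.
have := bnormD x (- x); rewrite subrr bnorm0 bnormN -mulr2n.
by rewrite pmulrn_lge0.
Qed.

Lemma bnormB x y : bnorm (x - y) = bnorm (y - x) :> R.
Proof. by rewrite -opprB bnormN. Qed.

Lemma bnorm_split z x y : bnorm (x - y) <= bnorm (x - z) + bnorm (z - y) :> R.
Proof. by rewrite (le_trans _ (bnormD _ _))// addrA subrK. Qed.

(* The infimum of the empty set is [+oo]. *)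
Definition Cpi (a : A) : \bar R :=
  ereal_inf [set z | exists b c : A,
    b * a * c = 1 /\ z = (bnorm b * bnorm c)%:E].

(* [A] is isomorphic to the complex numbers as a Banach algebra: the algebra
   isomorphism is bounded, and so is its inverse. *)
Definition iso_complex : Prop :=
  exists f : {lrmorphism A -> R[i]^o}, bijective f /\
    exists M : R, forall a : A, nrm (f a) <= M * bnorm a /\ bnorm a <= M * nrm (f a).

Definition purely_infinite : Prop :=
  ~ iso_complex /\
  forall a : A, a != 0 -> exists b c : A, b * a * c = 1.

End BanachAlgebraTheory.

(* Proper closed two-sided ideals; closure under scalars follows from
   [idealMl], see [idealZ]. *)
Record closedIdeal (R : realType) (A : banachAlgType R) := ClosedIdeal {
  ideal_set :> A -> Prop;
  ideal0 : ideal_set 0;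
  idealD : forall x y, ideal_set x -> ideal_set y -> ideal_set (x + y);
  idealMl : forall a x, ideal_set x -> ideal_set (a * x);
  idealMr : forall a x, ideal_set x -> ideal_set (x * a);
  ideal_closed : forall x,
    (forall e : R, 0 < e -> exists2 y, ideal_set y & bnorm (x - y) < e) ->
    ideal_set x;
  ideal_proper : ~ ideal_set 1
}.

Section Quotient.
Variables (R : realType) (A : banachAlgType R) (I : closedIdeal A).

Definition ideal_pred : A -> bool := fun x => `[< I x >].

Lemma ideal_predP x : reflect (I x) (ideal_pred x).
Proof. exact: asboolP. Qed.

Lemma idealZ (l : R[i]) x : I x -> I (l *: x).
Proof. by move=> Ix; rewrite -[x]mul1r scalerAl; exact: idealMl. Qed.

Lemma ideal_pred_zmod_closed : zmod_closed ideal_pred.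
Proof.
split; first exact/ideal_predP/ideal0.
move=> x y /ideal_predP Ix /ideal_predP Iy; apply/ideal_predP.
by apply: idealD => //; rewrite -scaleN1r; exact: idealZ.
Qed.

HB.instance Definition _ :=
  GRing.isZmodClosed.Build A ideal_pred ideal_pred_zmod_closed.

Definition ideal_zmod : zmodClosed A := GRing.ZmodClosed.clone A ideal_pred _.

Definition quot : Type := {ideal_quot ideal_zmod}.

HB.instance Definition _ := GRing.Zmodule.on quot.
HB.instance Definition _ := Choice.on quot.

Definition qproj (x : A) : quot := \pi_({ideal_quot ideal_zmod}) x.

Lemma qprojP (x y : A) : qproj x = qproj y <-> I (x - y).
Proof.
split=> [/eqP|Ixy]; first by rewrite -Quotient.idealrBE => /ideal_predP.
by apply/eqP; rewrite -Quotient.idealrBE; apply/ideal_predP.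
Qed.

Lemma qprojK (x : quot) : exists a, qproj a = x.
Proof. by exists (repr x); exact: reprK. Qed.

Lemma qprojD x y : qproj (x + y) = qproj x + qproj y.
Proof. exact: (@Quotient.pi_add A ideal_zmod). Qed.
Lemma qprojN x : qproj (- x) = - qproj x.
Proof. exact: (@Quotient.pi_opp A ideal_zmod). Qed.
Lemma qproj0 : qproj 0 = 0.
Proof. by rewrite -(subrr (0 : A)) qprojD qprojN subrr. Qed.
Lemma qprojB x y : qproj (x - y) = qproj x - qproj y.
Proof. by rewrite qprojD qprojN. Qed.

Definition qrepr (x : quot) : A :=
  repr (x : {ideal_quot ideal_zmod}).
Lemma qreprK x : qproj (qrepr x) = x. Proof. exact: reprK. Qed.
Lemma qreprB x : I (qrepr (qproj x) - x).
Proof. by apply/qprojP; rewrite qreprK. Qed.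

Definition qscale (l : R[i]) (x : quot) : quot := qproj (l *: qrepr x).
Definition qmul (x y : quot) : quot := qproj (qrepr x * qrepr y).

Lemma qprojZ_def l x : qproj (l *: x) = qscale l (qproj x).
Proof.
apply/esym/qprojP; rewrite -scalerBr; apply: idealZ; exact: qreprB.
Qed.

Lemma qprojM_def x y : qproj (x * y) = qmul (qproj x) (qproj y).
Proof.
apply/esym/qprojP.
rewrite -[_ * _](subrK (qrepr (qproj x) * y)) -mulrBr -addrA -mulrBl.
by apply: idealD; [apply: idealMl|apply: idealMr]; exact: qreprB.
Qed.

Lemma qscaleA l m x : qscale l (qscale m x) = qscale (l * m) x.
Proof. by rewrite -(qreprK x) -!qprojZ_def scalerA. Qed.
Lemma qscale1 : left_id 1 qscale.
Proof. by move=> x; rewrite -(qreprK x) -!qprojZ_def scale1r. Qed.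
Lemma qscaleDr : right_distributive qscale +%R.
Proof.
move=> l x y; rewrite -(qreprK x) -(qreprK y) -qprojD -!qprojZ_def.
by rewrite scalerDr qprojD.
Qed.
Lemma qscaleDl x : {morph qscale^~ x : l m / l + m}.
Proof. by move=> l m; rewrite -(qreprK x) -!qprojZ_def scalerDl qprojD. Qed.

HB.instance Definition _ := GRing.Zmodule_isLmodule.Build R[i] quot
  qscaleA qscale1 qscaleDr qscaleDl.

Lemma qprojZ (l : R[i]) x : qproj (l *: x) = l *: qproj x.
Proof. exact: qprojZ_def. Qed.

Lemma qmulA : associative qmul.
Proof.
move=> x y z; rewrite -(qreprK x) -(qreprK y) -(qreprK z).
by rewrite -!qprojM_def mulrA.
Qed.
Lemma qmul1x : left_id (qproj 1) qmul.
Proof. by move=> x; rewrite -(qreprK x) -qprojM_def mul1r. Qed.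
Lemma qmulx1 : right_id (qproj 1) qmul.
Proof. by move=> x; rewrite -(qreprK x) -qprojM_def mulr1. Qed.
Lemma qmulDl : left_distributive qmul +%R.
Proof.
move=> x y z; rewrite -(qreprK x) -(qreprK y) -(qreprK z).
by rewrite -qprojD -!qprojM_def mulrDl qprojD.
Qed.
Lemma qmulDr : right_distributive qmul +%R.
Proof.
move=> x y z; rewrite -(qreprK x) -(qreprK y) -(qreprK z).
by rewrite -qprojD -!qprojM_def mulrDr qprojD.
Qed.
Lemma qone_neq0 : qproj 1 != 0.
Proof.
apply/eqP; rewrite -qproj0 => /qprojP; rewrite subr0; exact: ideal_proper.
Qed.

HB.instance Definition _ := GRing.Zmodule_isNzRing.Build quot
  qmulA qmul1x qmulx1 qmulDl qmulDr qone_neq0.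

Lemma qprojM x y : qproj (x * y) = qproj x * qproj y.
Proof. exact: qprojM_def. Qed.

Lemma qscalerAl (l : R[i]) (x y : quot) : l *: (x * y) = l *: x * y.
Proof.
rewrite -(qreprK x) -(qreprK y) -qprojM -!qprojZ -qprojM.
by rewrite scalerAl.
Qed.
HB.instance Definition _ := GRing.Lmodule_isLalgebra.Build R[i] quot qscalerAl.
Lemma qscalerAr (l : R[i]) (x y : quot) : l *: (x * y) = x * (l *: y).
Proof.
rewrite -(qreprK x) -(qreprK y) -qprojM -!qprojZ -qprojM.
by rewrite scalerAr.
Qed.
HB.instance Definition _ := GRing.Lalgebra_isAlgebra.Build R[i] quot qscalerAr.

Definition qnorm (x : quot) : R := inf [set bnorm a | a in [set a | qproj a = x]].

Lemma qnorm_has (x : quot) :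
  has_inf [set bnorm a | a in [set a | qproj a = x]].
Proof.
split; last by exists 0 => _ [a _ <-]; exact: bnorm_ge0.
by exists (bnorm (qrepr x)), (qrepr x) => //=; exact: qreprK.
Qed.

Lemma qnorm_le a : qnorm (qproj a) <= bnorm a.
Proof. by apply: ge_inf; [case: (qnorm_has (qproj a))|exists a]. Qed.

Lemma qnorm_ge0 x : 0 <= qnorm x.
Proof.
apply: lb_le_inf; first by case: (qnorm_has x).
by move=> _ [a _ <-]; exact: bnorm_ge0.
Qed.

Lemma qnorm_approx x (e : R) : 0 < e ->
  exists a, qproj a = x /\ bnorm a <= qnorm x + e.
Proof.
move=> e0; have [_ [a /= ax <-] h] := inf_adherent e0 (qnorm_has x).
by exists a; split => //; exact: ltW.
Qed.

Lemma qnormD x y : qnorm (x + y) <= qnorm x + qnorm y.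
Proof.
apply/ler_addgt0Pl => e e0.
have e20 : 0 < e / 2 by rewrite divr_gt0.
have [a [<- ha]] := qnorm_approx x e20.
have [b [<- hb]] := qnorm_approx y e20.
rewrite -qprojD (le_trans (qnorm_le _))// (le_trans (bnormD _ _))//.
rewrite (le_trans (lerD ha hb))// addrACA [e in leRHS]splitr.
by rewrite [leRHS]addrC.
Qed.

Lemma qnormM x y : qnorm (x * y) <= qnorm x * qnorm y.
Proof.
have H e : 0 < e -> qnorm (x * y) <= (qnorm x + e) * (qnorm y + e).
  move=> e0.
  have [a [ax ha]] := qnorm_approx x e0.
  have [b [bx hb]] := qnorm_approx y e0.
  rewrite -{1}ax -{1}bx -qprojM (le_trans (qnorm_le _))// (le_trans (bnormM _ _))//.
  by rewrite ler_pM// bnorm_ge0.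
apply/ler_addgt0Pl => e e0.
pose d := Num.min 1 (e / (qnorm x + qnorm y + 1)).
have c0 : 0 < qnorm x + qnorm y + 1.
  by rewrite ltr_wpDl// addr_ge0// qnorm_ge0.
have d0 : 0 < d by rewrite lt_min ltr01 divr_gt0.
have d1 : d <= 1 by rewrite ge_min lexx.
have d2 : d * (qnorm x + qnorm y + 1) <= e.
  by rewrite -ler_pdivlMr// ge_min lexx orbT.
rewrite (le_trans (H d d0))//.
have -> : (qnorm x + d) * (qnorm y + d) =
   d * (qnorm x + qnorm y + d) + qnorm x * qnorm y.
  by rewrite mulrDl !mulrDr [qnorm x * d]mulrC -!addrA addrC -!addrA.
rewrite lerD2r (le_trans _ d2)// ler_wpM2l ?(ltW d0)//.
by rewrite lerD2l.
Qed.

Lemma nrm_gt0C (l : R[i]) : l != 0 -> 0 < nrm l.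
Proof.
move=> l0; rewrite lt_neqAle nrm_ge0 andbT eq_sym; apply/eqP => /nrm_eq0 /eqP.
exact/negP.
Qed.

Lemma qnormZ_le (l : R[i]) (x : quot) : qnorm (l *: x) <= nrm l * qnorm x.
Proof.
have [->|l0] := eqVneq l 0.
  rewrite scale0r -qproj0 (le_trans (qnorm_le _))// bnorm0.
  by rewrite mulr_ge0// ?nrm_ge0// qnorm_ge0.
have nl0 := nrm_gt0C l0.
apply/ler_addgt0Pl => e e0.
have [a [ax ha]] := qnorm_approx x (divr_gt0 e0 nl0).
rewrite -{1}ax -qprojZ (le_trans (qnorm_le _))//.
rewrite bnormZ -ler_pdivlMl// (le_trans ha)// mulrDr mulKf ?gt_eqF//.
by rewrite addrC [_^-1 * e]mulrC.
Qed.

Lemma nrmV_C (l : R[i]) : l != 0 -> nrm l^-1 = (nrm l)^-1.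
Proof.
move=> l0; apply: complexI; rewrite fmorphV/= -!nrmE.
by rewrite normfV.
Qed.

Lemma qnormZ (l : R[i]) (x : quot) : qnorm (l *: x) = nrm l * qnorm x.
Proof.
apply/eqP; rewrite eq_le qnormZ_le/=.
have [->|l0] := eqVneq l 0; first by rewrite nrm0 mul0r qnorm_ge0.
rewrite -ler_pdivlMl ?nrm_gt0C// -nrmV_C// (le_trans _ (qnormZ_le _ _))//.
by rewrite scalerA mulVf// scale1r.
Qed.

Lemma qnorm_eq0 (x : quot) : qnorm x = 0 -> x = 0.
Proof.
move=> x0; rewrite -(qreprK x) -qproj0; apply/qprojP; rewrite subr0.
apply: ideal_closed => e e0.
have e20 : 0 < e / 2 by rewrite divr_gt0.
have [a [ax]] := qnorm_approx x e20.
rewrite x0 add0r => ha.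
exists (qrepr x - a); first by apply/qprojP; rewrite ax qreprK.
rewrite opprB addrC subrK.
by rewrite (le_lt_trans ha)// ltr_pdivrMr// ltr_pMr// ltr1n.
Qed.

Lemma qnorm1 : qnorm 1 = 1.
Proof.
have le1 : qnorm 1 <= 1 by rewrite -(@bnorm1 R A); exact: qnorm_le.
apply/eqP; rewrite eq_le le1/=.
have n0 : 0 < qnorm 1.
  rewrite lt_neqAle qnorm_ge0 andbT eq_sym; apply/eqP => /qnorm_eq0 /eqP.
  by rewrite oner_eq0.
by rewrite -(ler_pM2r n0) mul1r -{1}[1 in leLHS]mulr1 qnormM.
Qed.

Lemma quot_complete (u : nat -> quot) :
  cauchy_for qnorm u -> exists l, seq_lim qnorm u l.
Proof.
move: u; apply: fast_complete_for; first exact: qnormD.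
move=> u fu.
have hx n : exists a, qproj a = u n.+1 - u n /\ bnorm a <= 2 * dyad R n.
  have [a [ax ha]] := qnorm_approx (u n.+1 - u n) (dyad_gt0 R n).
  exists a; split => //; rewrite (le_trans ha)// mulr_natl mulr2n lerD2r.
  by rewrite fu.
have [d Hd] := choice hx.
pose v n := qrepr (u 0%N) + \sum_(i < n) d i.
have vS n : v n.+1 - v n = d n.
  by rewrite /v big_ord_recr/= addrA [_ + d n]addrC addrK.
have vu n : qproj (v n) = u n.
  elim: n => [|n IH]; first by rewrite /v big_ord0 addr0 qreprK.
  by rewrite -[v n.+1](subrK (v n)) vS qprojD IH (proj1 (Hd n)) subrK.
have dyS n : dyad R n = 2 * dyad R n.+1.
  by rewrite /dyad exprS mulrA divff ?mul1r// pnatr_eq0.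
have fv m n : (m <= n)%N -> bnorm (v n - v m) <= 4 * dyad R m - 4 * dyad R n.
  elim: n => [|n IH]; first by rewrite leqn0 => /eqP ->; rewrite !subrr bnorm0.
  rewrite leq_eqVlt => /orP[/eqP->|]; first by rewrite !subrr bnorm0.
  rewrite ltnS => /IH {}IH; rewrite (le_trans (bnorm_split (v n) _ _))//.
  rewrite vS (le_trans (lerD (proj2 (Hd n)) IH))//.
  by rewrite (dyS n); lra.
have fw : fast (@bnorm R A) (fun n => v n.+2).
  move=> m n mn; rewrite (le_trans (fv m.+2 n.+2 mn))//.
  by rewrite !(dyS m, dyS m.+1); have := dyad_gt0 R n.+2; lra.
have [l /(fast_limit (@bnormD R A) fw) Hl] := bnorm_complete _ (fast_cauchy (@bnormN R A) fw).
exists (qproj l) => e e0; have [N HN] := dyad_small e0.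
exists N.+2 => -[|[|n]]// Nn.
rewrite -vu -qprojB (le_trans (qnorm_le _))// (le_trans (Hl n))//.
exact: HN.
Qed.

HB.instance Definition _ := isBanachAlgebra.Build R quot
  qnormD qnormZ qnorm_eq0 qnormM qnorm1 quot_complete.

End Quotient.

Section BoundedFamilies.
Variables (R : realType) (I : pointedType) (A : banachAlgType R).

Definition linf_pred : {pred (I -> A)} :=
  fun f => `[< exists M : R, forall i, bnorm (f i) <= M >].

Lemma linf_submod_closed : submod_closed linf_pred.
Proof.
split; first by apply/asboolP; exists 0 => i; rewrite bnorm0.
move=> l f g /asboolP[M HM] /asboolP[N HN]; apply/asboolP.
exists (nrm l * M + N) => i; rewrite (le_trans (bnormD _ _))// lerD//.
by rewrite bnormZ ler_wpM2l// nrm_ge0.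
Qed.
HB.instance Definition _ :=
  GRing.isSubmodClosed.Build R[i] (I -> A) linf_pred linf_submod_closed.

Record linf := Linf { linf_fun :> I -> A; linfP : linf_fun \in linf_pred }.

HB.instance Definition _ := [isSub for linf_fun].
HB.instance Definition _ := [Choice of linf by <:].
HB.instance Definition _ := [SubChoice_isSubLmodule of linf by <:].

Lemma linf_ext (f g : linf) : (forall i, f i = g i) -> f = g.
Proof. by move=> fg; apply: val_inj; apply/funext. Qed.

Lemma linf_bounded (f : linf) : exists M : R, forall i, bnorm (f i) <= M.
Proof. exact/asboolP/(linfP f). Qed.

Lemma linf1_subproof : (fun=> 1 : A) \in linf_pred.
Proof. by apply/asboolP; exists 1 => i; rewrite bnorm1. Qed.
Definition linf1 := Linf linf1_subproof.

Lemma linfM_subproof (f g : linf) : (fun i => f i * g i : A) \in linf_pred.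
Proof.
have [M HM] := linf_bounded f; have [N HN] := linf_bounded g.
apply/asboolP; exists (M * N) => i; rewrite (le_trans (bnormM _ _))//.
by rewrite ler_pM// bnorm_ge0.
Qed.
Definition linfM f g := Linf (linfM_subproof f g).

Lemma linfMA : associative linfM.
Proof. by move=> f g h; apply: linf_ext => i /=; rewrite mulrA. Qed.
Lemma linf1M : left_id linf1 linfM.
Proof. by move=> f; apply: linf_ext => i /=; rewrite mul1r. Qed.
Lemma linfM1 : right_id linf1 linfM.
Proof. by move=> f; apply: linf_ext => i /=; rewrite mulr1. Qed.
Lemma linfMDl : left_distributive linfM +%R.
Proof. by move=> f g h; apply: linf_ext => i /=; rewrite mulrDl. Qed.
Lemma linfMDr : right_distributive linfM +%R.
Proof. by move=> f g h; apply: linf_ext => i /=; rewrite mulrDr. Qed.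
Lemma linf1_neq0 : linf1 != 0.
Proof.
apply/eqP => /(congr1 (fun f : linf => f point))/=.
by apply/eqP; rewrite oner_eq0.
Qed.

HB.instance Definition _ := GRing.Zmodule_isNzRing.Build linf
  linfMA linf1M linfM1 linfMDl linfMDr linf1_neq0.

Lemma linf_scalerAl (l : R[i]) (f g : linf) : l *: (f * g) = l *: f * g.
Proof. by apply: linf_ext => i /=; rewrite [LHS]scalerAl. Qed.
HB.instance Definition _ :=
  GRing.Lmodule_isLalgebra.Build R[i] linf linf_scalerAl.
Lemma linf_scalerAr (l : R[i]) (f g : linf) : l *: (f * g) = f * (l *: g).
Proof. by apply: linf_ext => i /=; rewrite [LHS]scalerAr. Qed.
HB.instance Definition _ :=
  GRing.Lalgebra_isAlgebra.Build R[i] linf linf_scalerAr.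

Definition linf_norm (f : linf) : R := sup (range (fun i => bnorm (f i))).

Lemma linf_has_sup (f : linf) : has_sup (range (fun i => bnorm (f i))).
Proof.
split; first by exists (bnorm (f point)), point.
by have [M HM] := linf_bounded f; exists M => _ [i _ <-].
Qed.

Lemma linf_norm_ub (f : linf) i : bnorm (f i) <= linf_norm f.
Proof. by apply: ub_le_sup; [case: (linf_has_sup f)|exists i]. Qed.

Lemma linf_norm_le (f : linf) (M : R) :
  (forall i, bnorm (f i) <= M) -> linf_norm f <= M.
Proof.
move=> H; apply: ge_sup; first by case: (linf_has_sup f).
by move=> _ [i _ <-].
Qed.

Lemma linf_norm_ge0 f : 0 <= linf_norm f.
Proof. exact: le_trans (bnorm_ge0 _) (linf_norm_ub f point). Qed.

Lemma linf_normD f g : linf_norm (f + g) <= linf_norm f + linf_norm g.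
Proof.
apply: linf_norm_le => i; rewrite (le_trans (bnormD _ _))//.
by rewrite lerD// linf_norm_ub.
Qed.

Lemma linf_normZ_le (l : R[i]) f : linf_norm (l *: f) <= nrm l * linf_norm f.
Proof.
apply: linf_norm_le => i; rewrite /= [bnorm _]bnormZ.
by rewrite ler_wpM2l ?nrm_ge0// linf_norm_ub.
Qed.

Lemma linf_normZ (l : R[i]) f : linf_norm (l *: f) = nrm l * linf_norm f.
Proof.
apply/eqP; rewrite eq_le linf_normZ_le/=.
have [->|l0] := eqVneq l 0; first by rewrite nrm0 mul0r linf_norm_ge0.
rewrite -ler_pdivlMl ?nrm_gt0C//; apply: linf_norm_le => i.
rewrite ler_pdivlMl ?nrm_gt0C// -bnormZ; exact: (linf_norm_ub (l *: f)).
Qed.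

Lemma linf_norm_eq0 f : linf_norm f = 0 -> f = 0.
Proof.
move=> f0; apply: linf_ext => i; apply: (@bnorm_eq0 R).
by apply/eqP; rewrite eq_le bnorm_ge0 andbT -f0 linf_norm_ub.
Qed.

Lemma linf_normM f g : linf_norm (f * g) <= linf_norm f * linf_norm g.
Proof.
apply: linf_norm_le => i; rewrite (le_trans (bnormM _ _))//.
by rewrite ler_pM ?bnorm_ge0// linf_norm_ub.
Qed.

Lemma linf_norm1 : linf_norm 1 = 1.
Proof.
apply/eqP; rewrite eq_le; apply/andP; split.
  by apply: linf_norm_le => i; rewrite /= bnorm1.
by rewrite -{1}(@bnorm1 R A); exact: (linf_norm_ub 1 point).
Qed.

Lemma linf_complete (u : nat -> linf) :
  cauchy_for linf_norm u -> exists l, seq_lim linf_norm u l.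
Proof.
move: u; apply: fast_complete_for; first exact: linf_normD.
move=> u fu.
have fi i : fast (@bnorm R A) (fun n => u n i).
  move=> m n mn; rewrite (le_trans _ (fu _ _ mn))//.
  exact: (linf_norm_ub (u n - u m)).
have hl i : exists l : A, forall m, bnorm (l - u m i) <= dyad R m.
  have [l Hl] := bnorm_complete _ (fast_cauchy (@bnormN R A) (fi i)).
  by exists l; apply: (fast_limit (@bnormD R A) (fi i) Hl).
have [l Hl] := choice hl.
have lb : l \in linf_pred.
  have [M HM] := linf_bounded (u 0%N).
  apply/asboolP; exists (dyad R 0 + M) => i.
  rewrite -[l i](subrK (u 0%N i)) (le_trans (bnormD _ _))//.
  by rewrite lerD// Hl.
exists (Linf lb); apply: dyad_lim => m; apply: linf_norm_le => i.
exact: Hl.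
Qed.

HB.instance Definition _ := isBanachAlgebra.Build R linf
  linf_normD linf_normZ linf_norm_eq0 linf_normM linf_norm1 linf_complete.

(* A set carrying an ultrafilter is nonempty, so that taking [I] pointed is no
   restriction. *)
Section Ultrapower.
Variables (U : set_system I) (UU : UltraFilter U).

Definition null_family : set linf :=
  [set f | (fun i => bnorm (f i)) @ U --> (0 : R)].

Lemma null_familyP (f : linf) :
  null_family f <-> forall e : R, 0 < e -> U [set i | bnorm (f i) <= e].
Proof.
split=> [/cvgrPdist_le H e e0|H].
  apply: filterS (H e e0) => i /=.
  by rewrite sub0r normrN ger0_norm// bnorm_ge0.
apply/cvgrPdist_le => e e0; apply: filterS (H e e0) => i /=.
by rewrite sub0r normrN ger0_norm// bnorm_ge0.
Qed.

Lemma null_family0 : null_family 0.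
Proof.
apply/null_familyP => e e0; apply: filterS filterT => i _ /=.
by rewrite bnorm0 ltW.
Qed.

Lemma null_familyD f g : null_family f -> null_family g -> null_family (f + g).
Proof.
move=> /null_familyP Hf /null_familyP Hg; apply/null_familyP => e e0.
have e2 : 0 < e / 2 by rewrite divr_gt0.
apply: filterS2 (Hf _ e2) (Hg _ e2) => i /= hf hg.
by rewrite (le_trans (bnormD _ _))// [leRHS]splitr lerD.
Qed.

Lemma null_family_dom (M : R) (f g : linf) :
  (forall i, bnorm (g i) <= M * bnorm (f i)) -> null_family f -> null_family g.
Proof.
move=> H /null_familyP Hf; apply/null_familyP => e e0.
have M0 : 0 < `|M| + 1 by rewrite ltr_wpDl.
apply: filterS (Hf _ (divr_gt0 e0 M0)) => i /=.
rewrite ler_pdivlMr// => h; rewrite (le_trans (H i))// (le_trans _ h)//.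
rewrite mulrC ler_wpM2l ?bnorm_ge0//.
by rewrite (le_trans (ler_norm _))// lerDl.
Qed.

Lemma null_familyMl f g : null_family g -> null_family (f * g).
Proof.
apply: (@null_family_dom (linf_norm f)) => i.
rewrite (le_trans (bnormM _ _))// ler_wpM2r ?bnorm_ge0//; exact: linf_norm_ub.
Qed.

Lemma null_familyMr f g : null_family g -> null_family (g * f).
Proof.
apply: (@null_family_dom (linf_norm f)) => i.
rewrite (le_trans (bnormM _ _))// mulrC ler_wpM2r ?bnorm_ge0//.
exact: linf_norm_ub.
Qed.

Lemma null_family_closed f :
  (forall e : R, 0 < e -> exists2 g, null_family g & bnorm (f - g) < e) ->
  null_family f.
Proof.
move=> H; apply/null_familyP => e e0.
have e2 : 0 < e / 2 by rewrite divr_gt0.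
have [g /null_familyP Hg fg] := H _ e2.
apply: filterS (Hg _ e2) => i /= gi.
rewrite -[f i](subrK (g i)) (le_trans (bnormD _ _))// [leRHS]splitr lerD//.
exact: le_trans (linf_norm_ub (f - g) i) (ltW fg).
Qed.

Lemma null_family_proper : ~ null_family 1.
Proof.
move=> /null_familyP /(_ (2^-1)); rewrite invr_gt0 => /(_ (ltr0n _ 2)).
move=> /filter_ex[i /=]; rewrite bnorm1; lra.
Qed.

Definition null_ideal : closedIdeal linf := ClosedIdeal null_family0
  null_familyD null_familyMl null_familyMr null_family_closed null_family_proper.

Definition ultrapower : banachAlgType R := quot null_ideal.

End Ultrapower.
End BoundedFamilies.

Section BoundedOperators.
Variables (R : realType) (E : banachType R).

Lemma continuous_boundP (f : {linear E -> E}) :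
  continuous f <-> exists M : R, forall x, nrm (f x) <= M * nrm x.
Proof.
split=> [/linear_bounded_continuous/linear_boundedP/pinfty_ex_gt0[r r0 Hr]|].
  have rE : r = (complex.Re r)%:C by rewrite RRe_real// gtr0_real.
  exists (complex.Re r) => x.
  by have := Hr x; rewrite !nrmE rE -rmorphM/= lecR.
move=> [M HM]; apply/linear_bounded_continuous/linear_boundedP.
exists M%:C; split; first by apply/complex_realP; exists M.
move=> r Mr x; rewrite (le_trans _ (ler_wpM2r _ (ltW Mr)))//.
by rewrite !nrmE -rmorphM/= lecR.
Qed.

Definition bop_pred : {pred (E -> E)} :=
  fun f => `[< linear f /\ continuous f >].

Lemma bop_predP (f : E -> E) : reflect
  (linear f /\ exists M : R, forall x, nrm (f x) <= M * nrm x) (f \in bop_pred).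
Proof.
apply: (iffP (asboolP _)) => -[lf cf]; split=> //.
  pose g : {linear E -> E} :=
    HB.pack f (GRing.isLinear.Build R[i] E E *:%R f lf).
  exact/(continuous_boundP g).
pose g : {linear E -> E} :=
  HB.pack f (GRing.isLinear.Build R[i] E E *:%R f lf).
exact/(continuous_boundP g).
Qed.

Lemma bop_submod_closed : submod_closed bop_pred.
Proof.
split.
  apply/bop_predP; split; first by move=> l x y /=; rewrite scaler0 addr0.
  by exists 0 => x; rewrite nrm0 mul0r.
move=> l f g /bop_predP[lf [M HM]] /bop_predP[lg [N HN]].
apply/bop_predP; split.
  move=> k x y; rewrite /= -[LHS]/(l *: f _ + g _).
  rewrite lf lg -[RHS]/(k *: (l *: f _ + g _) + (l *: f _ + g _)).
  rewrite !scalerDr !scalerA [k * l]mulrC -!addrA; congr (_ + _).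
  by rewrite addrCA.
exists (nrm l * M + N) => x; rewrite (le_trans (nrmD _ _))// mulrDl lerD//.
by rewrite [nrm _]nrmZ -mulrA ler_wpM2l ?nrm_ge0.
Qed.
HB.instance Definition _ :=
  GRing.isSubmodClosed.Build R[i] (E -> E) bop_pred bop_submod_closed.

Record bop := Bop { bop_fun :> E -> E; bopP : bop_fun \in bop_pred }.

HB.instance Definition _ := [isSub for bop_fun].
HB.instance Definition _ := [Choice of bop by <:].
HB.instance Definition _ := [SubChoice_isSubLmodule of bop by <:].

Lemma bop_ext (f g : bop) : (forall i, f i = g i) -> f = g.
Proof. by move=> fg; apply: val_inj; apply/funext. Qed.

Lemma bop_bounded (f : bop) : exists M : R, forall x, nrm (f x) <= M * nrm x.
Proof. by have /bop_predP[] := bopP f. Qed.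

Lemma bop_linear (f : bop) : linear f.
Proof. by have /bop_predP[] := bopP f. Qed.
HB.instance Definition _ (f : bop) :=
  GRing.isLinear.Build R[i] E E *:%R f (bop_linear f).

Lemma bop1_subproof : (id : E -> E) \in bop_pred.
Proof. by apply/bop_predP; split=> //; exists 1 => x; rewrite mul1r. Qed.
Definition bop1 := Bop bop1_subproof.

Lemma bopM_subproof (f g : bop) : (f \o g : E -> E) \in bop_pred.
Proof.
have [M HM] := bop_bounded f; have [N HN] := bop_bounded g.
apply/bop_predP; split; first by move=> k x y /=; rewrite !linearP.
exists (`|M| * N) => x /=; rewrite (le_trans (HM _))//.
rewrite -mulrA (le_trans (ler_wpM2r (nrm_ge0 _) (ler_norm M)))//.
by rewrite ler_wpM2l.
Qed.
Definition bopM f g := Bop (bopM_subproof f g).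

Lemma bopMA : associative bopM.
Proof. by move=> f g h; apply: bop_ext. Qed.
Lemma bop1M : left_id bop1 bopM.
Proof. by move=> f; apply: bop_ext. Qed.
Lemma bopM1 : right_id bop1 bopM.
Proof. by move=> f; apply: bop_ext. Qed.
Lemma bopMDl : left_distributive bopM +%R.
Proof. by move=> f g h; apply: bop_ext. Qed.
Lemma bopMDr : right_distributive bopM +%R.
Proof. by move=> f g h; apply: bop_ext => x /=; rewrite linearD. Qed.
Lemma bop1_neq0 : bop1 != 0.
Proof.
have [x /eqP x0] := @nontrivial_subproof _ E.
by apply/eqP => /(congr1 (fun f : bop => f x))/=.
Qed.

HB.instance Definition _ := GRing.Zmodule_isNzRing.Build bop
  bopMA bop1M bopM1 bopMDl bopMDr bop1_neq0.

Lemma bop_scalerAl (l : R[i]) (f g : bop) : l *: (f * g) = l *: f * g.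
Proof. exact: bop_ext. Qed.
HB.instance Definition _ :=
  GRing.Lmodule_isLalgebra.Build R[i] bop bop_scalerAl.
Lemma bop_scalerAr (l : R[i]) (f g : bop) : l *: (f * g) = f * (l *: g).
Proof. by apply: bop_ext => i /=; rewrite linearZ. Qed.
HB.instance Definition _ :=
  GRing.Lalgebra_isAlgebra.Build R[i] bop bop_scalerAr.

Definition opnorm (f : bop) : R :=
  sup [set nrm (f x) | x in [set x | nrm x <= 1]].

Lemma opnorm_has_sup (f : bop) :
  has_sup [set nrm (f x) | x in [set x | nrm x <= 1]].
Proof.
split; first by exists (nrm (f 0)), 0 => //=; rewrite nrm0.
have [M HM] := bop_bounded f; exists `|M| => _ [x /= x1 <-].
rewrite (le_trans (HM x))// (le_trans (ler_wpM2r (nrm_ge0 _) (ler_norm M)))//.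
by rewrite ler_piMr.
Qed.

Lemma opnorm_ub1 (f : bop) x : nrm x <= 1 -> nrm (f x) <= opnorm f.
Proof. by move=> x1; apply: ub_le_sup; [case: (opnorm_has_sup f)|exists x]. Qed.

Lemma opnorm_ge0 f : 0 <= opnorm f.
Proof. by rewrite (le_trans (nrm_ge0 (f 0)))// opnorm_ub1// nrm0. Qed.

Lemma opnorm_ub (f : bop) x : nrm (f x) <= opnorm f * nrm x.
Proof.
have [->|x0] := eqVneq x 0; first by rewrite linear0 !nrm0 mulr0.
have nx : 0 < nrm x.
  rewrite lt_neqAle nrm_ge0 andbT eq_sym; apply/eqP => /nrm_eq0 /eqP.
  exact/negP.
have := @opnorm_ub1 f (((nrm x)^-1)%:C *: x).
rewrite linearZ !nrmZ nrm_real ger0_norm ?invr_ge0 ?nrm_ge0//.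
rewrite mulVf ?gt_eqF// => /(_ (lexx _)).
by rewrite ler_pdivrMl// mulrC.
Qed.

Lemma opnorm_le (f : bop) (M : R) : 0 <= M ->
  (forall x, nrm (f x) <= M * nrm x) -> opnorm f <= M.
Proof.
move=> M0 H; apply: ge_sup; first by case: (opnorm_has_sup f).
by move=> _ [x /= x1 <-]; rewrite (le_trans (H x))// ler_piMr.
Qed.

Lemma opnormD f g : opnorm (f + g) <= opnorm f + opnorm g.
Proof.
apply: opnorm_le => [|x]; first by rewrite addr_ge0// opnorm_ge0.
by rewrite (le_trans (nrmD _ _))// mulrDl lerD// opnorm_ub.
Qed.

Lemma opnormZ_le (l : R[i]) f : opnorm (l *: f) <= nrm l * opnorm f.
Proof.
apply: opnorm_le => [|x]; first by rewrite mulr_ge0 ?nrm_ge0 ?opnorm_ge0.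
by rewrite [nrm (_ x)]nrmZ -mulrA ler_wpM2l ?nrm_ge0// opnorm_ub.
Qed.

Lemma opnormZ (l : R[i]) f : opnorm (l *: f) = nrm l * opnorm f.
Proof.
apply/eqP; rewrite eq_le opnormZ_le/=.
have [->|l0] := eqVneq l 0; first by rewrite nrm0 mul0r opnorm_ge0.
rewrite -ler_pdivlMl ?nrm_gt0C// -nrmV_C// (le_trans _ (opnormZ_le _ _))//.
by rewrite scalerA mulVf// scale1r.
Qed.

Lemma opnorm_eq0 f : opnorm f = 0 -> f = 0.
Proof.
move=> f0; apply: bop_ext => x; apply: (@nrm_eq0 R).
by apply/eqP; rewrite eq_le nrm_ge0 andbT (le_trans (opnorm_ub _ _))// f0 mul0r.
Qed.

Lemma opnormM f g : opnorm (f * g) <= opnorm f * opnorm g.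
Proof.
apply: opnorm_le => [|x]; first by rewrite mulr_ge0 ?opnorm_ge0.
rewrite (le_trans (opnorm_ub f (g x)))// -mulrA.
by rewrite ler_wpM2l ?opnorm_ge0// opnorm_ub.
Qed.

Lemma opnorm1 : opnorm 1 = 1.
Proof.
apply/eqP; rewrite eq_le; apply/andP; split.
  by apply: opnorm_le => // x; rewrite mul1r.
have [x x0] := @nontrivial_subproof _ E.
have nx : 0 < nrm x.
  rewrite lt_neqAle nrm_ge0 andbT eq_sym; apply/eqP => /nrm_eq0 /eqP.
  exact/negP.
by rewrite -(ler_pM2r nx) mul1r; exact: (opnorm_ub 1 x).
Qed.

Lemma opnorm_complete (u : nat -> bop) :
  cauchy_for opnorm u -> exists l, seq_lim opnorm u l.
Proof.
move: u; apply: fast_complete_for; first exact: opnormD.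
move=> u fu.
have fx x m n : (m <= n)%N -> nrm (u n x - u m x) <= dyad R m * nrm x.
  move=> mn; rewrite (le_trans (opnorm_ub (u n - u m) x))//.
  by rewrite ler_wpM2r ?nrm_ge0// fu.
have cx x : cauchy_for (@nrm R E) (fun n => u n x).
  move=> e e0.
  have x1 : 0 < nrm x + 1 by rewrite ltr_wpDl ?nrm_ge0.
  have [n0 H] := dyad_small (divr_gt0 e0 x1); exists n0.
  have K m n : (n0 <= m)%N -> (m <= n)%N -> nrm (u n x - u m x) <= e.
    move=> hm mn; rewrite (le_trans (fx x _ _ mn))//.
    have := H _ hm; rewrite ler_pdivlMr//; apply: le_trans.
    by rewrite ler_wpM2l ?(ltW (dyad_gt0 _ _))// lerDl.
  move=> m n hm hn; have [mn|/ltnW nm] := leqP m n; last exact: K.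
  by rewrite nrmB K.
have hl x : exists l : E, forall m, nrm (l - u m x) <= dyad R m * nrm x.
  have [l Hl] := complete_seq (cx x); exists l => m.
  apply/ler_addgt0Pl => e e0.
  have [n0 /(_ (maxn n0 m) (leq_maxl _ _)) H] := Hl _ e0.
  rewrite (le_trans (nrm_split (u (maxn n0 m) x) _ _))// lerD// fx//.
  by rewrite leq_maxr.
have [l Hl] := choice hl.
have ll : linear l.
  move=> k x y; apply/eqP; rewrite -subr_eq0; apply/eqP/(@nrm_eq0 R).
  apply/eqP; rewrite eq_le nrm_ge0 andbT.
  pose C := nrm (k *: x + y) + (nrm k * nrm x + nrm y).
  have HC m : nrm (l (k *: x + y) - (k *: l x + l y)) <= dyad R m * C.
    rewrite (le_trans (nrm_split (u m (k *: x + y)) _ _))// mulrDr lerD//.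
    rewrite linearP opprD addrACA -scalerBr (le_trans (nrmD _ _))//.
    rewrite nrmZ nrmB [nrm (_ - l y)]nrmB mulrDr lerD//; last exact: Hl.
    by rewrite [leRHS]mulrCA ler_wpM2l ?nrm_ge0//; exact: Hl.
  have C1 : 0 < C + 1.
    by rewrite ltr_wpDl// !addr_ge0 ?mulr_ge0 ?nrm_ge0.
  apply/ler_addgt0Pl => e e0; rewrite addr0.
  have [n0 /(_ _ (leqnn _))] := dyad_small (divr_gt0 e0 C1).
  rewrite ler_pdivlMr//; apply: le_trans; rewrite (le_trans (HC n0))//.
  by rewrite ler_wpM2l ?(ltW (dyad_gt0 _ _))// lerDl.
have lb : l \in bop_pred.
  have [M HM] := bop_bounded (u 0%N).
  apply/bop_predP; split=> //; exists (dyad R 0 + M) => x.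
  rewrite -[l x](subrK (u 0%N x)) (le_trans (nrmD _ _))//.
  by rewrite mulrDl lerD.
exists (Bop lb); apply: dyad_lim => m.
by apply: opnorm_le => [|x]; [exact/ltW/dyad_gt0|exact: Hl].
Qed.

HB.instance Definition _ := isBanachAlgebra.Build R bop
  opnormD opnormZ opnorm_eq0 opnormM opnorm1 opnorm_complete.

Definition non_factoring : set bop :=
  [set T | ~ exists V W : bop, V * T * W = 1].

End BoundedOperators.
Arguments non_factoring {R} E.

(* [KindC0] stands for c_0(Gamma), [KindLp p] for l_p(Gamma) with
   1 <= p < oo. *)
Variant coord_kind (R : realType) : Type :=
  | KindC0
  | KindLp (p : R) of 1 <= p.

Section CoordinateSpaces.
Variables (R : realType) (Gamma : pointedType).
Implicit Types (x y : Gamma -> R[i]) (p r t : R).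

Definition psum p x : \bar R := (\esum_(g in [set: Gamma]) (nrm (x g) `^ p)%:E)%E.

Definition in_space (k : coord_kind R) x : Prop :=
  match k with
  | KindC0 => forall e : R, 0 < e -> finite_set [set g | e <= nrm (x g)]
  | KindLp p _ => (psum p x < +oo)%E
  end.

Definition coord_norm (k : coord_kind R) x : R :=
  match k with
  | KindC0 => sup (range (fun g => nrm (x g)))
  | KindLp p _ => fine (psum p x) `^ p^-1
  end.

(* [coord_norm k x <= r], in a form that also makes sense outside of the
   space: see [coord_normP]. *)
Definition bnd (k : coord_kind R) r x : Prop :=
  match k with
  | KindC0 => forall g, nrm (x g) <= r
  | KindLp p _ => (psum p x <= (r `^ p)%:E)%E
  end.

Lemma psumP p x (M : R) : (psum p x <= M%:E)%E <->
  forall s : seq Gamma, uniq s -> \sum_(g <- s) nrm (x g) `^ p <= M.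
Proof.
split=> [H s us|H].
  rewrite -lee_fin (le_trans _ H)// /psum; apply: esum_ge.
  exists [set` s]; first by split; [exact: finite_seq|exact: subsetT].
  by rewrite -sumEFin -fsbig_seq.
rewrite /psum /esum; apply: ge_ereal_sup => _ [F [finF _] <-].
by rewrite fsbig_finite//= sumEFin lee_fin; apply: H; exact: finmap.fset_uniq.
Qed.

Lemma psum_ge0 p x : (0 <= psum p x)%E.
Proof. by apply: esum_ge0 => g _; rewrite lee_fin powR_ge0. Qed.

Lemma psum_fin p x : (psum p x < +oo)%E -> psum p x = (fine (psum p x))%:E.
Proof. by move=> h; rewrite fineK// ge0_fin_numE// psum_ge0. Qed.

Lemma le_powR p r t : 1 <= p -> 0 <= r -> 0 <= t -> r <= t -> r `^ p <= t `^ p.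
Proof. by move=> p1 r0 t0 rt; rewrite ge0_ler_powR ?nnegrE// (le_trans ler01). Qed.

Lemma powRV_le p r t : 1 <= p -> 0 <= r -> 0 <= t ->
  (r `^ p^-1 <= t) = (r <= t `^ p).
Proof.
move=> p1 r0 t0; have p0 : 0 < p by rewrite (lt_le_trans ltr01).
apply/idP/idP => h.
  have := le_powR p1 (powR_ge0 _ _) t0 h.
  by rewrite -powRrM mulVf ?gt_eqF// powRr1.
have : r `^ p^-1 <= (t `^ p) `^ p^-1.
  by rewrite ge0_ler_powR ?nnegrE ?powR_ge0// invr_ge0 ltW.
by rewrite -powRrM mulfV ?gt_eqF// powRr1.
Qed.

Lemma nrmC_eq0 (z : R[i]) : nrm z = 0 -> z = 0.
Proof. exact: nrm_eq0. Qed.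

Lemma in_space_bnd k x : in_space k x -> exists2 r, 0 < r & bnd k r x.
Proof.
case: k => [|p p1] /= H.
  have fin := H 1 ltr01.
  exists (\sum_(g <- finmap.enum_fset (fset_set [set g | 1 <= nrm (x g)])) nrm (x g) + 1).
    by rewrite ltr_wpDl// sumr_ge0// => g _; exact: nrm_ge0.
  move=> g; have [g1|/ltW g1] := leP 1 (nrm (x g)); last first.
    by rewrite (le_trans g1)// lerDr sumr_ge0// => h _; exact: nrm_ge0.
  rewrite (big_rem g)/=; last by rewrite in_fset_set// inE.
  by rewrite -addrA lerDl addr_ge0// sumr_ge0// => h _; exact: nrm_ge0.
have := psum_fin H; set s := fine _ => sE.
have s0 : 0 <= s by rewrite -lee_fin -sE psum_ge0.
exists (s `^ p^-1 + 1); first by rewrite ltr_wpDl// powR_ge0.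
rewrite sE lee_fin -powRV_le ?addr_ge0 ?powR_ge0//.
by rewrite lerDl.
Qed.

Lemma coord_normP k x r : in_space k x -> 0 < r ->
  coord_norm k x <= r <-> bnd k r x.
Proof.
move=> sx r0; case: k sx => [|p p1] /= sx.
  have [M _ HM] := @in_space_bnd (KindC0 R) x sx.
  split=> [+ g|H].
    apply: le_trans; apply: ub_le_sup; last by exists g.
    by exists M => _ [h _ <-]; exact: HM.
  apply: ge_sup; first by exists (nrm (x point)), point.
  by move=> _ [g _ <-].
have sE := psum_fin sx.
have s0 : 0 <= fine (psum p x) by rewrite -lee_fin -sE psum_ge0.
by rewrite sE lee_fin/= powRV_le// ltW.
Qed.

Lemma bnd_in_lp p (p1 : 1 <= p) r x : bnd (KindLp p1) r x -> in_space (KindLp p1) x.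
Proof. by move=> /= h; rewrite (le_lt_trans h)// ltry. Qed.

Lemma coord_norm_ge0 k x : 0 <= coord_norm k x.
Proof.
case: k => [|p p1] /=; last exact: powR_ge0.
have [ub|nub] := pselect (has_ubound (range (fun g => nrm (x g)))).
  apply: le_trans (nrm_ge0 (x point)) _.
  by apply: ub_le_sup => //; exists point.
by rewrite sup_out// => -[_ /nub].
Qed.

Lemma bnd_pt k r x g : 0 < r -> bnd k r x -> nrm (x g) <= r.
Proof.
move=> r0; case: k => [|p p1] /= H; first exact: H.
have p0 : 0 < p by rewrite (lt_le_trans ltr01).
have /psumP/(_ [:: g] isT) := H; rewrite big_seq1 => h.
have p0' : p != 0 by rewrite gt_eqF.
rewrite -[leLHS](powRr1 (nrm_ge0 _)) -[X in _ `^ X](mulfV p0').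
by rewrite powRrM powRV_le ?powR_ge0// ltW.
Qed.

Lemma bnd_mono k r x y : (forall g, nrm (x g) <= nrm (y g)) ->
  bnd k r y -> bnd k r x.
Proof.
move=> xy; case: k => [|p p1] /= H; first by move=> g; exact: le_trans (H g).
apply: le_trans H; apply: le_esum => g _; rewrite lee_fin.
by apply: le_powR => //; exact: nrm_ge0.
Qed.

Lemma in_space_mono k x y : (forall g, nrm (x g) <= nrm (y g)) ->
  in_space k y -> in_space k x.
Proof.
move=> xy; case: k => [|p p1] H.
  move=> e /H; apply: sub_finite_set => g /= h; exact: le_trans (xy g).
have [r _ /(bnd_mono xy)] := in_space_bnd H; exact: bnd_in_lp.
Qed.

Lemma powR_convD p a b r t : 1 <= p -> 0 <= a -> 0 <= b -> 0 < r -> 0 < t ->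
  (a + b) `^ p <= (r + t) `^ p *
    (r / (r + t) / r `^ p * a `^ p + t / (r + t) / t `^ p * b `^ p).
Proof.
move=> p1 a0 b0 r0 t0.
have rt0 : 0 < r + t by rewrite addr_gt0.
have w0 : 0 <= r / (r + t) by rewrite divr_ge0 ?ltW.
have w1 : r / (r + t) <= 1 by rewrite ler_pdivrMr// mul1r lerDl ltW.
have wE : 1 - r / (r + t) = t / (r + t).
  by field; rewrite (gt_eqF rt0).
have -> : a + b = (r + t) * (r / (r + t) * (a / r) + (1 - r / (r + t)) * (b / t)).
  by rewrite wE; field; rewrite (gt_eqF r0) (gt_eqF t0) (gt_eqF rt0).
have ar : 0 <= a / r by rewrite divr_ge0 ?(ltW r0).
have bt : 0 <= b / t by rewrite divr_ge0 ?(ltW t0).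
rewrite powRM ?(ltW rt0)//; last by rewrite addr_ge0// mulr_ge0// subr_ge0.
rewrite ler_wpM2l ?powR_ge0//.
have := convex_powR p1 (Itv01 w0 w1) (x := a / r) (y := b / t).
rewrite !inE/= !in_itv/= !andbT => /(_ ar bt)/le_trans; apply.
rewrite convRE/= /unstable.onem wE.
have dE u v : 0 <= u -> 0 < v -> (u / v) `^ p = u `^ p / v `^ p.
  move=> u0 v0; rewrite powRM ?invr_ge0 ?(ltW v0)//; congr (_ * _).
  by rewrite -(powR_inv1 (ltW v0)) powRAC powR_inv1 ?powR_ge0.
rewrite !dE//.
have sw (u v w : R) : u * (v / w) = u / w * v by rewrite mulrA mulrAC.
by rewrite (sw (r / _)) (sw (t / _)).
Qed.

Lemma bndD k r t x y : 0 < r -> 0 < t ->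
  bnd k r x -> bnd k t y -> bnd k (r + t) (fun g => x g + y g).
Proof.
move=> r0 t0; case: k => [|p p1] /= hx hy.
  by move=> g; rewrite (le_trans (nrmD _ _))// lerD.
have rt0 : 0 < r + t by rewrite addr_gt0.
apply/psumP => s us.
have /psumP/(_ s us) Hx := hx; have /psumP/(_ s us) Hy := hy.
pose c1 := r / (r + t) / r `^ p; pose c2 := t / (r + t) / t `^ p.
have c10 : 0 <= c1 by rewrite !divr_ge0 ?powR_ge0 ?ltW.
have c20 : 0 <= c2 by rewrite !divr_ge0 ?powR_ge0 ?ltW.
apply: (@le_trans _ _ (\sum_(g <- s) (r + t) `^ p *
    (c1 * nrm (x g) `^ p + c2 * nrm (y g) `^ p))).
  apply: ler_sum => g _.
  apply: le_trans (powR_convD p1 (nrm_ge0 _) (nrm_ge0 _) r0 t0).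
  by rewrite le_powR ?addr_ge0 ?nrm_ge0 ?nrmD.
rewrite -mulr_sumr big_split/= -!mulr_sumr ler_piMr ?powR_ge0//.
apply: (@le_trans _ _ (c1 * r `^ p + c2 * t `^ p)).
  by rewrite lerD// ler_wpM2l.
rewrite /c1 /c2 !divfK ?gt_eqF ?powR_gt0//.
by rewrite -mulrDl divff// gt_eqF.
Qed.

Lemma bndZ k r x (l : R[i]) : 0 < r -> l != 0 -> bnd k r x ->
  bnd k (nrm l * r) (fun g => l * x g).
Proof.
move=> r0 l0; case: k => [|p p1] /= H.
  by move=> g; rewrite nrmM1 ler_wpM2l ?nrm_ge0.
apply/psumP => s us; have /psumP/(_ s us) Hx := H.
under eq_bigr do rewrite nrmM1 powRM ?nrm_ge0//.
by rewrite -mulr_sumr powRM ?nrm_ge0 ?(ltW r0)// ler_wpM2l ?powR_ge0.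
Qed.

Lemma in_space0 k : in_space k (fun=> 0).
Proof.
case: k => [e e0|p p1].
  rewrite [X in finite_set X](_ : _ = set0)//; apply/seteqP; split=> // g /=.
  by rewrite nrm0 leNgt e0.
apply: (@bnd_in_lp _ _ 1) => /=; apply/psumP => s _.
rewrite big1 ?powR_ge0// => g _.
by rewrite nrm0 powR0// gt_eqF// (lt_le_trans ltr01).
Qed.

Lemma in_spaceD k x y : in_space k x -> in_space k y ->
  in_space k (fun g => x g + y g).
Proof.
case: k => [|p p1] hx hy.
  move=> e e0; have e2 : 0 < e / 2 by rewrite divr_gt0.
  have : finite_set ([set g | e / 2 <= nrm (x g)] `|`
    [set g | e / 2 <= nrm (y g)]) by rewrite finite_setU; split; [exact: hx|exact: hy].
  apply: sub_finite_set => g /= h.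
  have [|h1] := leP (e / 2) (nrm (x g)); first by left.
  right; rewrite leNgt; apply/negP => h2.
  by have := nrmD (x g) (y g); move: h h1 h2; lra.
have [r r0 hr] := in_space_bnd hx; have [t t0 ht] := in_space_bnd hy.
exact: bnd_in_lp (bndD r0 t0 hr ht).
Qed.

Lemma in_spaceZ k (l : R[i]) x : in_space k x -> in_space k (fun g => l * x g).
Proof.
move=> hx; have [->|l0] := eqVneq l 0.
  by under eq_fun do rewrite mul0r; exact: in_space0.
case: k hx => [|p p1] hx.
  move=> e e0; have := hx (e / nrm l) (divr_gt0 e0 (nrm_gt0C l0)).
  apply: sub_finite_set => g /=.
  by rewrite nrmM1 ler_pdivrMr ?nrm_gt0C// mulrC.
have [r r0 hr] := in_space_bnd hx.
exact: bnd_in_lp (bndZ r0 l0 hr).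
Qed.

Variable k : coord_kind R.

Definition coord_pred : {pred (Gamma -> R[i])} := fun x => `[< in_space k x >].

Lemma coord_submod_closed : submod_closed coord_pred.
Proof.
split; first exact/asboolP/in_space0.
move=> l x y /asboolP hx /asboolP hy; apply/asboolP.
exact: in_spaceD (in_spaceZ l hx) hy.
Qed.
HB.instance Definition _ :=
  GRing.isSubmodClosed.Build R[i] (Gamma -> R[i]) coord_pred coord_submod_closed.

Record coord_space := CoordSpace {
  coord_fun :> Gamma -> R[i]; coordP : coord_fun \in coord_pred }.

HB.instance Definition _ := [isSub for coord_fun].
HB.instance Definition _ := [Choice of coord_space by <:].
HB.instance Definition _ := [SubChoice_isSubLmodule of coord_space by <:].

Lemma coord_ext (x y : coord_space) : (forall g, x g = y g) -> x = y.
Proof. by move=> xy; apply: val_inj; apply/funext. Qed.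

Lemma coord_in (x : coord_space) : in_space k x.
Proof. exact/asboolP/(coordP x). Qed.

Definition cspace_norm (x : coord_space) : R := coord_norm k x.

Lemma cspace_normP (x : coord_space) r : 0 < r ->
  cspace_norm x <= r <-> bnd k r x.
Proof. exact: coord_normP (coord_in x). Qed.

Lemma cspace_bnd (x : coord_space) (e : R) : 0 < e ->
  0 < cspace_norm x + e /\ bnd k (cspace_norm x + e) x.
Proof.
move=> e0; have h : 0 < cspace_norm x + e by rewrite ltr_wpDl// coord_norm_ge0.
by split => //; apply/cspace_normP => //; rewrite lerDl ltW.
Qed.

Lemma cspace_norm_pt (x : coord_space) g : nrm (x g) <= cspace_norm x.
Proof.
apply/ler_addgt0Pl => e e0; have [h hb] := cspace_bnd x e0.
by rewrite addrC; exact: bnd_pt hb.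
Qed.

Lemma cspace_normD (x y : coord_space) :
  cspace_norm (x + y) <= cspace_norm x + cspace_norm y.
Proof.
apply/ler_addgt0Pl => e e0; have e2 : 0 < e / 2 by rewrite divr_gt0.
have [hx bx] := cspace_bnd x e2; have [hy by_] := cspace_bnd y e2.
have -> : e + (cspace_norm x + cspace_norm y) =
  (cspace_norm x + e / 2) + (cspace_norm y + e / 2).
  by rewrite addrACA -splitr addrC.
apply/(cspace_normP (x + y) (addr_gt0 hx hy)); exact: (bndD hx hy bx by_).
Qed.

Lemma cspace_normZ_le (l : R[i]) (x : coord_space) :
  cspace_norm (l *: x) <= nrm l * cspace_norm x.
Proof.
have [->|l0] := eqVneq l 0.
  rewrite nrm0 mul0r scale0r; apply/ler_addgt0Pl => e e0; rewrite addr0.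
  apply/(cspace_normP 0 e0); case: (k) => [|p p1] /=.
    by move=> g; rewrite nrm0 ltW.
  apply/psumP => s _; rewrite big1 ?powR_ge0// => g _.
  by rewrite nrm0 powR0// gt_eqF// (lt_le_trans ltr01).
apply/ler_addgt0Pl => e e0.
have [h hb] := cspace_bnd x (divr_gt0 e0 (nrm_gt0C l0)).
have -> : e + nrm l * cspace_norm x = nrm l * (cspace_norm x + e / nrm l).
  by rewrite mulrDr mulrCA mulfV ?gt_eqF ?nrm_gt0C// mulr1 addrC.
apply/(cspace_normP (l *: x) (mulr_gt0 (nrm_gt0C l0) h)); exact: (bndZ h l0 hb).
Qed.

Lemma cspace_normZ (l : R[i]) (x : coord_space) :
  cspace_norm (l *: x) = nrm l * cspace_norm x.
Proof.
apply/eqP; rewrite eq_le cspace_normZ_le/=.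
have [->|l0] := eqVneq l 0; first by rewrite nrm0 mul0r coord_norm_ge0.
have := cspace_normZ_le l^-1 (l *: x).
by rewrite scalerA mulVf// scale1r nrmV_C// ler_pdivlMl ?nrm_gt0C.
Qed.

Lemma cspace_norm_eq0 (x : coord_space) : cspace_norm x = 0 -> x = 0.
Proof.
move=> x0; apply: coord_ext => g; apply: nrmC_eq0.
by apply/eqP; rewrite eq_le nrm_ge0 andbT -x0 cspace_norm_pt.
Qed.

HB.instance Definition _ := Lmodule_isNormed.Build R[i] coord_space
  (cnormD cspace_normD) (cnormZ cspace_normZ) (cnorm0 cspace_norm_eq0).

Lemma cspace_nrmE (x : coord_space) : nrm x = cspace_norm x.
Proof. by []. Qed.

Lemma bnd_lim (r : R) (v : nat -> Gamma -> R[i]) (w : Gamma -> R[i]) m :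
  0 < r -> (forall n, (m <= n)%N -> bnd k r (v n)) ->
  (forall g (e : R), 0 < e -> exists n0, forall n, (n0 <= n)%N ->
     nrm (w g - v n g) <= e) ->
  bnd k (r + r) w.
Proof.
move=> r0 hv hw.
have unif (s : seq Gamma) (e : R) : 0 < e -> exists n,
    (m <= n)%N /\ forall g, g \in s -> nrm (w g - v n g) <= e.
  move=> e0; suff [n0 H] : exists n0, forall n, (n0 <= n)%N ->
      forall g, g \in s -> nrm (w g - v n g) <= e.
    by exists (maxn m n0); rewrite leq_maxl; split=> //; apply: H; rewrite leq_maxr.
  elim: s => [|a s [n0 IH]]; first by exists 0%N.
  have [n1 H1] := hw a e e0; exists (maxn n0 n1) => n.
  rewrite geq_max => /andP[h0 h1] g; rewrite inE => /orP[/eqP->|]; first exact: H1.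
  exact: IH.
case: (k) hv => [|p p1] /= hv.
  move=> g; have [n [mn /(_ g)]] := unif [:: g] r r0.
  rewrite inE => /(_ (eqxx g)) h.
  by rewrite -[w g](subrK (v n g)) (le_trans (nrmD _ _))// lerD// hv.
have p0 : 0 < p by rewrite (lt_le_trans ltr01).
apply/psumP => s us.
pose N : R := (size s).+1%:R.
have N0 : 0 < N by rewrite ltr0n.
have iN : 0 < N^-1 by rewrite invr_gt0.
have [n [mn Hn]] := unif s (r * N^-1 `^ p^-1) (mulr_gt0 r0 (powR_gt0 _ iN)).
pose z g := if g \in s then w g - v n g else 0.
have bz : bnd (KindLp p1) r z.
  apply/psumP => s' us'.
  apply: (@le_trans _ _ (\sum_(g <- s' | g \in s) nrm (z g) `^ p)).
    rewrite [leLHS](bigID (fun g => g \in s))/= [X in _ + X]big1 ?addr0//.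
    move=> g /negbTE; rewrite /z => ->.
    by rewrite nrm0 powR0// gt_eqF.
  apply: (@le_trans _ _ (\sum_(g <- s' | g \in s) (r `^ p * N^-1))).
    apply: ler_sum => g gs; rewrite /z gs.
    have := le_powR p1 (nrm_ge0 _) _ (Hn g gs).
    rewrite powRM ?powR_ge0 ?(ltW r0)// -powRrM mulVf ?gt_eqF// powRr1 ?invr_ge0 ?(ltW N0)//.
    by apply; rewrite mulr_ge0 ?powR_ge0 ?(ltW r0).
  rewrite big_const_seq iter_addr_0 -mulr_natr -mulrA ler_piMr ?powR_ge0//.
  rewrite ler_pdivrMl// mulr1 /N ler_nat.
  rewrite -size_filter (leq_trans _ (leqnSn _))//.
  apply: uniq_leq_size; first exact: filter_uniq.
  by move=> g; rewrite mem_filter => /andP[].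
have /psumP/(_ s us) := bndD r0 r0 bz (hv n mn).
apply: le_trans; rewrite big_seq [leRHS]big_seq.
by apply: ler_sum => g gs; rewrite /z gs subrK.
Qed.

Lemma coord_complete (F : set_system coord_space) :
  ProperFilter F -> cauchy F -> cvg F.
Proof.
apply: fast_complete => u fu.
have fg g : fast (@nrm R R[i]) (fun n => u n g).
  move=> m n mn; rewrite (le_trans _ (fu _ _ mn))//.
  exact: (cspace_norm_pt (u n - u m)).
have [l Hl] := choice (fun g => complex_fast (fg g)).
have bl m : bnd k (dyad R m + dyad R m) (fun g => l g - u m g).
  apply: (@bnd_lim _ (fun n => u n - u m) _ m); first exact: dyad_gt0.
    move=> n mn; apply/(cspace_normP (u n - u m)); first exact: dyad_gt0.
    exact: fu.
  move=> g e e0; have [n0 H] := dyad_small e0; exists n0 => n n0n.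
  rewrite -[X in nrm X]/(l g - u m g - (u n g - u m g)).
  rewrite opprB addrA subrK (le_trans (Hl g n))//; exact: H.
have lin : in_space k l.
  case: (k) (bl) (fun m => coord_in (u m)) => [|p p1] /= bl' uin.
    move=> e e0; have e4 : 0 < e / 4 by rewrite divr_gt0.
    have [m /(_ _ (leqnn _)) hm] := dyad_small e4.
    have e2 : 0 < e / 2 by rewrite divr_gt0.
    apply: sub_finite_set (uin m _ e2) => g /= h.
    have := nrmD (l g - u m g) (u m g); rewrite subrK.
    by have := bl' m g; move: h hm; lra.
  have := in_spaceD (k := KindLp p1) (bnd_in_lp (bl' 0%N)) (uin 0%N).
  by under eq_fun do rewrite subrK.
have lP : l \in coord_pred by exact/asboolP.
exists (CoordSpace lP) => e e0; have e2 : 0 < e / 2 by rewrite divr_gt0.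
have [n0 H] := dyad_small e2; exists n0 => n n0n.
rewrite cspace_nrmE (@le_trans _ _ (dyad R n + dyad R n))//.
  apply/(cspace_normP (CoordSpace lP - u n) (addr_gt0 (dyad_gt0 R n) (dyad_gt0 R n))).
  exact: bl.
by have := H _ n0n; lra.
Qed.

HB.instance Definition _ := Uniform_isComplete.Build coord_space coord_complete.

Definition coord_delta (g : Gamma) : Gamma -> R[i] :=
  fun h => if h == g then 1 else 0.

Lemma coord_delta_subproof g : coord_delta g \in coord_pred.
Proof.
apply/asboolP; case: (k) => [|p p1].
  move=> e e0; apply: (@sub_finite_set _ _ [set g]) => // h /=.
  by rewrite /coord_delta; case: eqVneq => // _; rewrite nrm0 leNgt e0.
apply: (@bnd_in_lp _ _ 1) => /=; apply/psumP => s us.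
rewrite powR1 (bigID (fun h => h == g))/= [X in _ + X]big1 ?addr0; last first.
  move=> h /negbTE; rewrite /coord_delta => ->.
  by rewrite nrm0 powR0// gt_eqF// (lt_le_trans ltr01).
rewrite (eq_bigr (fun=> 1)); last first.
  by move=> h /eqP->; rewrite /coord_delta eqxx /nrm normr1 powR1.
rewrite big_const_seq iter_addr_0 lern1.
by rewrite (count_uniq_mem _ us) leq_b1.
Qed.

Lemma coord_nontrivial : exists x : coord_space, x != 0.
Proof.
exists (CoordSpace (coord_delta_subproof point)); apply/eqP.
move=> /(congr1 (fun x : coord_space => x point))/=.
by rewrite /coord_delta eqxx => /eqP; rewrite oner_eq0.
Qed.
HB.instance Definition _ := isNontrivial.Build coord_space coord_nontrivial.

Definition restr (A : set Gamma) x : Gamma -> R[i] :=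
  fun g => if g \in A then x g else 0.

Lemma restr_le A x g : nrm (restr A x g) <= nrm (x g).
Proof. by rewrite /restr; case: ifP => // _; rewrite nrm0 nrm_ge0. Qed.

Lemma coord_restr_subproof A (x : coord_space) : restr A x \in coord_pred.
Proof. apply/asboolP; exact: in_space_mono (restr_le A x) (coord_in x). Qed.

Definition coord_restr A (x : coord_space) : coord_space :=
  CoordSpace (coord_restr_subproof A x).

Lemma coord_proj_subproof A : coord_restr A \in @bop_pred R coord_space.
Proof.
apply/bop_predP; split.
  move=> l x y; apply: coord_ext => g /=.
  rewrite -[RHS]/(l * restr A x g + restr A y g) /restr.
  by case: ifP => // _; rewrite mulr0 addr0.
exists 1 => x; rewrite mul1r !cspace_nrmE; apply/ler_addgt0Pl => e e0.
have [h hb] := cspace_bnd x e0; rewrite addrC; apply/(cspace_normP (coord_restr A x) h).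
exact: bnd_mono (restr_le A x) hb.
Qed.

Definition coord_proj A : bop coord_space := Bop (coord_proj_subproof A).

Definition card_lt (T U : Type) (A : set T) (B : set U) : bool :=
  (A #<= B) && ~~ (B #<= A).

(* Cardinals are represented by sets: kappa is the cardinality of [kappa]. *)
Definition kcompact (T : Type) (kappa : set T) : set (bop coord_space) :=
  [set S | forall e : R, 0 < e -> exists2 A : set Gamma,
     card_lt A kappa & bnorm (S - coord_proj A * S) <= e].

End CoordinateSpaces.
Arguments kcompact {R Gamma} k {T} kappa.

Definition countably_incomplete (I : Type) (U : set_system I) : Prop :=
  exists B : nat -> set I, (forall n, U (B n)) /\ \bigcap_n B n = set0.

(* Main.v *)
(** The norm of [T] in the quotient by the [kappa]-compact operators is the infimum
    of the norms of [(1 - P_C) T], over the sets [C] of fewer than [|Gamma|]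
    coordinates.  If [T] has quotient norm [1] and norm at most [1 + e], then the image
    under [T] of a suitable finitely supported unit vector keeps norm almost [1]
    outside of any prescribed small set of coordinates.  Zorn's lemma turns this
    into [|Gamma|] disjointly supported vectors [x_j] of norm at most [1] whose
    images are close to disjointly supported vectors [y_j] of norm close to [1].
    With [V e_j = x_j] and [Q] built from norming functionals of the [y_j], both of
    norm at most [1], the operator [Q T V] is close to the identity, and a Neumann
    series gives a factorization of the identity with almost optimal constant.

    The errors [T x_j - y_j] must be summable against the coordinates of every
    vector.  On [l_1] a uniform error is enough, and it comes for free from the
    additivity of the norm.  On the other spaces the rows of [T] vanish at infinity,
    so the errors can be chosen summable if [Gamma] is countable, and zero if it is
    not. *)
Require Import Defs.
From HB Require Import structures.
From mathcomp Require Import all_boot all_order all_algebra.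
From mathcomp Require Import all_classical all_reals all_analysis.
From mathcomp Require Import complex ring lra.

Set Implicit Arguments.
Unset Strict Implicit.
Unset Printing Implicit Defensive.

Import Order.TTheory GRing.Theory Num.Theory.
Import numFieldNormedType.Exports.
Local Open Scope classical_set_scope.
Local Open Scope card_scope.
Local Open Scope complex_scope.
Local Open Scope ring_scope.

(** * Cardinal arithmetic by maximal disjoint families *)

Section Cardinals.

Lemma card_le_inj (T U : Type) (A : set T) (B : set U) (f : T -> U) :
  (forall x, A x -> B (f x)) ->
  (forall x y, A x -> A y -> f x = f y -> x = y) -> A #<= B.
Proof.
move=> fAB finj.
have fi : {in A &, injective f}.
  by move=> x y /set_mem Ax /set_mem Ay; exact: finj.
rewrite -(card_le_eql (inj_card_eq fi)).
by apply: subset_card_le => _ [x Ax <-]; exact: fAB.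
Qed.

Lemma card_inj_le (T : Type) (U : pointedType) (A : set T) (B : set U) :
  A #<= B -> exists f : T -> U, (forall x, A x -> B (f x)) /\
    (forall x y, A x -> A y -> f x = f y -> x = y).
Proof.
move=> /pcard_leP/unsquash f; exists f; split; first by move=> x; exact: funS.
by move=> x y Ax Ay; apply: inj; rewrite inE.
Qed.

(** If [B i] met no [B j], then [i] could be added to [E], against maximality. Nonemptiness of [B i]
    ensures that [i] is not yet in [E]. *)
Lemma maximal_disjointP (I T : Type) (B : I -> set T) (D E : set I) i :
  maximal_disjoint_subcollection B E D -> D i -> B i !=set0 ->
  exists2 j, E j & B j `&` B i !=set0.
Proof.
move=> [ED tE maxE] Di Bi0; apply: contrapT => /forall2NP H.
have dis j : E j -> B j `&` B i = set0.
  move=> Ej; apply: contrapT => /eqP/set0P h.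
  by case: (H j).
have nEi : ~ E i.
  by move=> /dis; rewrite setIid => Bi; case: Bi0 => x; rewrite Bi.
apply: (maxE (i |` E)).
- split; last by move=> /(_ i); apply/contra_not: nEi; apply; left.
  by move=> j Ej; right.
- by move=> j [->//|/ED].
- move=> a b [->|Ea] [->|Eb] //; last by exact: tE.
  + by rewrite setIC dis// => -[].
  + by rewrite dis// => -[].
Qed.

(** A maximal disjoint family [E] of injective sequences covers [A] up to a finite set. Hence [A]
    has the cardinality of [E] times [nat], and a further factor [nat] is absorbed there by
    [card_nat2]. *)
Lemma card_prod_nat_le (T : pointedType) (A : set T) : infinite_set A ->
  A `*` [set: nat] #<= A.
Proof.
move=> Ainf.
pose D := [set f : nat -> T | injective f /\ range f `<=` A].
have [E mE] := ex_maximal_disjoint_subcollection (fun f : nat -> T => range f) D.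
have [ED tE _] := mE.
pose rest := A `\` \bigcup_(f in E) range f.
have rfin : finite_set rest.
  apply: contrapT => /infiniteP/card_inj_le[f [fr finj]].
  have [||g Eg [_ [[n _ <-] [m _ fm]]]] := @maximal_disjointP _ _ _ D E f mE.
  - by split; [by move=> n m; exact: finj|by move=> _ [n _ <-]; case: (fr n I)].
  - by exists (f 0%N), 0%N.
  - by have [_] := fr m I; apply; exists g => //; exists n.
have [f0 Ef0] : E !=set0.
  apply/set0P/eqP => E0; apply: Ainf; rewrite /rest E0 bigcup_set0 setD0 in rfin.
  exact: rfin.
have /countable_injP[e einj] := finite_set_countable rfin.
(* Points on a sequence get even second components. The finitely many remaining points get odd ones
   at the fixed sequence [f0], so that the two codes never collide. *)
have codeP a : exists c : (nat -> T) * nat, A a -> E c.1 /\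
    ((~ rest a /\ a = c.1 c.2./2 /\ ~~ odd c.2) \/
     (rest a /\ c = (f0, (e a).*2.+1))).
  have [Aa|nAa] := pselect (A a); last by exists (f0, 0%N).
  have [ra|nra] := pselect (rest a); first by exists (f0, (e a).*2.+1) => _; split; [|right].
  have [f Ef [n _ fn]] : (\bigcup_(f in E) range f) a.
    by apply: contrapT => h; apply: nra.
  by exists (f, n.*2) => _; split=> //=; left; rewrite doubleK odd_double.
have [c cP] := choice codeP.
have AE : A #<= E `*` [set: nat].
  apply: (card_le_inj (f := c)) => [a /cP[] //|a b Aa Ab].
  have [_ ha] := cP a Aa; have [_ hb] := cP b Ab => cab.
  case: ha hb => [[_ [aE oa]]|[ra ca]] [[_ [bE ob]]|[rb cb]].
  - by rewrite aE bE cab.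
  - by move: oa; rewrite cab cb/= odd_double.
  - by move: ob; rewrite -cab ca/= odd_double.
  - move: cab; rewrite ca cb => -[/double_inj eab].
    by apply: einj; rewrite ?inE.
have EA : E `*` [set: nat] #<= A.
  apply: (card_le_inj (f := fun c : (nat -> T) * nat => c.1 c.2)).
    by move=> [f n] [/= /ED[_ h] _]; apply: h; exists n.
  move=> [f n] [g m] [/= Ef _] [/= Eg _] fg.
  have fgE : f = g by apply: tE => //; exists (f n); split; [exists n|exists m].
  by move: fg; rewrite fgE => /(proj1 (ED _ Eg)) ->.
apply: card_le_trans EA.
have /card_eqPle[/card_inj_le[h [_ hi]] _] := card_nat2.
have [k [kE ki]] := card_inj_le AE.
apply: (card_le_inj (f := fun an : T * nat => ((k an.1).1, h ((k an.1).2, an.2)))).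
  by move=> [a n] [/= Aa _]; have [] := kE a Aa.
move=> [a n] [b m] [/= Aa _] [/= Ab _] [kab /(hi _ _ I I)[kab2 ->]].
congr (_, _); apply: ki => //.
by rewrite (surjective_pairing (k a)) kab kab2 -surjective_pairing.
Qed.

(** Two pairs have disjoint images under [F] when they share no component, so a maximal disjoint
    family is a maximal partial injection. It exhausts [A] or [B], as a point left over on each side
    would give a new pair. *)
Lemma card_le_total (T U : pointedType) (A : set T) (B : set U) :
  A #<= B \/ B #<= A.
Proof.
pose F (q : T * U) : set (T + U) := [set s | s = inl q.1 \/ s = inr q.2].
have [E mE] := ex_maximal_disjoint_subcollection F (A `*` B).
have [ED tE _] := mE.
have El q q' : E q -> E q' -> q.1 = q'.1 -> q = q'.
  by move=> Eq Eq' qq; apply: tE => //; exists (inl q.1); split; left; rewrite ?qq.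
have Er q q' : E q -> E q' -> q.2 = q'.2 -> q = q'.
  by move=> Eq Eq' qq; apply: tE => //; exists (inr q.2); split; right; rewrite ?qq.
have [Afull|/existsNP[a /not_implyP[Aa na]]] :=
    pselect (forall a, A a -> exists b, E (a, b)).
  left; have [f fE] : exists f : T -> U, forall a, A a -> E (a, f a).
    have /choice[f Hf] : forall a, exists b, A a -> E (a, b).
      move=> a; have [/Afull[b ?]|nA] := pselect (A a); first by exists b.
      by exists point.
    by exists f.
  apply: (card_le_inj (f := f)) => [a /fE/ED[]//|a a' Aa Aa' ff].
  by have [] := Er _ _ (fE _ Aa) (fE _ Aa') ff.
have Bfull b : B b -> exists a, E (a, b).
  move=> Bb; apply: contrapT => nb.
  have [||[a' b'] Eab [s [/= h1 h2]]] := maximal_disjointP (i := (a, b)) mE.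
  - by [].
  - by exists (inl a); left.
  - case: h1 h2 => -> [] // [] h; subst.
      by apply: na; exists b'.
    by apply: nb; exists a'.
right; have [f fE] : exists f : U -> T, forall b, B b -> E (f b, b).
  have /choice[f Hf] : forall b, exists a, B b -> E (a, b).
    move=> b; have [/Bfull[a' ?]|nB] := pselect (B b); first by exists a'.
    by exists point.
  by exists f.
apply: (card_le_inj (f := f)) => [b /fE/ED[]//|b b' Bb Bb' ff].
by have [] := El _ _ (fE _ Bb) (fE _ Bb') ff.
Qed.

(** Two copies of [B] embed in [B] times [nat], hence in [B]. *)
Lemma card_setU_le (T : pointedType) (A B : set T) : infinite_set B ->
  A #<= B -> A `|` B #<= B.
Proof.
move=> Binf /card_inj_le[f [fB fi]]; apply: card_le_trans (card_prod_nat_le Binf).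
apply: (card_le_inj (f := fun x => if x \in B then (x, 0%N) else (f x, 1%N))).
  move=> x [Ax|Bx]; last by rewrite mem_set.
  by case: ifPn => [/set_mem//|_]; split=> //; exact: fB.
move=> x y hx hy; case: ifPn => xB; case: ifPn => yB // -[] // fxy.
move/negP in xB; move/negP in yB.
apply: fi => //; first by case: hx => // /mem_set.
by case: hy => // /mem_set.
Qed.

End Cardinals.

(** * Sets of fewer than [Gamma] coordinates *)

Section SmallSets.
Variable Gamma : pointedType.
Hypothesis Gamma_infinite : infinite_set [set: Gamma].
Implicit Types A B : set Gamma.

Definition small A : Prop := card_lt A [set: Gamma].

Definition uncountable : Prop := ~ countable [set: Gamma].

(* Chosen so that the union of a [small] family of [tiny] sets is [small]. *)
Definition tiny A : Prop := finite_set A \/ (countable A /\ uncountable).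

Lemma smallP A : small A <-> ~ ([set: Gamma] #<= A).
Proof.
rewrite /small /card_lt; split=> [/andP[_ /negP]//|/negP ->].
by rewrite andbT subset_card_le.
Qed.

Lemma small_sub A B : A `<=` B -> small B -> small A.
Proof.
move=> AB /smallP nB; apply/smallP => h; apply: nB; apply: card_le_trans h _.
exact: subset_card_le.
Qed.

Lemma tiny_small A : tiny A -> small A.
Proof.
move=> [Afin|[cA uG]]; apply/smallP => h.
  by apply: Gamma_infinite; exact: card_le_finite h Afin.
by apply: uG; exact: sub_countable h cA.
Qed.

(** A finite union of tiny sets is tiny. For infinite [A], the union injects into [A] times [nat],
    because tiny sets are countable, and so into [A]. *)
Lemma small_bigcup A (N : Gamma -> set Gamma) : small A ->
  (forall a, A a -> tiny (N a)) -> small (\bigcup_(a in A) N a).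
Proof.
move=> sA tN; have [Afin|Ainf] := pselect (finite_set A).
  apply: tiny_small; have [uG|cG] := pselect uncountable.
    right; split=> //; apply: bigcup_countable => [|a /tN[/finite_set_countable//|[]//]].
    exact: finite_set_countable.
  by left; apply: bigcup_finite => // a /tN[//|[]].
apply/smallP => h; move/smallP: sA; apply; apply: card_le_trans h _.
apply: card_le_trans (card_prod_nat_le Ainf).
have cN a : A a -> countable (N a) by move=> /tN[/finite_set_countable|[]].
have /choice[e eP] : forall a, exists e : Gamma -> nat, A a -> {in N a &, injective e}.
  move=> a; have [/cN/countable_injP[e ei]|nA] := pselect (A a); first by exists e.
  by exists (fun=> 0%N).
have /choice[f fP] : forall g, exists a, (\bigcup_(a in A) N a) g -> A a /\ N a g.
  move=> g; have [[a Aa Na]|nA] := pselect ((\bigcup_(a in A) N a) g); first by exists a.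
  by exists point.
apply: (card_le_inj (f := fun g => (f g, e (f g) g))) => [g /fP[]//|g h /fP[Ag Ng]].
move=> /fP[Ah Nh] [fgh]; rewrite -fgh => /(eP _ Ag); apply; rewrite inE//.
by rewrite fgh.
Qed.

Lemma small_setU A B : small A -> small B -> small (A `|` B).
Proof.
wlog AB : A B / A #<= B.
  move=> H sA sB; have [AB|BA] := card_le_total A B; first exact: H.
  by rewrite setUC; exact: H.
move=> sA sB; have [Bfin|Binf] := pselect (finite_set B).
  apply: tiny_small; left; rewrite finite_setU; split=> //.
  exact: card_le_finite AB Bfin.
move/smallP: sB => nB; apply/smallP => h; apply: nB.
exact: card_le_trans h (card_setU_le Binf AB).
Qed.

Lemma small_compl_nonempty A : small A -> exists g, ~ A g.
Proof.
move=> /smallP nA; apply: contrapT => /forallNP h; apply: nA.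
by apply: subset_card_le => g _; apply: contrapT; exact: h.
Qed.

(** [Gamma] times [nat] embeds in [Gamma], and the images of two different slices are disjoint and
    large. The coordinate projection onto such a set will be a nontrivial idempotent modulo the
    ideal. *)
Lemma ex_large_colarge : exists A, ~ small A /\ ~ small (~` A).
Proof.
have /card_inj_le[f [_ fi]] := card_prod_nat_le Gamma_infinite.
have {}fi : injective f by move=> x y; exact: fi.
have H n : [set: Gamma] #<= f @` [set q | q.2 = n].
  apply: (card_le_inj (f := fun g => f (g, n))) => [g _|g h _ _ /fi[]//].
  by exists (g, n).
exists (f @` [set q | q.2 = 0%N]); split; first by move=> /smallP; exact.
move=> /smallP; apply; apply: card_le_trans (H 1%N) _.
apply: subset_card_le => _ [[g n] /= -> <-]; rewrite /setC/= => -[[h m] /= ->].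
by move=> /fi[].
Qed.

End SmallSets.

(** * Summable families of errors *)

Section Weights.
Variables (R : realType) (Gamma : pointedType).

(* The errors up to which every vector is supported in some [tiny] set
   ([ex_tiny_tail]).  Zero has to be allowed when [Gamma] is uncountable, as all
   but countably many terms of a summable family vanish ([ex_weights]). *)
Definition admissible (r : R) : Prop := 0 < r \/ (r = 0 /\ uncountable Gamma).

Lemma admissible_ge0 r : admissible r -> 0 <= r.
Proof. by move=> [/ltW//|[->]]. Qed.

Lemma sum_dyad_le (s : seq nat) : uniq s -> \sum_(n <- s) dyad R n.+1 <= 1.
Proof.
move=> us; pose N := (\max_(n <- s) n).+1.
have sN n : n \in s -> (n < N)%N by move=> ns; rewrite ltnS; exact: leq_bigmax_seq.
have -> : \sum_(n <- s) dyad R n.+1 = \sum_(0 <= n < N | n \in s) dyad R n.+1.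
  rewrite -[RHS]big_filter; apply: perm_big; apply: uniq_perm => //.
    by rewrite filter_uniq// iota_uniq.
  move=> n; rewrite mem_filter mem_index_iota/=; case: (boolP (n \in s)) => //= ns.
  by rewrite sN.
apply: (@le_trans _ _ (\sum_(0 <= n < N) dyad R n.+1)).
  rewrite big_mkcond; apply: ler_sum => n _; case: ifP => // _.
  exact/ltW/dyad_gt0.
suff -> M : \sum_(0 <= n < M) dyad R n.+1 = 1 - dyad R M.
  by rewrite gerBl ltW// dyad_gt0.
elim: M => [|M IH]; first by rewrite big_geq// /dyad expr0 subrr.
by rewrite big_nat_recr//= IH /dyad exprS; lra.
Qed.

(** A countable [Gamma] carries a geometric series of positive weights. On an uncountable one all
    weights are zero, which is admissible there. *)
Lemma ex_weights r : admissible r -> exists w : Gamma -> R,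
  (forall g, admissible (w g)) /\
  (forall s, uniq s -> \sum_(g <- s) w g <= r).
Proof.
move=> [r0|[-> uG]]; last first.
  by exists (fun=> 0); split=> [g|s _]; [right|rewrite big1].
have [uG|] := pselect (uncountable Gamma).
  by exists (fun=> 0); split=> [g|s _]; [right|rewrite big1// ltW].
move=> /contrapT/countable_injP[e ei].
have {}ei : injective e by move=> x y; apply: ei; rewrite inE.
exists (fun g => r * dyad R (e g).+1); split=> [g|s us].
  by left; rewrite mulr_gt0// dyad_gt0.
rewrite -mulr_sumr ler_piMr ?(ltW r0)//.
by rewrite -(big_map e xpredT (fun n => dyad R n.+1)) sum_dyad_le// map_inj_uniq.
Qed.

(** A positive tolerance needs only a finite set. Tolerance zero is reached by the countable union
    of the finite sets for the tolerances [dyad R n]. *)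
Lemma ex_tiny (P : R -> set Gamma -> Prop) r : admissible r ->
  (forall d e A B, d <= e -> A `<=` B -> P d A -> P e B) ->
  (forall e, 0 < e -> exists2 A, finite_set A & P e A) ->
  (forall A, (forall e, 0 < e -> P e A) -> P 0 A) ->
  exists2 A, tiny A & P r A.
Proof.
move=> [r0|[-> uG]] mono fin lim.
  by have [A fA PA] := fin r r0; exists A => //; left.
have hA n : exists A, finite_set A /\ P (dyad R n) A.
  by have [A fA PA] := fin _ (dyad_gt0 R n); exists A.
have [A AP] := choice hA.
exists (\bigcup_n A n).
  right; split=> //; apply: bigcup_countable => // n _.
  by apply: finite_set_countable; case: (AP n).
apply: lim => e /dyad_small[n /(_ n (leqnn n)) ne].
by apply: mono ne _ (proj2 (AP n)); exact: bigcup_sup.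
Qed.

End Weights.

(** * Tails of vectors and finite supports *)

Section CoordinateFunctions.
Variables (R : realType) (Gamma : pointedType).
Implicit Types (k : coord_kind R) (x : Gamma -> R[i]).

Lemma nrm1C : nrm (1 : R[i]) = 1. Proof. by rewrite /nrm normr1. Qed.

Lemma bnd_delta k (g : Gamma) : bnd k 1 (coord_delta R g).
Proof.
have d h : nrm (coord_delta R g h) = (h == g)%:R.
  by rewrite /coord_delta; case: eqP => _; rewrite ?nrm0 ?nrm1C.
case: k => [h /=|p p1]; first by rewrite d lern1 leq_b1.
apply/psumP => s us; rewrite powR1 (eq_bigr (fun h => (h == g)%:R)).
  rewrite -natr_sum lern1 (leq_trans _ (leq_b1 (g \in s)))//.
  rewrite -(count_uniq_mem _ us) -sum1_count [leqRHS]big_mkcond.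
  by apply: leq_sum => h _ /=; case: eqP.
move=> h _; rewrite d; case: (h == g); first by rewrite powR1.
by rewrite powR0// gt_eqF// (lt_le_trans ltr01).
Qed.

Lemma finite_tail k x (e : R) : in_space k x -> 0 < e ->
  exists2 D, finite_set D & bnd k e (restr (~` D) x).
Proof.
move=> xin e0; case: k xin => [|p p1] xin.
  exists [set g | e <= nrm (x g)]; first exact: xin.
  move=> g; rewrite /restr in_setC; case: ifPn; last by rewrite nrm0 ltW.
  by rewrite notin_setE => /negP; rewrite -ltNge => /ltW.
have p0 : 0 < p by rewrite (lt_le_trans ltr01).
have := psum_fin xin; set S := fine _ => SE.
have [s [us sS]] : exists s, uniq s /\ S - e `^ p < \sum_(g <- s) nrm (x g) `^ p.
  apply: contrapT => /forallNP H.
  suff : (psum p x <= (S - e `^ p)%:E)%E.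
    by rewrite SE lee_fin lerBrDr gerDl leNgt powR_gt0.
  by apply/psumP => s us; rewrite leNgt; apply/negP => h; apply: (H s).
exists [set` s] => //; apply/psumP => t ut.
(* The terms of [t] outside [s] fit next to [s] in one partial sum, bounded by [S]. The sum over [s]
   falls short of [S] by less than the p-th power of [e]. *)
have ust : uniq (s ++ [seq g <- t | g \notin s]).
  rewrite cat_uniq us filter_uniq// andbT -all_predC.
  by apply/allP => g; rewrite mem_filter => /andP[].
have : (psum p x <= S%:E)%E by rewrite SE.
move=> /psumP/(_ _ ust); rewrite big_cat/= big_filter => H.
have -> : \sum_(g <- t) nrm (restr (~` [set` s]) x g) `^ p =
    \sum_(g <- t | g \notin s) nrm (x g) `^ p.
  rewrite [RHS]big_mkcond/=; apply: eq_bigr => g _.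
  have -> : (g \notin s) = (g \in ~` [set` s]).
    by rewrite in_setC; congr negb; apply/idP/idP; rewrite inE.
  by rewrite /restr; case: ifP => // _; rewrite nrm0 powR0// gt_eqF.
by move: sS H; lra.
Qed.

End CoordinateFunctions.

Lemma nrm_sum (R : realType) (V : normedZmodType R[i]) (I : Type) (s : seq I) (F : I -> V) :
  nrm (\sum_(i <- s) F i) <= \sum_(i <- s) nrm (F i).
Proof.
elim: s => [|i s IH]; first by rewrite !big_nil nrm0.
by rewrite !big_cons (le_trans (nrmD _ _))// lerD2l.
Qed.

Section OperatorTheory.
Variables (R : realType) (E : banachType R).
Implicit Types (S T : bop E) (x y : E).

Lemma bopD S x y : S (x + y) = S x + S y. Proof. exact: linearD. Qed.
Lemma bopB S x y : S (x - y) = S x - S y. Proof. exact: linearB. Qed.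
Lemma bopZ S (l : R[i]) x : S (l *: x) = l *: S x. Proof. exact: linearZ. Qed.
Lemma bop0 S : S 0 = 0. Proof. exact: linear0. Qed.
Lemma bop_sum S (I : Type) (s : seq I) (P : pred I) (F : I -> E) :
  S (\sum_(i <- s | P i) F i) = \sum_(i <- s | P i) S (F i).
Proof. exact: linear_sum. Qed.

Lemma bop_mulE S T x : (S * T) x = S (T x). Proof. by []. Qed.
Lemma bop_subE S T x : (S - T) x = S x - T x. Proof. by []. Qed.
Lemma bop_oneE x : (1 : bop E) x = x. Proof. by []. Qed.

Lemma bop_nrm S x : nrm (S x) <= bnorm S * nrm x. Proof. exact: opnorm_ub. Qed.

End OperatorTheory.

Section CoordinateVectors.
Variables (R : realType) (Gamma : pointedType) (k : coord_kind R).
Local Notation E := (coord_space Gamma k).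
Implicit Types (x y z : E) (A B D : set Gamma) (g : Gamma) (T : bop E).

Lemma coordD x y g : (x + y) g = x g + y g. Proof. by []. Qed.
Lemma coordN x g : (- x) g = - x g. Proof. by []. Qed.
Lemma coord_zero g : (0 : E) g = 0. Proof. by []. Qed.
Lemma coordZ (l : R[i]) x g : (l *: x) g = l * x g. Proof. by []. Qed.
Lemma coord_sum (I : Type) (s : seq I) (P : pred I) (F : I -> E) g :
  (\sum_(i <- s | P i) F i) g = \sum_(i <- s | P i) F i g.
Proof.
exact: (big_morph (fun x : E => x g) (fun x y => coordD x y g) (coord_zero g)).
Qed.

Lemma nrm_coord x g : nrm (x g) <= nrm x.
Proof. exact: cspace_norm_pt. Qed.

Lemma nrm_bndP x r : 0 < r -> nrm x <= r <-> bnd k r x.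
Proof. exact: cspace_normP. Qed.

Lemma nrm_bnd x (e : R) : 0 < e -> 0 < nrm x + e /\ bnd k (nrm x + e) x.
Proof. exact: cspace_bnd. Qed.

Local Opaque nrm.

Lemma nrm_le_bnd x y : (forall r, 0 < r -> bnd k r y -> bnd k r x) ->
  nrm x <= nrm y.
Proof.
move=> H; apply/ler_addgt0Pl => e e0; have [h hb] := nrm_bnd y e0.
by rewrite addrC; apply/(nrm_bndP x h)/H.
Qed.

Lemma nrm_coord_mono x y : (forall g, nrm (x g) <= nrm (y g)) -> nrm x <= nrm y.
Proof. by move=> xy; apply: nrm_le_bnd => r r0; exact: bnd_mono. Qed.

Lemma nrm_coord_le x y (c : R) : 0 <= c ->
  (forall g, nrm (x g) <= c * nrm (y g)) -> nrm x <= c * nrm y.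
Proof.
move=> c0 xy; rewrite -[c in leRHS](ger0_norm c0) -nrm_real -nrmZ.
by apply: nrm_coord_mono => g; rewrite coordZ nrmM1 nrm_real ger0_norm.
Qed.

Lemma restrE A x g : coord_restr A x g = if g \in A then x g else 0.
Proof. by []. Qed.

Lemma coord_restr_le A x : nrm (coord_restr A x) <= nrm x.
Proof. by apply: nrm_coord_mono => g; exact: restr_le. Qed.

Lemma coord_projE A x : coord_proj k A x = coord_restr A x. Proof. by []. Qed.

Lemma restrD A x y : coord_restr A (x + y) = coord_restr A x + coord_restr A y.
Proof. exact: (linearD (coord_proj k A) x y). Qed.

Lemma restr_compl A x : x - coord_restr A x = coord_restr (~` A) x.
Proof.
apply: coord_ext => g; rewrite coordD coordN !restrE in_setC.
by case: (g \in A); rewrite ?subrr ?subr0.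
Qed.

Lemma restr_split A x : x = coord_restr A x + coord_restr (~` A) x.
Proof. by rewrite -restr_compl addrCA subrr addr0. Qed.

Lemma restr_restr A B x : coord_restr A (coord_restr B x) = coord_restr (A `&` B) x.
Proof.
by apply: coord_ext => g; rewrite !restrE in_setI; case: (g \in A).
Qed.

Lemma restr_sub_le A B x : A `<=` B ->
  nrm (coord_restr A x) <= nrm (coord_restr B x).
Proof.
move=> AB; rewrite -(setIidl AB) -restr_restr; exact: coord_restr_le.
Qed.

Lemma proj_norm_le A : bnorm (coord_proj k A) <= 1 :> R.
Proof. by apply: opnorm_le => // x; rewrite mul1r; exact: coord_restr_le. Qed.

Lemma projC A : 1 - coord_proj k A = coord_proj k (~` A).
Proof. by apply: bop_ext => x; exact: restr_compl. Qed.

Definition unit_vec g : E := CoordSpace (coord_delta_subproof k g).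

Lemma unit_vecE g h : unit_vec g h = if h == g then 1 else 0. Proof. by []. Qed.

Lemma nrm_unit_vec g : nrm (unit_vec g) = 1.
Proof.
apply/eqP; rewrite eq_le; apply/andP; split.
  exact/(nrm_bndP (unit_vec g) ltr01)/bnd_delta.
by have := nrm_coord (unit_vec g) g; rewrite unit_vecE eqxx nrm1C.
Qed.

Definition fin_supp x := finite_set [set g | x g != 0].

Lemma ex_finite_tail x (e : R) : 0 < e ->
  exists2 D, finite_set D & nrm (coord_restr (~` D) x) <= e.
Proof.
move=> e0; have [D fD h] := finite_tail (coord_in x) e0.
by exists D => //; apply/(nrm_bndP (coord_restr (~` D) x) e0).
Qed.

Lemma ex_tiny_tail x (r : R) : admissible Gamma r ->
  exists2 D, tiny D & nrm (coord_restr (~` D) x) <= r.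
Proof.
move=> ar; apply: (ex_tiny (P := fun r D => nrm (coord_restr (~` D) x) <= r) ar).
- move=> d e A B de AB h; apply: le_trans (le_trans h de).
  by apply: restr_sub_le; exact: subsetC.
- by move=> e; exact: ex_finite_tail.
- by move=> A H; apply/ler_addgt0Pl => e e0; rewrite addr0 H.
Qed.

Lemma fin_supp_restr D x : finite_set D -> fin_supp (coord_restr D x).
Proof.
apply: sub_finite_set => g /=; rewrite /restr.
by case: ifP => [/set_mem//|_]; rewrite eqxx.
Qed.

Lemma fin_supp_restrr A x : fin_supp x -> fin_supp (coord_restr A x).
Proof.
apply: sub_finite_set => g /=; rewrite /restr.
by case: ifP => // _; rewrite eqxx.
Qed.

Lemma restr_id A x : (forall g, ~ A g -> x g = 0) -> coord_restr A x = x.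
Proof.
move=> xA; apply: coord_ext => g; rewrite restrE.
by case: ifPn => //; rewrite notin_setE => /xA.
Qed.

Lemma restr_eq0 A x : (forall g, A g -> x g = 0) -> coord_restr A x = 0.
Proof.
move=> xA; apply: coord_ext => g; rewrite restrE.
by case: ifPn => // /set_mem/xA.
Qed.

Lemma coord_sum_unit (s : seq Gamma) (c : Gamma -> R[i]) g : uniq s ->
  (\sum_(h <- s) c h *: unit_vec h) g = if g \in s then c g else 0.
Proof.
move=> us; rewrite coord_sum; under eq_bigr do rewrite coordZ unit_vecE.
case: ifPn => [gs|gs].
  rewrite (bigD1_seq g)//= eqxx mulr1 big1 ?addr0// => h /negbTE.
  by rewrite eq_sym => ->; rewrite mulr0.
rewrite big1_seq// => h /andP[_ hs]; case: eqP => [gh|_]; last by rewrite mulr0.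
by rewrite gh hs in gs.
Qed.

Lemma fin_supp_expand x (s : seq Gamma) : uniq s ->
  (forall g, x g != 0 -> g \in s) -> x = \sum_(g <- s) x g *: unit_vec g.
Proof.
move=> us xs; apply: coord_ext => h; rewrite coord_sum_unit//.
by case: ifPn => // hs; apply/eqP; apply: contraNT hs; exact: xs.
Qed.

Lemma fin_suppP x : fin_supp x ->
  exists2 s : seq Gamma, uniq s & forall g, (g \in s) = (x g != 0).
Proof.
move=> fx; exists (finmap.enum_fset (fset_set [set g | x g != 0])).
  exact: finmap.fset_uniq.
by move=> g; rewrite in_fset_set// ; apply/idP/idP; rewrite inE.
Qed.

Lemma fin_supp_ind (S : bop E) x : fin_supp x ->
  exists2 s : seq Gamma, uniq s & (forall g, (g \in s) = (x g != 0)) /\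
    S x = \sum_(g <- s) x g *: S (unit_vec g).
Proof.
move=> /fin_suppP[s us sx]; exists s => //; split=> //.
rewrite {1}(@fin_supp_expand x s)//; last by move=> g; rewrite sx.
by rewrite bop_sum; apply: eq_bigr => g _; rewrite bopZ.
Qed.

(** Finitely supported vectors are dense in all the spaces considered, and [f] is continuous. *)
Lemma opnorm_le_fin (f : bop E) (M : R) : 0 <= M ->
  (forall x, fin_supp x -> nrm (f x) <= M * nrm x) -> bnorm f <= M.
Proof.
move=> M0 H; apply: opnorm_le => // x; apply/ler_addgt0Pl => e e0.
have N1 : 0 < bnorm f + 1 by rewrite ltr_wpDl// bnorm_ge0.
have [D fD hD] := ex_finite_tail x (divr_gt0 e0 N1).
rewrite {1}(restr_split D x) bopD (le_trans (nrmD _ _))// addrC lerD//.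
  rewrite (le_trans (bop_nrm _ _))//; move: hD; rewrite ler_pdivlMr//.
  by apply: le_trans; rewrite mulrC ler_wpM2l ?nrm_ge0// lerDl.
apply: (le_trans (H _ (fin_supp_restr x fD))).
exact: (ler_wpM2l M0 (coord_restr_le D x)).
Qed.

Lemma ex_fin_supp_lt (f : bop E) (M : R) : 0 <= M -> M < bnorm f ->
  exists x, [/\ fin_supp x, nrm x = 1 & M < nrm (f x)].
Proof.
move=> M0 Mf; have [x fx Mx] : exists2 x, fin_supp x & M * nrm x < nrm (f x).
  apply: contrapT => /forall2NP H; move: Mf; rewrite ltNge => /negP; apply.
  apply: opnorm_le_fin => // x fx; rewrite leNgt; apply/negP => h.
  by case: (H x).
have x0 : 0 < nrm x.
  rewrite lt_neqAle nrm_ge0 andbT; apply/eqP => /esym/nrm_eq0 x0.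
  by move: Mx; rewrite x0 bop0 !nrm0 mulr0 ltxx.
exists (((nrm x)^-1)%:C *: x); split.
- apply: sub_finite_set fx => g; rewrite /mkset; apply: contra => /eqP xg.
  by rewrite coordZ xg mulr0.
- by rewrite nrmZ nrm_real ger0_norm ?invr_ge0 ?nrm_ge0// mulVf// gt_eqF.
- rewrite bopZ nrmZ nrm_real ger0_norm ?invr_ge0 ?nrm_ge0//.
  rewrite ltr_pdivlMl; last exact: x0.
  by rewrite [ltLHS]mulrC; exact: Mx.
Qed.

End CoordinateVectors.

(** * Rows and columns of an operator *)

Section KindDependent.
Variables (R : realType) (Gamma : pointedType).
Implicit Types (k : coord_kind R) (x y : Gamma -> R[i]).

Definition is_l1 k : Prop := if k is KindLp p _ then p = 1 else False.

Lemma l1_sum_le k x (r : R) (s : seq Gamma) : is_l1 k -> 0 < r ->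
  bnd k r x -> uniq s -> \sum_(g <- s) nrm (x g) <= r.
Proof.
case: k => [//|p p1] /= pE r0 /psumP H us; have := H s us.
rewrite pE powRr1 ?(ltW r0)//.
by apply: le_trans; apply: ler_sum => g _; rewrite powRr1 ?nrm_ge0.
Qed.

(* The norm of a sum of [N] disjointly supported unit vectors is at most
   [N `^ growth k]. *)
Definition growth k : R := if k is KindLp p _ then p^-1 else 0.

Lemma growth_lt1 k : ~ is_l1 k -> growth k < 1.
Proof.
case: k => [//|p p1] /= /eqP np; rewrite invf_lt1 ?(lt_le_trans ltr01)//.
by rewrite lt_neqAle eq_sym np.
Qed.

(** On disjoint supports the p-th powers of the norms add up. For [KindC0] the growth exponent is
    zero and all the bounds are one. *)
Lemma bnd_disjointD k (N : nat) x y : (forall g, x g = 0 \/ y g = 0) ->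
  bnd k (N%:R `^ growth k) x -> bnd k 1 y ->
  bnd k (N.+1%:R `^ growth k) (fun g => x g + y g).
Proof.
move=> dis; case: k => [|p p1] /=.
  by rewrite !powRr0 => hx hy g; case: (dis g) => ->; rewrite ?add0r ?addr0.
have p0 : 0 < p by rewrite (lt_le_trans ltr01).
move=> /psumP hx /psumP hy; apply/psumP => s us.
have pE (M : nat) : (M%:R `^ p^-1) `^ p = M%:R :> R.
  by rewrite -powRrM mulVf ?gt_eqF// powRr1.
have := hx s us; have := hy s us; rewrite !pE powR1 => hy' hx'.
rewrite -(natr1 N) (le_trans _ (lerD hx' hy'))// -big_split/=.
apply: ler_sum => g _; case: (dis g) => ->.
  by rewrite add0r nrm0 powR0 ?gt_eqF// add0r.
by rewrite addr0 nrm0 powR0 ?gt_eqF// addr0.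
Qed.

End KindDependent.

Section RowsColumns.
Variables (R : realType) (Gamma : pointedType) (k : coord_kind R).
Hypothesis Gamma_infinite : infinite_set [set: Gamma].
Local Notation E := (coord_space Gamma k).
Implicit Types (x y z : E) (A B D : set Gamma) (g : Gamma) (T : bop E).
Local Opaque nrm.

(** Triangle inequality for the expansion in unit vectors: the l_1 norm dominates the norm of every
    [k]. *)
Lemma nrm_le_sum y (M : R) :
  (forall s : seq Gamma, uniq s -> \sum_(g <- s) nrm (y g) <= M) -> nrm y <= M.
Proof.
move=> H; apply/ler_addgt0Pl => e e0.
have [D fD hD] := ex_finite_tail y e0.
rewrite (restr_split D y) (le_trans (nrmD _ _))// addrC lerD//.
have [s us sx] := fin_suppP (fin_supp_restr y fD).
rewrite (fin_supp_expand us (x := coord_restr D y)); last by move=> g; rewrite sx.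
rewrite (le_trans (nrm_sum _ _))//; apply: le_trans (H s us).
apply: ler_sum => g _; rewrite nrmZ nrm_unit_vec mulr1; exact: restr_le.
Qed.

(** Each column [T (unit_vec k g)] lives in a tiny set up to the error [w g], and the union of these
    sets over [A] is small. The coordinates of [x] are at most [nrm x], so the errors add up to at
    most [r * nrm x]. *)
Lemma ex_small_col T A (r : R) : small A -> 0 < r ->
  exists2 C, small C & bnorm (coord_proj k (~` C) * T * coord_proj k A) <= r.
Proof.
move=> sA r0; have [w [aw sw]] := ex_weights (Gamma := Gamma) (or_introl r0).
have /choice[C HC] : forall g, exists C, tiny C /\
    nrm (coord_restr (~` C) (T (unit_vec k g))) <= w g.
  by move=> g; have [C tC hC] := ex_tiny_tail (T (unit_vec k g)) (aw g); exists C.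
exists (\bigcup_(g in A) C g).
  by apply: small_bigcup => // g _; case: (HC g).
apply: opnorm_le_fin => [|x fx]; first exact: ltW.
rewrite !bop_mulE !coord_projE.
set CC := \bigcup_(g in A) C g; set x' := coord_restr A x.
have [s us [sx' ->]] := fin_supp_ind T (fin_supp_restrr A fx).
rewrite -coord_projE bop_sum (le_trans (nrm_sum _ _))//.
apply: (@le_trans _ _ (\sum_(g <- s) nrm x * w g)); last first.
  by rewrite -mulr_sumr mulrC ler_wpM2r ?nrm_ge0// sw.
rewrite big_seq [leRHS]big_seq; apply: ler_sum => g.
rewrite sx' -/x' => x'g; have Ag : A g.
  by apply: contrapT => nA; move: x'g; rewrite restrE memNset// eqxx.
rewrite bopZ nrmZ ler_pM ?nrm_ge0//.
  exact: le_trans (nrm_coord x' g) (coord_restr_le A x).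
apply: le_trans (proj2 (HC g)); rewrite coord_projE; apply: restr_sub_le.
by apply: subsetC; exact: bigcup_sup.
Qed.

(* A bounded functional which is at least [e] on unit vectors supported off any
   finite set is at least [N * e] on a sum of [N] disjointly supported ones,
   whose norm is only [N `^ growth k]. *)
Lemma ex_finite_row T g (e : R) : ~ is_l1 k -> 0 < e ->
  exists2 B, finite_set B & forall x, fin_supp x -> (forall h, B h -> x h = 0) ->
    nrm (T x g) <= e * nrm x.
Proof.
move=> nl1 e0; apply: contrapT => /forall2NP H.
have {}H B : finite_set B -> exists x, [/\ fin_supp x,
    forall h, B h -> x h = 0, nrm x <= 1 & exists2 r : R, e <= r & T x g = r%:C].
  move=> fB; case: (H B) => // {}H.
  have [x [fx xB hx]] : exists x, [/\ fin_supp x, forall h, B h -> x h = 0 &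
      e * nrm x < nrm (T x g)].
    apply: contrapT => /forallNP nx; apply: H => x fx xB; rewrite leNgt.
    by apply/negP => h; apply: (nx x).
  have c0 : 0 < nrm (T x g).
    by apply: le_lt_trans hx; rewrite mulr_ge0 ?(ltW e0) ?nrm_ge0.
  have x0 : 0 < nrm x.
    rewrite lt_neqAle nrm_ge0 andbT; apply/eqP => /esym/nrm_eq0 x0.
    by move: c0; rewrite x0 bop0 coord_zero nrm0 ltxx.
  have cn0 : T x g != 0 by apply: contraTneq c0 => ->; rewrite nrm0 ltxx.
  (* The scalar [l] makes the norm one and the value at [g] a positive real, so that the values of
     several such vectors add up without cancellation. *)
  pose l : R[i] := (nrm (T x g) / nrm x)%:C / T x g.
  have ln : nrm l = (nrm x)^-1.
    rewrite /l nrmM1 nrmV_C// nrm_real ger0_norm ?divr_ge0 ?nrm_ge0//.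
    by rewrite mulrAC mulfV ?mul1r// gt_eqF.
  exists (l *: x); split.
  - apply: sub_finite_set fx => h; rewrite /mkset; apply: contra => /eqP xh.
    by rewrite coordZ xh mulr0.
  - by move=> h /xB xh; rewrite coordZ xh mulr0.
  - by rewrite nrmZ ln mulVf// gt_eqF.
  - exists (nrm (T x g) / nrm x); last by rewrite bopZ coordZ /l divfK.
    rewrite ler_pdivlMr; last exact: x0.
    exact: ltW hx.
have G N : exists x, [/\ fin_supp x, bnd k (N%:R `^ growth k) x &
    exists2 r : R, N%:R * e <= r & T x g = r%:C].
  elim: N => [|N [x [fx bx [r hr rE]]]].
    exists 0; split.
    - by rewrite /fin_supp (_ : [set _ | _] = set0)//; apply/seteqP; split=> h //=; rewrite eqxx.
    - case: (k) => [h|p p1] /=; first by rewrite nrm0 powR_ge0.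
      apply/psumP => s _; rewrite big1 ?powR_ge0// => h _.
      by rewrite nrm0 powR0// gt_eqF// (lt_le_trans ltr01).
    - by exists 0; rewrite ?mul0r// bop0.
  have [y [fy yx y1 [t ht tE]]] := H _ fx.
  exists (x + y); split.
  - suff : finite_set ([set h | x h != 0] `|` [set h | y h != 0]).
      apply: sub_finite_set => h; rewrite /mkset coordD => xyh.
      have [xh|] := eqVneq (x h) 0; last by left.
      by right; move: xyh; rewrite /mkset xh add0r.
    by rewrite finite_setU.
  - apply: bnd_disjointD => //; last exact/(nrm_bndP y ltr01).
    by move=> h; have [|/yx] := eqVneq (x h) 0; [left|right].
  - exists (r + t); last by rewrite bopD coordD rE tE rmorphD.
    by rewrite -natr1 mulrDl mul1r lerD.
have K N : (0 < N)%N -> N%:R * e <= bnorm T * (N%:R `^ growth k).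
  move=> N0; have [x [fx bx [r hr rE]]] := G N.
  have p0 : 0 < N%:R `^ growth k :> R by apply: powR_gt0; rewrite ltr0n.
  have xN : nrm x <= N%:R `^ growth k by apply/(nrm_bndP x p0).
  apply: (le_trans hr); rewrite (le_trans (ler_norm r))// -nrm_real -rE.
  apply: (le_trans (nrm_coord _ _)); apply: (le_trans (bop_nrm _ _)).
  by rewrite ler_wpM2l// bnorm_ge0.
(* Division by the growth of the norm leaves the power [a] of [N], bounded by [bnorm T / e]. Since
   [a] is positive, a large [N] gives a contradiction. *)
pose a := 1 - growth k; have a0 : 0 < a by rewrite subr_gt0 growth_lt1.
have K2 N : (0 < N)%N -> N%:R `^ a <= bnorm T / e.
  move=> N0; have N0' : 0 < N%:R :> R by rewrite ltr0n.
  have p0 : 0 < N%:R `^ growth k :> R by rewrite powR_gt0.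
  rewrite ler_pdivlMr// -(ler_pM2r p0) (le_trans _ (K N N0))//.
  rewrite mulrAC -powRD; last by rewrite (gt_eqF N0') implybT.
  by rewrite subrK powRr1// ltW.
pose c := bnorm T / e + 1.
have c0 : 0 < c by rewrite ltr_wpDl// divr_ge0 ?bnorm_ge0// ltW.
pose N := (Num.bound (c `^ a^-1)).+1.
have cN : c `^ a^-1 <= N%:R.
  by apply/ltW/(lt_trans (archi_boundP (powR_ge0 _ _))); rewrite ltr_nat.
have := K2 N isT; rewrite leNgt => /negP; apply.
have cE : c = (c `^ a^-1) `^ a by rewrite -powRrM mulVf ?gt_eqF// powRr1// ltW.
have : c <= N%:R `^ a.
  by rewrite cE ge0_ler_powR ?nnegrE ?powR_ge0// ltW.
by apply: lt_le_trans; rewrite ltrDl.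
Qed.

(** By [ex_finite_row] and [ex_tiny], the row of [g] has norm at most [w g] off a tiny set. The
    union of these sets over [A] is small, and the weights sum up to at most [r]. *)
Lemma ex_small_row T A (r : R) : ~ is_l1 k -> small A -> admissible Gamma r ->
  exists2 B, small B & forall x, fin_supp x -> (forall h, B h -> x h = 0) ->
    nrm (coord_restr A (T x)) <= r * nrm x.
Proof.
move=> nl1 sA ar; have [w [aw sw]] := ex_weights ar.
pose P g (d : R) B := forall x, fin_supp x -> (forall h, B h -> x h = 0) ->
  nrm (T x g) <= d * nrm x.
have /choice[B HB] : forall g, exists B, tiny B /\ P g (w g) B.
  move=> g; suff [B tB PB] : exists2 B, tiny B & P g (w g) B by exists B.
  apply: (ex_tiny (P := P g)) => //.
  - move=> d e A1 A2 de A12 h x fx xA; apply: (@le_trans _ _ (d * nrm x)).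
      by apply: h => // t /A12; exact: xA.
    by rewrite ler_wpM2r ?nrm_ge0.
  - by move=> e e0; exact: ex_finite_row.
  - move=> A1 H x fx xA; rewrite mul0r; apply/ler_addgt0Pl => e e0; rewrite addr0.
    have x1 : 0 < nrm x + 1 by rewrite ltr_wpDl ?nrm_ge0.
    apply: le_trans (H _ (divr_gt0 e0 x1) x fx xA) _.
    rewrite -mulrA ger_pMr// mulrC ler_pdivrMr// mul1r.
    by rewrite lerDl.
exists (\bigcup_(g in A) B g).
  by apply: small_bigcup => // g _; case: (HB g).
move=> x fx xB; apply: nrm_le_sum => s us.
apply: (@le_trans _ _ (\sum_(g <- s) w g * nrm x)); last first.
  by rewrite -mulr_suml ler_wpM2r ?nrm_ge0// sw.
apply: ler_sum => g _; rewrite restrE; case: ifPn => [/set_mem Ag|_].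
  by apply: (proj2 (HB g)) => // h Bh; apply: xB; exists g.
by rewrite nrm0 mulr_ge0 ?nrm_ge0// (admissible_ge0 (aw g)).
Qed.

(** Both terms are controlled by finite sums, over [s] and [t]. These are compared with one sum over
    the merged index list, at each entry of which one of the two restrictions vanishes. *)
Lemma l1_nrm_split y A : is_l1 k ->
  nrm (coord_restr A y) + nrm (coord_restr (~` A) y) <= nrm y.
Proof.
move=> l1; rewrite -lerBrDr; apply: nrm_le_sum => s us.
rewrite lerBrDr -lerBrDl; apply: nrm_le_sum => t ut; rewrite lerBrDl.
pose u := undup (s ++ t).
have sub (v : seq Gamma) (F : Gamma -> R) : uniq v -> {subset v <= u} ->
    (forall g, 0 <= F g) -> \sum_(g <- v) F g <= \sum_(g <- u) F g.
  move=> uv vu F0; rewrite [leRHS](bigID (fun g => g \in v))/= -[leLHS]addr0 lerD//.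
    rewrite -[leRHS]big_filter le_eqVlt; apply/orP; left.
    apply/eqP; apply: perm_big; apply: uniq_perm => //.
      by rewrite filter_uniq// undup_uniq.
    by move=> g; rewrite mem_filter; case: (boolP (g \in v)) => // /vu ->.
  by rewrite sumr_ge0.
apply: (@le_trans _ _ (\sum_(g <- u) nrm (y g))).
  apply: (le_trans (lerD (sub s _ us _ _) (sub t _ ut _ _))).
  - by move=> g gs; rewrite mem_undup mem_cat gs.
  - by move=> g; exact: nrm_ge0.
  - by move=> g gs; rewrite mem_undup mem_cat gs orbT.
  - by move=> g; exact: nrm_ge0.
  rewrite -big_split/=; apply: ler_sum => g _.
  by rewrite /restr in_setC; case: (g \in A); rewrite ?nrm0 ?addr0 ?add0r.
apply/ler_addgt0Pl => e e0; have [h hb] := nrm_bnd y e0; rewrite addrC.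
by apply: l1_sum_le hb _ => //; exact: undup_uniq.
Qed.

(** A common interface for l_1 and the other spaces: [w j] bounds what the image of the vector
    labelled [j] leaves on the coordinates [A] already used. The sums run along an injection [f]
    because the vectors, first indexed by labels, are later reindexed by [Gamma]. *)
Lemma ex_error_weights T (e : R) : 0 < e -> bnorm T <= 1 + e ->
  exists w : Gamma -> R, [/\ forall j, admissible Gamma (w j),
    (forall (f : Gamma -> Gamma) (s : seq Gamma) z, injective f -> uniq s ->
       \sum_(i <- s) nrm (z i) * w (f i) <= 3 * e * nrm z) &
    forall j A, small A -> exists2 B, small B &
      forall x, fin_supp x -> (forall h, B h -> x h = 0) -> nrm x <= 1 ->
        1 - 2 * e <= nrm (coord_restr (~` A) (T x)) ->
        nrm (coord_restr A (T x)) <= w j].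
Proof.
move=> e0 Te; have [l1|nl1] := pselect (is_l1 k).
  (* [3 * e] is [(1 + e) - (1 - 2 * e)], the share of the norm of [T x] that additivity leaves on
     [A]. *)
  exists (fun=> 3 * e); split.
  - by move=> j; left; rewrite mulr_gt0.
  - move=> f s z _ us; rewrite -mulr_suml mulrC ler_wpM2l ?mulr_ge0 ?(ltW e0)//.
    apply/ler_addgt0Pl => d d0; have [h hb] := nrm_bnd z d0; rewrite addrC.
    exact: l1_sum_le hb us.
  - move=> j A sA; exists set0; first by apply: tiny_small => //; left.
    have arith (a b c : R) : a <= 1 + e -> b + c <= a -> 1 - 2 * e <= c -> b <= 3 * e.
      by clear -a b c e; lra.
    move=> x _ _ x1; have := l1_nrm_split (T x) A l1.
    have : nrm (T x) <= 1 + e.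
      apply: (le_trans (bop_nrm _ _)); apply: le_trans Te.
      by rewrite ler_piMr// bnorm_ge0.
    exact: arith.
have [w [aw sw]] := ex_weights (Gamma := Gamma) (or_introl e0).
exists w; split => //.
- move=> f s z fi us; apply: (@le_trans _ _ (\sum_(i <- s) nrm z * w (f i))).
    apply: ler_sum => i _.
    exact: (ler_wpM2r (admissible_ge0 (aw (f i))) (nrm_coord z i)).
  rewrite -mulr_sumr mulrC ler_wpM2r ?nrm_ge0//.
  rewrite -(big_map f xpredT w) (le_trans (sw _ _)) ?map_inj_uniq//.
  by rewrite ler_peMl ?(ltW e0)// ler1n.
- move=> j A sA; have [B sB HB] := ex_small_row T nl1 sA (aw j).
  exists B => // x fx xB x1 _; apply: (le_trans (HB x fx xB)).
  by rewrite ler_piMr// (admissible_ge0 (aw j)).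
Qed.

End RowsColumns.

(** * Neumann series *)

Section Neumann.
Variables (R : realType) (A : banachAlgType R).

Lemma expr_small (q e : R) : 0 <= q -> q < 1 -> 0 < e ->
  exists N, forall n, (N <= n)%N -> q ^+ n <= e.
Proof.
move=> q0 q1 e0.
have : (fun n => q ^+ n) @ \oo --> (0 : R) by apply: cvg_expr; rewrite ger0_norm.
move=> /cvgrPdist_le/(_ e e0)[N _ H]; exists N => n Nn.
by have := H n Nn; rewrite sub0r normrN ger0_norm// exprn_ge0.
Qed.

(** The partial sums [u n] of the powers of [1 - a] telescope when multiplied by [a]. They form a
    Cauchy sequence, dominated by the geometric series of [q]. *)
Lemma neumann_left_inverse (a : A) (q : R) : bnorm (1 - a) <= q -> q < 1 ->
  exists2 b : A, b * a = 1 & bnorm b <= (1 - q)^-1.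
Proof.
move=> aq q1; have q0 : 0 <= q by apply: le_trans aq; exact: bnorm_ge0.
have p0 : 0 < 1 - q by rewrite subr_gt0.
pose u n : A := \sum_(i < n) (1 - a) ^+ i.
have uS n : u n.+1 = u n + (1 - a) ^+ n by rewrite /u big_ord_recr.
have bX n : bnorm ((1 - a) ^+ n) <= q ^+ n.
  elim: n => [|n IH]; first by rewrite !expr0 bnorm1.
  rewrite !exprS (le_trans (bnormM _ _))//.
  by apply: ler_pM => //; exact: bnorm_ge0.
have uE n : u n * a = 1 - (1 - a) ^+ n.
  elim: n => [|n IH]; first by rewrite /u big_ord0 mul0r expr0 subrr.
  rewrite uS mulrDl IH exprSr mulrBr mulr1 opprB.
  by rewrite [RHS]addrA [LHS]addrAC.
have ud m n : (m <= n)%N -> bnorm (u n - u m) <= (q ^+ m - q ^+ n) / (1 - q).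
  elim: n => [|n IH]; first by rewrite leqn0 => /eqP ->; rewrite !subrr bnorm0 mul0r.
  rewrite leq_eqVlt => /orP[/eqP->|]; first by rewrite !subrr bnorm0 mul0r.
  rewrite ltnS => /IH {}IH; rewrite uS addrAC (le_trans (bnormD _ _))//.
  apply: (le_trans (lerD IH (bX n))).
  by rewrite ler_pdivlMr// mulrDl divfK ?gt_eqF// exprS; lra.
have uc : cauchy_for (@bnorm R A) u.
  move=> e e0; have [N HN] := expr_small q0 q1 (mulr_gt0 e0 p0); exists N.
  have K m n : (N <= m)%N -> (m <= n)%N -> bnorm (u n - u m) <= e.
    move=> hm mn; apply: (le_trans (ud m n mn)); rewrite ler_pdivrMr//.
    by apply: le_trans (HN m hm); rewrite gerBl exprn_ge0.
  move=> m n hm hn; have [mn|/ltnW nm] := leqP m n; last exact: K.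
  by rewrite bnormB; exact: K.
have [l Hl] := bnorm_complete u uc.
have ub n : bnorm (u n) <= (1 - q)^-1.
  have := ud 0%N n (leq0n n); rewrite /u [X in _ - X]big_ord0 subr0 expr0 => h.
  apply: (le_trans h); rewrite ler_piMl ?invr_ge0 ?(ltW p0)//.
  by rewrite gerBl exprn_ge0.
exists l; last first.
  apply/ler_addgt0Pl => e e0; have [N HN] := Hl e e0.
  have -> : l = (l - u N) + u N by rewrite subrK.
  by apply: (le_trans (bnormD _ _)); apply: lerD; [exact: HN|exact: ub].
apply/eqP; rewrite -subr_eq0; apply/eqP/(@bnorm_eq0 R)/eqP.
rewrite eq_le bnorm_ge0 andbT; apply/ler_addgt0Pl => e e0; rewrite addr0.
have a1 : 0 < bnorm a + 1 by apply: ltr_wpDl => //; exact: bnorm_ge0.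
have e2 : 0 < e / 2 by rewrite divr_gt0.
have [N1 H1] := Hl _ (divr_gt0 e2 a1); have [N2 H2] := expr_small q0 q1 e2.
pose n := maxn N1 N2.
have -> : l * a - 1 = (l - u n) * a - (1 - a) ^+ n.
  by rewrite mulrBl uE opprB addrAC addrA subrK.
rewrite (le_trans (bnormD _ _))// [leRHS]splitr bnormN lerD//.
  rewrite (le_trans (bnormM _ _))//.
  have := H1 n (leq_maxl _ _); rewrite ler_pdivlMr//; apply: le_trans.
  by rewrite ler_wpM2l ?bnorm_ge0// lerDl.
by rewrite (le_trans (bX n))// H2// leq_maxr.
Qed.

End Neumann.

(** * Norming functionals with finitely many coordinates *)

Section Norming.
Variables (R : realType) (Gamma : pointedType).
Implicit Types (k : coord_kind R) (u v z : Gamma -> R[i]).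

(** The unimodular factor that turns [c] into its modulus. At [c = 0] it takes the value 0. *)
Definition phase (c : R[i]) : R[i] := (nrm c)%:C / c.

Lemma phaseM c : phase c * c = (nrm c)%:C.
Proof.
have [->|c0] := eqVneq c 0; first by rewrite mulr0 nrm0.
by rewrite /phase divfK.
Qed.

Lemma nrm_phase_le c : nrm (phase c) <= 1.
Proof.
have [->|c0] := eqVneq c 0; first by rewrite /phase invr0 mulr0 nrm0.
rewrite /phase nrmM1 nrmV_C// nrm_real ger0_norm ?nrm_ge0//.
by rewrite mulfV// gt_eqF// nrm_gt0C.
Qed.

(* [dominated k s c v] holds for the values [c] at [v] of the functionals of
   norm one that only depend on the coordinates in [s]. *)
Definition dominated k (s : seq Gamma) (c : R[i]) v : Prop :=
  match k with
  | KindC0 => c = 0 \/ exists2 g, g \in s & nrm c <= nrm (v g)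
  | KindLp p _ => nrm c `^ p <= \sum_(g <- s) nrm (v g) `^ p
  end.

(* Young's inequality, as the tangent inequality of the convex function
   [x `^ p] at [t], which covers [p = 1]. *)
Lemma powR_tangent (p t x : R) : 1 <= p -> 0 <= t -> 0 <= x ->
  p * (t `^ (p - 1) * x) <= (p - 1) * t `^ p + x `^ p.
Proof.
rewrite le_eqVlt => /predU1P[<-|p1] t0 x0.
  by rewrite subrr powRr0 !mul1r mul0r add0r powRr1.
have p0 : 0 < p by rewrite (lt_trans ltr01).
have p10 : 0 < p - 1 by rewrite subr_gt0.
pose q := p / (p - 1); have q0 : 0 < q by rewrite divr_gt0.
have pq : p^-1 + q^-1 = 1.
  by rewrite /q invf_div -[X in X + _]div1r -mulrDl addrC subrK divff// gt_eqF.
have := conjugate_powR x0 (powR_ge0 t (p - 1)) p0 q0 pq.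
rewrite -powRrM /q [(p - 1) * _]mulrC divfK ?gt_eqF// => h.
rewrite -ler_pdivlMl// mulrC; apply: (le_trans h).
move: (x `^ p) (t `^ p) => X P; rewrite le_eqVlt; apply/orP; left; apply/eqP.
by field; rewrite (gt_eqF p0) (gt_eqF p10).
Qed.

(** The extremal functional of Hoelder's inequality: the moduli of [u], normalized to [t], are
    raised to the power [p - 1] and multiplied by phases. The tangent inequality bounds its norm by
    one. *)
Lemma ex_norming_lp (p : R) (p1 : 1 <= p) (s : seq Gamma) u :
  exists a : Gamma -> R[i],
    \sum_(g <- s) a g * u g = ((\sum_(g <- s) nrm (u g) `^ p) `^ p^-1)%:C /\
    forall v, dominated (KindLp p1) s (\sum_(g <- s) a g * v g) v.
Proof.
have p0 : 0 < p by rewrite (lt_le_trans ltr01).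
set S := \sum_(g <- s) nrm (u g) `^ p.
have S0 : 0 <= S by apply: sumr_ge0 => g _; exact: powR_ge0.
pose N := S `^ p^-1.
have NS : N `^ p = S by rewrite /N -powRrM mulVf ?gt_eqF// powRr1.
have [SE|Sn0] := eqVneq S 0.
  exists (fun=> 0); split=> [|v].
    rewrite SE powR0 ?invr_eq0 ?gt_eqF// big1// => g _; exact: mul0r.
  rewrite /dominated big1 => [|g _]; last exact: mul0r.
  by rewrite nrm0 powR0 ?gt_eqF// sumr_ge0// => g _; exact: powR_ge0.
have Sgt : 0 < S by rewrite lt_neqAle eq_sym Sn0.
have N0 : 0 < N by rewrite powR_gt0.
pose t g := nrm (u g) / N.
have t0 g : 0 <= t g by rewrite divr_ge0 ?nrm_ge0 ?(ltW N0).
have tp : \sum_(g <- s) t g `^ p = 1.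
  under eq_bigr do rewrite /t powRM ?nrm_ge0 ?invr_ge0 ?(ltW N0)//.
  rewrite -mulr_suml -powR_inv1 ?(ltW N0)// powRAC NS powR_inv1//.
  by rewrite divff.
have tE g : t g `^ (p - 1) * nrm (u g) = N * t g `^ p.
  rewrite -[X in _ * X](divfK (lt0r_neq0 N0)) -/(t g) mulrA [RHS]mulrC.
  congr (_ * _); have [p1E|p1n] := eqVneq p 1.
    by rewrite p1E subrr powRr0 mul1r powRr1.
  by rewrite mulrC mulr_powRB1.
exists (fun g => (t g `^ (p - 1))%:C * phase (u g)); split.
  under eq_bigr do rewrite -mulrA phaseM -rmorphM/= tE.
  by rewrite -raddf_sum/= -mulr_sumr tp mulr1.
move=> v; rewrite /dominated; set c := (X in nrm X `^ p <= _).
set W := \sum_(g <- s) nrm (v g) `^ p.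
have W0 : 0 <= W by apply: sumr_ge0 => g _; exact: powR_ge0.
have nc : nrm c <= \sum_(g <- s) t g `^ (p - 1) * nrm (v g).
  rewrite /c (le_trans (nrm_sum _ _))//; apply: ler_sum => g _.
  rewrite nrmM1 [nrm (_ * phase _)]nrmM1 nrm_real ger0_norm ?powR_ge0// -mulrA ler_wpM2l ?powR_ge0//.
  exact: (ler_piMl (nrm_ge0 _) (nrm_phase_le _)).
(* The tangent inequality at [t g] and [nrm (v g) / r], summed over [s], bounds p times the sum by
   (p - 1) + 1 = p. *)
have cr (r : R) : 0 < r -> W <= r `^ p -> nrm c <= r.
  move=> r0 Wr; apply: (le_trans nc).
  rewrite -[leRHS]mul1r -ler_pdivrMr// mulr_suml.
  have rp : 0 < r `^ p by rewrite powR_gt0.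
  rewrite -(ler_pM2l p0) mulr1 mulr_sumr.
  apply: (@le_trans _ _ (\sum_(g <- s) ((p - 1) * t g `^ p + (nrm (v g) / r) `^ p))).
    apply: ler_sum => g _; rewrite -mulrA.
    by apply: powR_tangent => //; rewrite divr_ge0 ?nrm_ge0 ?(ltW r0).
  rewrite big_split/= -mulr_sumr tp mulr1 -lerBrDl opprB addrC subrK.
  under eq_bigr do rewrite powRM ?nrm_ge0 ?invr_ge0 ?(ltW r0)//.
  rewrite -mulr_suml -powR_inv1 ?(ltW r0)// powRAC powR_inv1 ?powR_ge0//.
  by rewrite ler_pdivrMr// mul1r.
(* [cr] needs a positive radius. For [W = 0] it is applied to arbitrarily small radii. *)
have [WE|Wn] := eqVneq W 0; last first.
  have Wgt : 0 < W by rewrite lt_neqAle eq_sym Wn.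
  have WpE : (W `^ p^-1) `^ p = W by rewrite -powRrM mulVf ?gt_eqF// powRr1.
  rewrite -[leRHS]WpE; apply: (le_powR p1 (nrm_ge0 _) (powR_ge0 _ _)).
  by apply: cr; [exact: powR_gt0|rewrite WpE lexx].
have -> : nrm c = 0.
  apply/eqP; rewrite eq_le nrm_ge0 andbT; apply/ler_addgt0Pl => e e0.
  by rewrite addr0; apply: cr; [exact: e0|rewrite WE powR_ge0].
by rewrite powR0// gt_eqF.
Qed.

Lemma ex_max_seq (T : eqType) (F : T -> R) (s : seq T) : s != [::] ->
  exists2 g, g \in s & forall h, h \in s -> F h <= F g.
Proof.
elim: s => [//|g s IH] _; have [->|/IH[h hs hm]] := eqVneq s [::].
  by exists g => [|h]; rewrite inE// => /eqP ->.
have [gh|/ltW hg] := leP (F g) (F h).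
  exists h => [|t]; rewrite inE ?hs ?orbT// => /orP[/eqP->//|]; exact: hm.
exists g => [|t]; rewrite inE ?eqxx// => /orP[/eqP->//|/hm th].
exact: le_trans th hg.
Qed.

End Norming.

Section NormingCoordinates.
Variables (R : realType) (Gamma : pointedType).
Local Opaque nrm.

(** On c_0 the functional evaluates, up to a phase, at a coordinate in [s] where [y] is largest. On
    l_p it comes from [ex_norming_lp]. *)
Lemma ex_norming (k : coord_kind R) (y : coord_space Gamma k) (s : seq Gamma) :
  uniq s -> exists a : Gamma -> R[i],
    \sum_(g <- s) a g * y g = (nrm (coord_restr [set` s] y))%:C /\
    forall v : Gamma -> R[i], dominated k s (\sum_(g <- s) a g * v g) v.
Proof.
move=> us; set x := coord_restr [set` s] y.
have xs g : g \in s -> x g = y g.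
  by move=> gs; rewrite restrE mem_set.
have xns g : g \notin s -> x g = 0.
  by move=> gs; rewrite restrE memNset//; exact/negP.
case: k y x xs xns => [|p p1] y x xs xns.
  have [sE|/(ex_max_seq (fun g => nrm (y g)))[g0 gs gmax]] := eqVneq s [::].
    exists (fun=> 0); rewrite sE; split=> [|v]; last by left; rewrite big_nil.
    suff -> : x = 0 by rewrite big_nil nrm0.
    by apply: coord_ext => g; rewrite xns// sE.
  have one (v : Gamma -> R[i]) :
      \sum_(g <- s) (if g == g0 then phase (y g0) else 0) * v g = phase (y g0) * v g0.
    rewrite (bigD1_seq g0)//= eqxx big1 ?addr0// => g /negbTE ->.
    by rewrite mul0r.
  exists (fun g => if g == g0 then phase (y g0) else 0); split=> [|v].
    rewrite one phaseM; congr (_%:C); apply/eqP; rewrite eq_le; apply/andP; split.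
      by rewrite -(xs _ gs); exact: nrm_coord.
    apply/ler_addgt0Pl => e e0.
    have r0 : 0 < e + nrm (y g0) by rewrite ltr_pwDl// nrm_ge0.
    apply/(nrm_bndP x r0) => g; have [gs'|gs'] := boolP (g \in s).
      by rewrite xs// (le_trans (gmax g gs'))// lerDr ltW.
    by rewrite xns// nrm0 ltW.
  rewrite one; right; exists g0 => //.
  rewrite nrmM1; exact: (ler_piMl (nrm_ge0 _) (nrm_phase_le _)).
have p0 : 0 < p by rewrite (lt_le_trans ltr01).
have [a [aE aD]] := ex_norming_lp p1 s y.
exists a; split=> //; rewrite aE; congr (_%:C).
set S := \sum_(g <- s) _; have S0 : 0 <= S by apply: sumr_ge0 => g _; exact: powR_ge0.
have xb (r : R) : 0 < r -> nrm x <= r <-> S <= r `^ p.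
  move=> r0; split=> [/(nrm_bndP x r0)/psumP/(_ s us)|Sr].
    by under eq_big_seq => g gs do rewrite xs//.
  apply/(nrm_bndP x r0)/psumP => t ut; apply: le_trans Sr.
  rewrite (bigID (fun g => g \in s))/= [X in _ + X]big1 ?addr0; last first.
    by move=> g /xns ->; rewrite nrm0 powR0// gt_eqF.
  rewrite -big_filter /S (eq_big_seq (fun g => nrm (y g) `^ p)); last first.
    by move=> g; rewrite mem_filter => /andP[/xs ->].
  rewrite [leRHS](bigID (fun g => g \in t))/= -[leLHS]addr0 lerD//; last first.
    by apply: sumr_ge0 => g _; exact: powR_ge0.
  rewrite -[leRHS]big_filter le_eqVlt; apply/orP; left.
  apply/eqP; apply: perm_big; apply: uniq_perm; rewrite ?filter_uniq//.
  by move=> g; rewrite !mem_filter andbC.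
have SpE : (S `^ p^-1) `^ p = S by rewrite -powRrM mulVf ?gt_eqF// powRr1.
apply/eqP; rewrite eq_le; apply/andP; split; apply/ler_addgt0Pl => e e0.
  have r0 : 0 < e + nrm x by rewrite ltr_pwDl// nrm_ge0.
  rewrite powRV_le ?(ltW r0)//; apply/(xb _ r0); by rewrite lerDr ltW.
have r0 : 0 < e + S `^ p^-1 by rewrite ltr_pwDl// powR_ge0.
apply/(xb _ r0); rewrite -{1}SpE le_powR ?powR_ge0 ?(ltW r0)//.
by rewrite lerDr ltW.
Qed.

End NormingCoordinates.

(** * Contractions built from disjoint blocks of coordinates *)

Section GatherScatter.
Variables (R : realType) (Gamma : pointedType) (k : coord_kind R).
Implicit Types (u v z f : Gamma -> R[i]).

(** The p-th power of each [f j] is at most the sum over the block [s j]. As the blocks are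
    disjoint, their concatenation is duplicate-free and gives one partial sum of [v]. *)
Lemma gather_bnd (s : Gamma -> seq Gamma) f v (r : R) : 0 < r ->
  (forall j, uniq (s j)) ->
  (forall i j g, g \in s i -> g \in s j -> i = j) ->
  (forall j, dominated k (s j) (f j) v) -> bnd k r v -> bnd k r f.
Proof.
move=> r0 us dis; case: k => [|p p1] /= dom hv.
  by move=> j; case: (dom j) => [->|[g _ /le_trans]]; [rewrite nrm0 ltW|apply].
apply/psumP => t ut.
apply: (@le_trans _ _ (\sum_(j <- t) \sum_(g <- s j) nrm (v g) `^ p)).
  by apply: ler_sum => j _; exact: dom.
have ufl : uniq (flatten (map s t)).
  elim: t ut => [//|j t IH] /=/andP[jt /IH ut].
  rewrite cat_uniq us ut andbT; apply/hasPn => g /flattenP[_ /mapP[i it ->] gi].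
  by apply/negP => gj; move: jt; rewrite (dis _ _ _ gj gi) it.
have /psumP/(_ _ ufl) := hv; apply: le_trans.
by rewrite big_flatten big_map.
Qed.

Lemma gather_in (s : Gamma -> seq Gamma) f v :
  (forall j, uniq (s j)) ->
  (forall i j g, g \in s i -> g \in s j -> i = j) ->
  (forall j, dominated k (s j) (f j) v) -> in_space k v -> in_space k f.
Proof.
move=> us dis dom hv; have [r r0 bv] := in_space_bnd hv.
have bf := gather_bnd r0 us dis dom bv.
case: k dom hv bf {bv} => [|p p1] dom hv bf; last exact: bnd_in_lp bf.
move=> e e0; have /choice[h hP] : forall j, exists g, e <= nrm (f j) ->
    g \in s j /\ e <= nrm (v g).
  move=> j; case: (dom j) => [f0|[g gs fg]].
    by exists point; rewrite f0 nrm0 leNgt e0.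
  by exists g => ef; split=> //; exact: le_trans fg.
apply: (card_le_finite _ (hv e e0)).
apply: (card_le_inj (f := h)) => [j /= /hP[]//|i j /= /hP[hi _] /hP[hj _] hij].
by apply: (dis _ _ (h i)) => //; rewrite hij.
Qed.

(** [J g] is the index of the block that contains [g], if any. When the p-th powers are grouped by
    blocks, block [j] contributes at most that of [nrm (z j)], because [x j] has norm at most
    one. *)
Lemma scatter_bnd (J : Gamma -> option Gamma) (x : Gamma -> Gamma -> R[i]) f z (r : R) :
  0 < r -> (forall j, bnd k 1 (x j)) ->
  (forall g, f g = if J g is Some j then z j * x j g else 0) ->
  bnd k r z -> bnd k r f.
Proof.
move=> r0; case: k => [|p p1] /= bx fE bz.
  move=> g; rewrite fE; case: (J g) => [j|]; last by rewrite nrm0 ltW.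
  by rewrite nrmM1 -[leRHS]mulr1 ler_pM ?nrm_ge0.
have p0 : 0 < p by rewrite (lt_le_trans ltr01).
apply/psumP => s us; pose t := undup (pmap J s).
have /psumP/(_ t (undup_uniq _)) := bz; apply: le_trans.
apply: (@le_trans _ _ (\sum_(g <- s) \sum_(j <- t | J g == Some j)
    nrm (z j) `^ p * nrm (x j g) `^ p)).
  rewrite big_seq [leRHS]big_seq; apply: ler_sum => g gs.
  rewrite fE; case Jg : (J g) => [j|]; last first.
    by rewrite nrm0 powR0 ?gt_eqF// big1.
  have jt : j \in t by rewrite mem_undup mem_pmap -Jg map_f.
  rewrite [leRHS]big_mkcond (bigD1_seq j) ?undup_uniq//= eqxx.
  rewrite nrmM1 powRM ?nrm_ge0// lerDl.
  by apply: sumr_ge0 => i _; case: ifP => // _; rewrite mulr_ge0 ?powR_ge0.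
rewrite (exchange_big_dep xpredT)//=; apply: ler_sum => j _.
rewrite -mulr_sumr ler_piMr ?powR_ge0//.
have := bx j => /psumP/(_ _ (filter_uniq (fun g => J g == Some j) us)).
by rewrite powR1 big_filter.
Qed.

Lemma scatter_in (J : Gamma -> option Gamma) (x : Gamma -> Gamma -> R[i]) f z :
  (forall j, finite_set [set g | x j g != 0]) -> (forall j, bnd k 1 (x j)) ->
  (forall g, f g = if J g is Some j then z j * x j g else 0) ->
  in_space k z -> in_space k f.
Proof.
move=> xfin bx fE hz; have [r r0 bz] := in_space_bnd hz.
have bf := scatter_bnd r0 bx fE bz.
case: k bx hz bf {bz} => [|p p1] bx hz bf; last exact: bnd_in_lp bf.
move=> e e0; apply: (@sub_finite_set _ _
    (\bigcup_(j in [set j | e <= nrm (z j)]) [set g | x j g != 0])).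
  move=> g /=; rewrite fE; case: (J g) => [j|]; last by rewrite nrm0 leNgt e0.
  rewrite nrmM1 => h; exists j => /=.
    apply: (le_trans h); rewrite -[leRHS]mulr1 ler_wpM2l ?nrm_ge0//; exact: bx.
  by apply: contraTneq h => ->; rewrite nrm0 mulr0 -ltNge.
by apply: bigcup_finite => // ; exact: hz.
Qed.

End GatherScatter.

Section CoordinateOperators.
Variables (R : realType) (Gamma : pointedType) (k : coord_kind R).
Local Notation E := (coord_space Gamma k).

Lemma ex_coord_op (F : E -> Gamma -> R[i]) :
  (forall x, in_space k (F x)) ->
  (forall (l : R[i]) x y g, F (l *: x + y) g = l * F x g + F y g) ->
  (forall (x : E) (r : R), 0 < r -> bnd k r x -> bnd k r (F x)) ->
  exists S : bop E, (forall x g, S x g = F x g) /\ bnorm S <= 1.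
Proof.
move=> Fin Flin Fbnd.
have FP x : F x \in @coord_pred R Gamma k by exact/asboolP.
pose f (x : E) : E := CoordSpace (FP x).
have fle x : nrm (f x) <= nrm x by apply: nrm_le_bnd => r r0; exact: Fbnd.
have fP : f \in @bop_pred R E.
  apply/bop_predP; split; first by move=> l x y; apply: coord_ext => g; exact: Flin.
  by exists 1 => x; rewrite mul1r; exact: fle.
exists (Bop fP); split=> //.
by apply: opnorm_le => // x; rewrite mul1r; exact: fle.
Qed.

End CoordinateOperators.

(** * A criterion for factoring the identity *)

Section FactorCriterion.
Variables (R : realType) (Gamma : pointedType) (k : coord_kind R).
Local Notation E := (coord_space Gamma k).
Local Opaque nrm.

Lemma ex_scatter_op (x : Gamma -> E) :
  (forall j, fin_supp (x j)) -> (forall j, nrm (x j) <= 1) ->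
  (forall i j g, x i g != 0 -> x j g != 0 -> i = j) ->
  exists V : bop E, (forall j, V (unit_vec k j) = x j) /\ bnorm V <= 1.
Proof.
move=> xfin x1 xdis.
have /choice[J JP] : forall g, exists o : option Gamma,
    if o is Some j then x j g != 0 else forall j, x j g = 0.
  move=> g; have [[j xj]|nj] := pselect (exists j, x j g != 0); first by exists (Some j).
  exists None => j; apply/eqP; apply: contrapT => /negP xj.
  by apply: nj; exists j.
pose F (z : E) g := if J g is Some j then z j * x j g else 0.
have xb j : bnd k 1 (x j) by apply/(nrm_bndP (x j) ltr01).
have [|||V [VE V1]] := @ex_coord_op R Gamma k F.
- by move=> z; exact: (scatter_in xfin xb (fun=> erefl) (coord_in z)).
- move=> l y z g; rewrite /F; case: (J g) => [j|]; last by rewrite mulr0 addr0.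
  by rewrite coordD coordZ mulrDl mulrA.
- by move=> z r r0; exact: (scatter_bnd r0 xb (fun=> erefl)).
exists V; split=> // j; apply: coord_ext => g; rewrite VE /F.
have := JP g; case: (J g) => [i xi|xn]; last by rewrite xn.
rewrite unit_vecE; case: eqP => [->|ij]; first by rewrite mul1r.
rewrite mul0r; apply/esym/eqP; apply: contrapT => /negP xj.
by apply: ij; exact: xdis xi xj.
Qed.

Lemma ex_gather_op (y : Gamma -> E) (s : Gamma -> seq Gamma) :
  (forall j, uniq (s j)) ->
  (forall i j g, g \in s i -> y j g != 0 -> i = j) ->
  (forall i j g, g \in s i -> g \in s j -> i = j) ->
  exists Q : bop E, bnorm Q <= 1 /\
    forall j, Q (y j) = (nrm (coord_restr [set` s j] (y j)))%:C *: unit_vec k j.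
Proof.
move=> us ys sdis.
have /choice[a aP] := fun j => ex_norming (y j) (us j).
pose F (v : E) j := \sum_(g <- s j) a j g * v g.
have dom v j : dominated k (s j) (F v j) v by case: (aP j) => _; apply.
have [|||Q [QE Q1]] := @ex_coord_op R Gamma k F.
- by move=> v; exact: (gather_in us sdis (dom v) (coord_in v)).
- move=> l u v j; rewrite /F mulr_sumr -big_split; apply: eq_bigr => g _.
  by rewrite coordD coordZ mulrDr mulrCA.
- by move=> v r r0; exact: (gather_bnd r0 us sdis (dom v)).
exists Q; split=> // j; apply: coord_ext => i; rewrite QE coordZ unit_vecE /F.
case: eqP => [->|ij]; first by rewrite mulr1 (proj1 (aP j)).
rewrite mulr0 big1_seq// => g /andP[_ gi].
have [->|yj] := eqVneq (y j g) 0; first by rewrite mulr0.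
by case: ij; exact: ys gi yj.
Qed.

(** With [V] sending [unit_vec k j] to [x j] and [Q] norming the [y j], the operator [1 - Q * T * V]
    splits in two. Its diagonal part is at most [a], as [y j] has norm close to one on [s j]; the
    errors [T (x j) - y j] contribute at most [b]. A Neumann series then inverts [Q * T * V] from
    the left. *)
Lemma factor_criterion (T : bop E) (x y : Gamma -> E) (s : Gamma -> seq Gamma)
    (a b : R) :
  (forall j, fin_supp (x j)) -> (forall j, nrm (x j) <= 1) ->
  (forall i j g, x i g != 0 -> x j g != 0 -> i = j) ->
  (forall j, uniq (s j)) ->
  (forall i j g, g \in s i -> y j g != 0 -> i = j) ->
  (forall i j g, g \in s i -> g \in s j -> i = j) ->
  (forall j, `|nrm (coord_restr [set` s j] (y j)) - 1| <= a) ->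
  (forall (z : E) (t : seq Gamma), uniq t ->
     \sum_(i <- t) nrm (z i) * nrm (T (x i) - y i) <= b * nrm z) ->
  0 <= a -> 0 <= b -> a + b < 1 ->
  exists B C : bop E, B * T * C = 1 /\ bnorm B * bnorm C <= (1 - (a + b))^-1.
Proof.
move=> xfin x1 xdis us ys sdis ha hb a0 b0 ab.
have [V [VE V1]] := ex_scatter_op xfin x1 xdis.
have [Q [Q1 QE]] := ex_gather_op us ys sdis.
have close : bnorm (1 - Q * T * V) <= a + b.
  apply: opnorm_le_fin => [|z fz]; first exact: addr_ge0.
  have [t ut [zt zE]] := fin_supp_ind (1 - Q * T * V) fz.
  pose n j := nrm (coord_restr [set` s j] (y j)).
  pose d := \sum_(j <- t) (z j * (1 - n j)%:C) *: unit_vec k j.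
  pose e := \sum_(j <- t) z j *: Q (T (x j) - y j).
  have -> : (1 - Q * T * V) z = d - e.
    rewrite zE /d /e -sumrN -big_split; apply: eq_bigr => j _.
    rewrite -[RHS]/((z j * (1 - n j)%:C) *: unit_vec k j - z j *: Q (T (x j) - y j)).
    rewrite bop_subE !bop_mulE bop_oneE VE bopB QE -/(n j).
    by rewrite !scalerBr opprB rmorphB/= mulrBr mulr1 scalerBl scalerA addrA subrK.
  rewrite mulrDl; apply: (le_trans (nrmD _ _)); rewrite nrmN; apply: lerD.
    apply: nrm_coord_le => [|g]; first exact: a0.
    rewrite /d coord_sum_unit; last exact: ut.
    case: ifP => _; last by rewrite nrm0; exact: (mulr_ge0 a0 (nrm_ge0 _)).
    rewrite nrmM1 nrm_real mulrC distrC.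
    exact: (ler_wpM2r (nrm_ge0 _) (ha g)).
  apply: (le_trans (nrm_sum _ _)); apply: le_trans (hb z t ut).
  apply: ler_sum => j _; rewrite nrmZ; apply: (ler_wpM2l (nrm_ge0 _)).
  apply: (le_trans (bop_nrm _ _)).
  exact: (ler_piMl (nrm_ge0 _) Q1).
have [B BE Bn] := neumann_left_inverse close ab.
exists (B * Q), V; split; first by rewrite -BE !mulrA.
apply: le_trans Bn; apply: (@le_trans _ _ (bnorm (B * Q))).
  exact: (ler_piMr (bnorm_ge0 _) V1).
apply: (le_trans (bnormM _ _)).
exact: (ler_piMr (bnorm_ge0 _) Q1).
Qed.

End FactorCriterion.

(** * Operators that stay large off every small set *)

Section LargeOperators.
Variables (R : realType) (Gamma : pointedType) (k : coord_kind R).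
Hypothesis Gamma_infinite : infinite_set [set: Gamma].
Local Notation E := (coord_space Gamma k).
Implicit Types (x y z : E) (A B C D L : set Gamma) (g j : Gamma) (T : bop E).
Local Opaque nrm.

(** A unit vector [x0] whose image keeps norm almost one off [C] and [A] is cut off [B] and [B'].
    The removed part does little harm, because [T] sends vectors supported there into the
    coordinates [C] up to [e]. The image, restricted to a tiny set off [A], is [y]. *)
Lemma large_operator_step T (e wj : R) A B : 0 < e -> e < 1 -> bnorm T <= 1 + e ->
  (forall C, small C -> 1 <= bnorm (coord_proj k (~` C) * T)) ->
  admissible Gamma wj -> wj <= 3 * e ->
  small A -> small B ->
  (exists2 B', small B' &
     forall x, fin_supp x -> (forall h, B' h -> x h = 0) -> nrm x <= 1 ->
       1 - 2 * e <= nrm (coord_restr (~` A) (T x)) ->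
       nrm (coord_restr A (T x)) <= wj) ->
  exists (x y : E) (s : seq Gamma),
    [/\ fin_supp x, nrm x <= 1 & forall g, B g -> x g = 0] /\
    [/\ tiny [set g | y g != 0], forall g, A g -> y g = 0 &
        nrm (T x - y) <= 2 * wj] /\
    [/\ uniq s, forall g, g \in s -> y g != 0 &
        `|nrm (coord_restr [set` s] y) - 1| <= 6 * e].
Proof.
move=> e0 e1 Te large awj we sA sB [B' sB' HB'].
have sBB := small_setU Gamma_infinite sB sB'.
have [C sC HC] := ex_small_col Gamma_infinite T sBB e0.
have sCA := small_setU Gamma_infinite sC sA.
have M0 : 0 <= 1 - e by rewrite subr_ge0 ltW.
have M1 : 1 - e < bnorm (coord_proj k (~` (C `|` A)) * T).
  by apply: lt_le_trans (large _ sCA); rewrite gtrBl.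
have [x0 [fx0 nx0 Tx0]] := ex_fin_supp_lt M0 M1.
pose x := coord_restr (~` (B `|` B')) x0.
have xB g : (B `|` B') g -> x g = 0.
  by move=> Bg; rewrite restrE memNset//; apply.
have fx : fin_supp x by exact: fin_supp_restrr.
have x1 : nrm x <= 1 by rewrite -nx0; exact: coord_restr_le.
(* One [e] is lost in the choice of [x0], the other by removing the coordinates in [B] and [B']. *)
have TxA : 1 - 2 * e <= nrm (coord_restr (~` A) (T x)).
  have : nrm (coord_restr (~` (C `|` A)) (T (coord_restr (B `|` B') x0))) <= e.
    apply: (@le_trans _ _ (nrm (coord_restr (~` C) (T (coord_restr (B `|` B') x0))))).
      by apply: restr_sub_le; apply: subsetC => g; left.
    rewrite -!coord_projE -!bop_mulE; apply: (le_trans (bop_nrm _ _)).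
    by rewrite nx0 mulr1; exact: HC.
  move: Tx0; rewrite bop_mulE coord_projE {1}(restr_split (B `|` B') x0) bopD restrD.
  move=> /lt_le_trans/(_ (nrmD _ _)) h1 h2.
  apply: (@le_trans _ _ (nrm (coord_restr (~` (C `|` A)) (T x)))).
    move: h1 h2; rewrite -/x; move: (nrm _) (nrm _) => a b.
    by clear -a b e; lra.
  by apply: restr_sub_le; apply: subsetC => g; right.
have TxA' : nrm (coord_restr A (T x)) <= wj.
  by apply: HB' => // h hB'; apply: xB; right.
pose v := coord_restr (~` A) (T x).
have [D tD hD] := ex_tiny_tail v awj.
pose y := coord_restr D v.
have [D' fD' hD'] := ex_finite_tail y e0.
(* [s] is the exact support of the truncated [y] rather than [D'], so that disjointness of the
   supports of the [y] passes to the [s]. *)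
have [s us sE] := fin_suppP (fin_supp_restr y fD').
have ys : coord_restr [set` s] y = coord_restr D' y.
  apply: coord_ext => g; rewrite restrE; case: ifPn => [/set_mem gs|/negP ns].
    have {}gs : g \in s := gs; rewrite restrE; case: ifPn => // gD.
    by move: gs; rewrite sE restrE (negbTE gD) eqxx.
  apply/esym/eqP; apply: contraT; rewrite -sE => gs.
  by exfalso; apply: ns; rewrite inE.
exists x, y, s; split; [|split]; split => //.
- by move=> g Bg; apply: xB; left.
- have sub : [set g | y g != 0] `<=` D.
    move=> g; rewrite /mkset => yg; apply: contrapT => nD.
    by move: yg; rewrite [y g]restrE memNset// eqxx.
  case: tD => [fD|[cD uG]]; [left|right].
    exact: sub_finite_set sub fD.
  by split=> //; exact: sub_countable (subset_card_le sub) cD.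
- move=> g Ag; rewrite restrE; case: ifP => // _.
  by rewrite restrE memNset//; apply.
- have -> : T x - y = coord_restr A (T x) + coord_restr (~` D) v.
    by rewrite -(restr_compl D) addrA -/y /v -(restr_split A (T x)).
  rewrite mulr_natl mulr2n; apply: (le_trans (nrmD _ _)).
  exact: (lerD TxA' hD).
- move=> g gs; have : coord_restr D' y g != 0 by rewrite -sE.
  by rewrite restrE; case: ifP => // _; rewrite eqxx.
(* From [1 - 2 * e], the cut to [D] takes [wj], at most [3 * e], and the cut to [D'] takes [e]: in
   all [6 * e]. *)
rewrite ys; have hv : nrm v <= nrm y + wj.
  by rewrite {1}(restr_split D v); apply: (le_trans (nrmD _ _)); exact: (lerD (lexx _) hD).
have hy : nrm y <= nrm (coord_restr D' y) + e.
  by rewrite {1}(restr_split D' y); apply: (le_trans (nrmD _ _)); exact: (lerD (lexx _) hD').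
have hT : nrm (coord_restr D' y) <= 1 + e.
  apply: (le_trans (coord_restr_le _ _)); apply: (le_trans (coord_restr_le _ _)).
  apply: (le_trans (coord_restr_le _ _)); apply: (le_trans (bop_nrm _ _)).
  apply: le_trans Te; exact: (ler_piMr (bnorm_ge0 _) x1).
rewrite ler_distl; move: TxA hv hy hT; rewrite -/v.
move: (nrm v) (nrm y) (nrm _) we e0 => a b c; clear -a b c e wj.
by move=> *; apply/andP; split; lra.
Qed.

(** In a maximal family with distinct labels and disjoint supports, the labels form a large set:
    otherwise the supports have small unions, and [large_operator_step] with a new label extends the
    family. Reindexed by [Gamma], the family satisfies [factor_criterion]. *)
Lemma large_operator_factors T (e : R) : 0 < e -> 12 * e < 1 -> bnorm T <= 1 + e ->
  (forall C, small C -> 1 <= bnorm (coord_proj k (~` C) * T)) ->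
  exists V W : bop E, V * T * W = 1 /\ bnorm V * bnorm W <= (1 - 12 * e)^-1.
Proof.
move=> e0 e12 Te large.
have e1 : e < 1 by clear -e0 e12; lra.
have [w [aw sw step]] := ex_error_weights Gamma_infinite e0 Te.
have w3 j : w j <= 3 * e.
  have := sw id [:: j] (unit_vec k j) (fun _ _ => id) isT.
  by rewrite big_seq1 nrm_unit_vec unit_vecE eqxx nrm1C mul1r mulr1.
(* The label [j] assigns the error weight [w j] to the member. Distinct labels keep the sum of the
   errors under control. *)
pose good (t : Gamma * E * E * seq Gamma) :=
  let: (j, x, y, s) := t in
  [/\ fin_supp x, nrm x <= 1, tiny [set g | y g != 0] & nrm (T x - y) <= 2 * w j] /\
  [/\ uniq s, forall g, g \in s -> y g != 0 &
      `|nrm (coord_restr [set` s] y) - 1| <= 6 * e].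
pose lab (t : Gamma * E * E * seq Gamma) := t.1.1.1.
pose xx (t : Gamma * E * E * seq Gamma) := t.1.1.2.
pose yy (t : Gamma * E * E * seq Gamma) := t.1.2.
pose F t : set (nat * Gamma) := [set q | match q.1 with
  | 0%N => q.2 = lab t | 1%N => xx t q.2 != 0 | _ => yy t q.2 != 0 end].
(* [F t] and [F t'] are disjoint when [t] and [t'] have different labels and
   disjointly supported vectors. *)
have [M mM] := ex_maximal_disjoint_subcollection F [set t | good t].
have [MD tM _] := mM.
pose L := [set j | exists2 t, M t & lab t = j].
have /choice[h hP] : forall j, exists t, L j -> M t /\ lab t = j.
  move=> j; have [[t Mt tj]|nL] := pselect (L j); first by exists t.
  by exists (point, 0, 0, [::]).
have hE t : M t -> h (lab t) = t.
  move=> Mt; have Lt : L (lab t) by exists t.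
  have [Mh hl] := hP _ Lt; apply: tM => //.
  by exists (0%N, lab t); split; rewrite /F /mkset//= hl.
have nL : ~ small L.
  move=> sL; have [j nj] := small_compl_nonempty sL.
  pose A := \bigcup_(i in L) [set g | yy (h i) g != 0].
  pose B := \bigcup_(i in L) [set g | xx (h i) g != 0].
  have sA : small A.
    apply: small_bigcup => // i /hP[/MD + _].
    by rewrite /yy; case: (h i) => [[[? ?] ?] ?] [[]].
  have sB : small B.
    apply: small_bigcup => // i /hP[/MD + _].
    by rewrite /xx; case: (h i) => [[[? ?] ?] ?] [[fx _ _ _] _]; left.
  have [x [y [s [[fx x1 xB] [[ty yA Txy] [us ys sn]]]]]] :=
    large_operator_step e0 e1 Te large (aw j) (w3 j) sA sB (step j A sA).
  have [||t Mt [[[|[|n]] g] [/= h1 h2]]] := maximal_disjointP (i := (j, x, y, s)) mM.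
  - by split; split.
  - by exists (0%N, j).
  - by apply: nj; exists t => //; rewrite -h1.
  - move: h2; rewrite /F /mkset /xx /= xB ?eqxx//; exists (lab t); first by exists t.
    by rewrite hE.
  - move: h2; rewrite /F /mkset /yy /= yA ?eqxx//; exists (lab t); first by exists t.
    by rewrite hE.
have /card_inj_le[f [fL fi]] : [set: Gamma] #<= L.
  by apply: contrapT => nGL; apply: nL; apply/smallP.
have {}fi : injective f by move=> i j; exact: fi.
have hf i : M (h (f i)) /\ lab (h (f i)) = f i by apply: hP; exact: fL.
have inj i j : h (f i) = h (f j) -> i = j.
  by move=> hij; apply: fi; rewrite -(proj2 (hf i)) hij (proj2 (hf j)).
have goodf i : good (h (f i)) by apply: MD; exact: (proj1 (hf i)).
(* The first [6 * e] is the defect of the norms of the [y]. The second is twice the bound [3 * e] on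
   the weighted sums, each error being at most [2 * w (f i)]. *)
have [|||||||||||V [W [VTW VW]]] := @factor_criterion R Gamma k T
    (fun i => xx (h (f i))) (fun i => yy (h (f i))) (fun i => (h (f i)).2)
    (6 * e) (6 * e).
- by move=> i; move: (goodf i); rewrite /xx; case: (h (f i)) => [[[? ?] ?] ?] [[]].
- by move=> i; move: (goodf i); rewrite /xx; case: (h (f i)) => [[[? ?] ?] ?] [[]].
- move=> i j g xi xj; apply: inj; apply: tM; [exact: (proj1 (hf i))|exact: (proj1 (hf j))|].
  by exists (1%N, g).
- by move=> i; move: (goodf i); case: (h (f i)) => [[[? ?] ?] ?] [_ []].
- move=> i j g gi yj; apply: inj; apply: tM; [exact: (proj1 (hf i))|exact: (proj1 (hf j))|].
  exists (2%N, g); split=> //; rewrite /F /mkset /=.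
  by move: (goodf i) gi; rewrite /yy; case: (h (f i)) => [[[? ?] ?] ?] [_ [_ + _]]; apply.
- move=> i j g gi gj; apply: inj; apply: tM; [exact: (proj1 (hf i))|exact: (proj1 (hf j))|].
  exists (2%N, g); split; rewrite /F /mkset /=.
    by move: (goodf i) gi; rewrite /yy; case: (h (f i)) => [[[? ?] ?] ?] [_ [_ + _]]; apply.
  by move: (goodf j) gj; rewrite /yy; case: (h (f j)) => [[[? ?] ?] ?] [_ [_ + _]]; apply.
- by move=> i; move: (goodf i); rewrite /yy; case: (h (f i)) => [[[? ?] ?] ?] [_ []].
- move=> z t ut; apply: (@le_trans _ _ (2 * \sum_(i <- t) nrm (z i) * w (f i))).
    rewrite mulr_sumr; apply: ler_sum => i _; rewrite mulrCA.
    apply: (ler_wpM2l (nrm_ge0 _)); move: (goodf i) (proj2 (hf i)).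
    rewrite /xx /yy /lab; case: (h (f i)) => [[[j x] y] s] [[_ _ _ hj] _] /= <-.
    exact: hj.
  have := sw f t z fi ut; move: (\sum_(i <- t) _) (nrm z) => a b; clear -e.
  by move=> h; rewrite (_ : 6 * e * b = 2 * (3 * e * b)) ?ler_pM2l//; ring.
- by clear -e0; lra.
- by clear -e0; lra.
- by clear -e12; lra.
exists V, W; split=> //; apply: (le_trans VW).
by rewrite (_ : 6 * e + 6 * e = 12 * e)//; ring.
Qed.

End LargeOperators.

(** * From norm-one factorizations to ultrapowers *)

Section NormOneFactorization.
Variables (R : realType) (A : banachAlgType R).

Definition nearly_isometric_factorization : Prop :=
  forall (a : A) (e : R), bnorm a = 1 -> 0 < e ->
    exists b c : A, b * a * c = 1 /\ bnorm b * bnorm c <= 1 + e.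

Hypothesis HA : nearly_isometric_factorization.

Lemma Cpi_eq1 (a : A) : bnorm a = 1 -> Cpi a = 1%E.
Proof.
move=> a1; apply/eqP; rewrite eq_le; apply/andP; split.
  apply/lee_addgt0Pr => e e0; have [b [c [bac bc]]] := HA a1 e0.
  apply: (@le_trans _ _ (bnorm b * bnorm c)%:E).
    by apply: ereal_inf_lbound; exists b, c.
  by rewrite -EFinD lee_fin.
apply: le_ereal_inf_tmp => _ [b [c [bac ->]]]; rewrite lee_fin.
rewrite -(@bnorm1 R A) -bac; apply: (le_trans (bnormM _ _)).
apply: (ler_wpM2r (bnorm_ge0 _)); apply: (le_trans (bnormM _ _)).
by rewrite a1 mulr1.
Qed.

Lemma bnorm_gt0 (a : A) : a != 0 -> 0 < bnorm a :> R.
Proof.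
move=> a0; rewrite lt_neqAle bnorm_ge0 andbT eq_sym.
by apply: contra_neq a0; exact: bnorm_eq0.
Qed.

(** Rescaling moves the norm of [c] into [b]. The bounds then depend on [bnorm a] only, so that
    factors chosen index by index form bounded families. *)
Lemma bounded_factorization (a : A) : a != 0 -> exists b c : A,
  [/\ b * a * c = 1, bnorm b <= 2 / bnorm a :> R & bnorm c <= 1 :> R].
Proof.
move=> a0; have na := bnorm_gt0 a0; set n := bnorm a in na *.
have nZ (r : R) (x : A) : 0 <= r -> bnorm (r%:C *: x) = r * bnorm x.
  by move=> r0; rewrite bnormZ nrm_real ger0_norm.
have a1 : bnorm ((n^-1)%:C *: a) = 1.
  by rewrite nZ ?invr_ge0 ?(ltW na)// mulVf// gt_eqF.
have [b [c [bac bc]]] := HA a1 ltr01.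
have c0 : c != 0.
  by apply/eqP => c0; move: bac; rewrite c0 mulr0 => /esym/eqP; rewrite oner_eq0.
have nc := bnorm_gt0 c0; set m := bnorm c in nc bc *.
exists ((m / n)%:C *: b), ((m^-1)%:C *: c); split.
- rewrite -scalerAr -!scalerAl scalerA -rmorphM/= mulrA mulVf ?gt_eqF// mul1r.
  by rewrite -bac -scalerAr -scalerAl.
- rewrite nZ; last by rewrite divr_ge0 ?ltW.
  rewrite mulrAC ler_pM2r ?invr_gt0// mulrC; apply: (le_trans bc).
  by rewrite -[2]natr1.
- by rewrite nZ ?invr_ge0 ?(ltW nc)// mulVf// gt_eqF.
Qed.

Variables (I : pointedType) (U : set_system I) (UU : UltraFilter U).

(** A representative of a nonzero class stays above some [e] on a member of [U]. The factors chosen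
    there have norms at most [2 / e] and 1. *)
Lemma ultrapower_factorization (x : ultrapower A UU) : x != 0 ->
  exists b c : ultrapower A UU, b * x * c = 1.
Proof.
move=> x0; pose f : linf I A := qrepr x.
have fx : qproj (null_ideal A UU) f = x by exact: qreprK.
have [e [e0 Ue]] : exists e : R, 0 < e /\ ~ U [set i | bnorm (f i) <= e].
  apply: contrapT => /forallNP H; move/eqP: x0; apply.
  rewrite -fx -(qproj0 (null_ideal A UU)); apply/qprojP; rewrite subr0.
  apply/null_familyP => e e0; apply: contrapT => Ue.
  by apply: (H e).
have Ue' : U [set i | e < bnorm (f i)].
  have [//|h] := in_ultra_setVsetC [set i | bnorm (f i) <= e] UU.
  by apply: filterS h => i /=; rewrite /setC/= => /negP; rewrite -ltNge.
have /choice[bc bcP] : forall i, exists bc : A * A,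
    [/\ e < bnorm (f i) -> bc.1 * f i * bc.2 = 1,
        bnorm bc.1 <= 2 / e & bnorm bc.2 <= 1].
  move=> i; have [ef|fe] := ltP e (bnorm (f i)); last first.
    by exists (0, 0); split=> //=; rewrite bnorm0 ?divr_ge0 ?(ltW e0).
  have fi0 : f i != 0.
    by apply: contraTneq ef => ->; rewrite bnorm0 -leNgt ltW.
  have [b [c [bfc hb hc]]] := bounded_factorization fi0.
  exists (b, c); split=> //=; apply: (le_trans hb).
  by rewrite ler_pM2l// lef_pV2 ?posrE ?(ltW ef)// (lt_trans e0).
have bP : (fun i => (bc i).1) \in @linf_pred R I A.
  by apply/asboolP; exists (2 / e) => i; case: (bcP i).
have cP : (fun i => (bc i).2) \in @linf_pred R I A.
  by apply/asboolP; exists 1 => i; case: (bcP i).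
exists (qproj (null_ideal A UU) (Linf bP)), (qproj (null_ideal A UU) (Linf cP)).
rewrite -fx -(qprojM _ (Linf bP) f) -(qprojM _ _ (Linf cP)).
rewrite -[1]/(qproj (null_ideal A UU) 1).
apply/qprojP/null_familyP => d d0; apply: filterS Ue' => i ei.
rewrite /mkset; case: (bcP i) => /(_ ei) h _ _.
apply: le_trans (ltW d0); rewrite le_eqVlt; apply/orP; left; apply/eqP.
transitivity (bnorm ((bc i).1 * f i * (bc i).2 - 1) : R); first by [].
by rewrite h subrr bnorm0.
Qed.

(** An isomorphism with the complex numbers would send the class of the constant family [p] to 0 or
    1, the only idempotents of a field. By injectivity the class itself would be 0 or 1, but a
    constant null family is zero. *)
Lemma ultrapower_purely_infinite (p : A) : p * p = p -> p != 0 -> p != 1 ->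
  purely_infinite (ultrapower A UU).
Proof.
move=> pp p0 p1; split; last exact: ultrapower_factorization.
move=> [f [bf _]]; have finj := bij_inj bf.
have cP (a : A) : (fun=> a : A) \in @linf_pred R I A.
  by apply/asboolP; exists (bnorm a) => i.
pose q : ultrapower A UU := qproj (null_ideal A UU) (Linf (cP p)).
have nullP (g : linf I A) (a : A) : (forall i, g i = a) -> null_family U g -> a = 0.
  move=> ga /null_familyP H; apply: (@bnorm_eq0 R); apply/eqP.
  rewrite eq_le bnorm_ge0 andbT; apply/ler_addgt0Pl => e e0; rewrite addr0.
  by have /filter_ex[i /=] := H e e0; rewrite ga.
have qq : q * q = q by rewrite /q -qprojM; congr qproj; exact: linf_ext.
have : (f q : R[i]) * (f q - 1) = 0.
  by rewrite mulrBr mulr1 -[X in X - _](rmorphM f) qq subrr.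
move=> /eqP; rewrite mulf_eq0 subr_eq0 => /orP[] /eqP fq.
  have : q = 0 by apply: finj; rewrite fq rmorph0.
  rewrite /q -(qproj0 (null_ideal A UU)) => /qprojP; rewrite subr0.
  by move=> /nullP => /(_ p (fun=> erefl)) /eqP; exact/negP.
have : q = 1 by apply: finj; rewrite fq rmorph1.
move=> /qprojP/nullP => /(_ (p - 1) (fun=> erefl)) /eqP.
by rewrite subr_eq0; exact/negP.
Qed.

End NormOneFactorization.

(** * The ideal of kappa-compact operators and its quotient *)

Section KappaCompact.
Variables (R : realType) (Gamma : pointedType) (k : coord_kind R).
Hypothesis Gamma_infinite : infinite_set [set: Gamma].
Local Notation E := (coord_space Gamma k).
Local Notation kc := (@kcompact R Gamma k Gamma [set: Gamma]).
Implicit Types (A B C : set Gamma) (S T : bop E).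
Local Opaque nrm.

Lemma kcompactP S : kc S <-> forall e : R, 0 < e ->
  exists2 A, small A & bnorm (coord_proj k (~` A) * S) <= e.
Proof.
have eqp A : S - coord_proj k A * S = coord_proj k (~` A) * S.
  by rewrite -(projC k A) mulrBl mul1r.
split=> H e /H[A sA hA]; exists A; [exact: sA| |exact: sA|].
  by rewrite -eqp; exact: hA.
by rewrite eqp; exact: hA.
Qed.

Lemma proj_mul_mono A B S : A `<=` B ->
  bnorm (coord_proj k A * S) <= bnorm (coord_proj k B * S) :> R.
Proof.
move=> AB; apply: opnorm_le => [|x]; first exact: bnorm_ge0.
apply: le_trans (bop_nrm (coord_proj k B * S) x).
by rewrite !bop_mulE !coord_projE; exact: restr_sub_le.
Qed.

Lemma proj_mulP A B : coord_proj k A * coord_proj k B = coord_proj k (A `&` B).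
Proof. by apply: bop_ext => x; exact: restr_restr. Qed.

Lemma small0 : small (set0 : set Gamma).
Proof. by apply: tiny_small => //; left. Qed.

Lemma kcompact0 : kc 0.
Proof.
apply/kcompactP => e e0; exists set0; first exact: small0.
by rewrite mulr0 bnorm0 ltW.
Qed.

Lemma kcompactD S T : kc S -> kc T -> kc (S + T).
Proof.
move=> /kcompactP hS /kcompactP hT; apply/kcompactP => e e0.
have e2 : 0 < e / 2 by rewrite divr_gt0.
have [A sA hA] := hS _ e2; have [B sB hB] := hT _ e2.
exists (A `|` B); first exact: small_setU.
rewrite mulrDr; apply: (le_trans (bnormD _ _)); rewrite [leRHS]splitr.
apply: lerD.
  by apply: le_trans hA; apply: proj_mul_mono; apply: subsetC => g; left.
by apply: le_trans hB; apply: proj_mul_mono; apply: subsetC => g; right.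
Qed.

Lemma kcompactMr T S : kc S -> kc (S * T).
Proof.
move=> /kcompactP hS; apply/kcompactP => e e0.
have T1 : 0 < bnorm T + 1 :> R by apply: ltr_wpDl => //; exact: bnorm_ge0.
have [A sA hA] := hS _ (divr_gt0 e0 T1); exists A => //.
rewrite mulrA; apply: (le_trans (bnormM _ _)).
move: hA; rewrite (ler_pdivlMr _ _ T1); apply: le_trans.
by apply: (ler_wpM2l (bnorm_ge0 _)); rewrite lerDl.
Qed.

(** [S] lives on a small set [A] up to a small error, and by [ex_small_col] the operator [T] sends
    vectors supported in [A] into a small set [C], again up to a small error. *)
Lemma kcompactMl T S : kc S -> kc (T * S).
Proof.
move=> /kcompactP hS; apply/kcompactP => e e0.
have e2 : 0 < e / 2 by rewrite divr_gt0.
have T1 : 0 < bnorm T + 1 :> R by apply: ltr_wpDl => //; exact: bnorm_ge0.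
have S1 : 0 < bnorm S + 1 :> R by apply: ltr_wpDl => //; exact: bnorm_ge0.
have [A sA hA] := hS _ (divr_gt0 e2 T1).
have [C sC hC] := ex_small_col Gamma_infinite T sA (divr_gt0 e2 S1).
exists C => //.
have -> : coord_proj k (~` C) * (T * S) =
    coord_proj k (~` C) * T * coord_proj k A * S +
    coord_proj k (~` C) * T * (coord_proj k (~` A) * S).
  rewrite -[X in X + _]mulrA -mulrDr -mulrDl -(projC k A).
  by rewrite [_ + (1 - _)]addrC subrK mul1r mulrA.
apply: (le_trans (bnormD _ _)); rewrite [leRHS]splitr; apply: lerD.
  apply: (le_trans (bnormM _ _)); move: hC; rewrite (ler_pdivlMr _ _ S1); apply: le_trans.
  by apply: (ler_wpM2l (bnorm_ge0 _)); rewrite lerDl.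
apply: (le_trans (bnormM _ _)); move: hA; rewrite (ler_pdivlMr _ _ T1); apply: le_trans.
have le1 : bnorm (coord_proj k (~` C) * T) <= bnorm T + 1 :> R.
  apply: (le_trans (bnormM _ _)).
  apply: (le_trans (ler_piMl (bnorm_ge0 _) (proj_norm_le _ _))).
  by rewrite lerDl.
by rewrite [leRHS]mulrC; exact: (ler_wpM2r (bnorm_ge0 _) le1).
Qed.

Lemma kcompact_closed S :
  (forall e : R, 0 < e -> exists2 T, kc T & bnorm (S - T) < e) -> kc S.
Proof.
move=> H; apply/kcompactP => e e0; have e2 : 0 < e / 2 by rewrite divr_gt0.
have [T /kcompactP/(_ _ e2)[A sA hA] hT] := H _ e2.
exists A => //; rewrite -[S](subrK T) mulrDr; apply: (le_trans (bnormD _ _)).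
rewrite [leRHS]splitr; apply: lerD; last exact: hA.
apply: (le_trans (bnormM _ _)); apply: le_trans (ltW hT).
exact: (ler_piMl (bnorm_ge0 _) (proj_norm_le _ _)).
Qed.

(** At a coordinate of [A] missed by [B], the unit vector is fixed by the projection cut off [B].
    Hence an error of one half forces [A] into [B]. *)
Lemma kcompact_proj A : kc (coord_proj k A) <-> small A.
Proof.
split=> [/kcompactP/(_ (2^-1)) []|sA]; first by rewrite invr_gt0.
  move=> B sB; rewrite proj_mulP => hB; apply: small_sub sB => g Ag.
  apply: contrapT => nB; have := bop_nrm (coord_proj k (~` B `&` A)) (unit_vec k g).
  rewrite coord_projE restr_id; last first.
    move=> h hA; rewrite unit_vecE; case: eqP => // hg.
    by exfalso; apply: hA; rewrite hg; split.
  rewrite nrm_unit_vec mulr1 => h; have := le_trans h hB.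
  by rewrite leNgt invf_lt1// ltr1n.
apply/kcompactP => e e0; exists A => //; rewrite proj_mulP setICl.
suff -> : coord_proj k (set0 : set Gamma) = 0 by rewrite bnorm0 ltW.
by apply: bop_ext => x; exact: restr_eq0.
Qed.

Lemma kcompact_proper : ~ kc 1.
Proof.
have <- : coord_proj k [set: Gamma] = 1.
  by apply: bop_ext => x; apply: restr_id => g h; exfalso; exact: (h I).
by move=> /kcompact_proj /smallP; apply; exact: card_lexx.
Qed.

Definition kcompact_ideal : closedIdeal (bop E) := ClosedIdeal kcompact0
  kcompactD kcompactMl (fun T S => @kcompactMr T S) kcompact_closed kcompact_proper.

Local Notation pi := (qproj kcompact_ideal).

Lemma qproj_proj_mul A T : small A -> pi (coord_proj k (~` A) * T) = pi T.
Proof.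
move=> sA; apply/qprojP; rewrite -projC mulrBl mul1r addrAC subrr add0r -mulNr.
apply: kcompactMr; rewrite -mulN1r; apply: kcompactMl.
exact/kcompact_proj.
Qed.

(** Off a suitable small set [A], the operator [T] is close to a representative [T'] of almost
    minimal norm. The part [S] of [T] off [A] thus has norm at most [1 + e] and still has quotient
    norm 1, so it stays large off every small set. The identity is factored exactly, not only modulo
    the ideal. *)
Lemma factor_norm_one T (d : R) : bnorm (pi T) = 1 -> 0 < d ->
  exists V W : bop E, V * T * W = 1 /\ bnorm V * bnorm W <= 1 + d.
Proof.
move=> T1 d0; have d1 : 0 < 1 + d by rewrite addr_gt0.
(* Chosen so that the inverse of [1 - 12 * e] is [1 + d]. *)
pose e := d / (12 * (1 + d)).
have e0 : 0 < e by rewrite divr_gt0// mulr_gt0.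
have e12 : 12 * e = 1 - (1 + d)^-1 by rewrite /e; field; rewrite gt_eqF.
have e2 : 0 < e / 2 by rewrite divr_gt0.
have [T' [T'E nT']] := qnorm_approx (pi T) e2.
have /qprojP/kcompactP/(_ _ e2)[A sA hA] := T'E.
pose S := coord_proj k (~` A) * T.
have large C : small C -> 1 <= bnorm (coord_proj k (~` C) * S) :> R.
  move=> sC; rewrite -T1 -(qproj_proj_mul T sA) -(qproj_proj_mul _ sC).
  exact: qnorm_le.
have nS : bnorm S <= 1 + e.
  have -> : S = coord_proj k (~` A) * T' - coord_proj k (~` A) * (T' - T).
    by rewrite mulrBr opprB addrC subrK.
  apply: (le_trans (bnormD _ _)); rewrite bnormN [e in leRHS]splitr addrA.
  apply: lerD; last exact: hA.
  apply: (le_trans (bnormM _ _)).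
  apply: (le_trans (ler_piMl (bnorm_ge0 _) (proj_norm_le _ _))).
  by rewrite -[X in X + _]T1; exact: nT'.
have e121 : 12 * e < 1 by rewrite e12 gtrBl invr_gt0.
have [V [W [VSW nVW]]] := large_operator_factors Gamma_infinite e0 e121 nS large.
exists (V * coord_proj k (~` A)), W; split; first by rewrite -VSW /S !mulrA.
apply: le_trans (_ : bnorm V * bnorm W <= _).
  apply: (ler_wpM2r (bnorm_ge0 _)); apply: (le_trans (bnormM _ _)).
  exact: (ler_piMr (bnorm_ge0 _) (proj_norm_le _ _)).
by apply: (le_trans nVW); rewrite e12 opprB addrC subrK invrK.
Qed.

Lemma kcompact_quot_factorization : nearly_isometric_factorization (quot kcompact_ideal).
Proof.
move=> a d; have [T <-] := qprojK a => T1 d0.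
have [V [W [VTW nVW]]] := factor_norm_one T1 d0.
exists (pi V), (pi W); split; first by rewrite -(qprojM _ V T) -(qprojM _ _ W) VTW.
by apply: le_trans nVW; apply: ler_pM; rewrite ?bnorm_ge0//; exact: qnorm_le.
Qed.

(** A proper ideal contains no operator through which the identity factors. Conversely, an operator
    outside the ideal has nonzero quotient norm and can be scaled to quotient norm 1 for
    [factor_norm_one]. *)
Lemma non_factoring_kcompact : non_factoring E = kc.
Proof.
apply/seteqP; split=> [T nT|T kT [V [W VTW]]]; last first.
  apply: kcompact_proper; rewrite -VTW; apply: kcompactMr; exact: kcompactMl.
apply: contrapT => nkT; apply: nT.
have n0 : pi T != 0.
  by apply/eqP => T0; apply: nkT; rewrite -[T]subr0; apply/(@qprojP _ _ kcompact_ideal); rewrite qproj0.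
have np := bnorm_gt0 n0; set n := bnorm (pi T) in np.
have T1 : bnorm (pi ((n^-1)%:C *: T)) = 1.
  by rewrite qprojZ bnormZ nrm_real ger0_norm ?invr_ge0 ?(ltW np)// mulVf// gt_eqF.
have [V [W [VTW _]]] := factor_norm_one T1 ltr01.
exists ((n^-1)%:C *: V), W; rewrite -VTW.
by rewrite -scalerAr -!scalerAl.
Qed.

End KappaCompact.

(** * A nontrivial idempotent of the quotient, and the ultrapowers *)

Lemma ex_nontrivial_idempotent (R : realType) (Gamma : pointedType)
    (k : coord_kind R) (Gamma_infinite : infinite_set [set: Gamma]) :
  exists p : quot (kcompact_ideal k Gamma_infinite), [/\ p * p = p, p != 0 & p != 1].
Proof.
set K := kcompact_ideal k Gamma_infinite.
have [A [nA nAc]] := ex_large_colarge Gamma_infinite.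
have nz B : ~ small B -> qproj K (coord_proj k B) != 0.
  move=> nB; apply/eqP => PB; apply/nB/(kcompact_proj k).
  by rewrite -[coord_proj k B]subr0; apply/(@qprojP _ _ K); rewrite qproj0.
exists (qproj K (coord_proj k A)); split; [|exact: nz|].
  by rewrite -(qprojM _ (coord_proj k A)) proj_mulP setIid.
rewrite eq_sym -subr_eq0 -[1]/(qproj K 1) -(qprojB _ 1 (coord_proj k A)) projC.
exact: nz.
Qed.

Theorem proposition6p13 (R : realType) (Gamma : pointedType)
    (k : coord_kind R) (Gamma_infinite : infinite_set [set: Gamma]) :
  let E : banachType R := coord_space Gamma k in
  [/\ non_factoring E = kcompact k [set: Gamma],
      exists2 K : closedIdeal (bop E),
        ideal_set K = kcompact k [set: Gamma] &
        forall a : quot K, bnorm a = 1 -> Cpi a = 1%E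
    & exists2 M : closedIdeal (bop E),
        ideal_set M = non_factoring E &
        forall (I : pointedType) (U : set_system I) (UU : UltraFilter U),
          countably_incomplete U -> purely_infinite (ultrapower (quot M) UU)].
Proof.
move=> E; have NK := non_factoring_kcompact k Gamma_infinite.
pose K := kcompact_ideal k Gamma_infinite.
have HK := @kcompact_quot_factorization R Gamma k Gamma_infinite.
split; first exact: NK.
  by exists K => // a a1; exact: (Cpi_eq1 HK a1).
exists K => [|I U UU _]; first exact: (esym NK).
have [p [pp p0 p1]] := ex_nontrivial_idempotent k Gamma_infinite.
exact: (ultrapower_purely_infinite HK UU pp p0 p1).
Qed.
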